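(* Let $d\in\mathbb{N}$, $\alpha\in(0,1)$, $\beta\in(0,2)$. Assume that the spectral measure $\mu$ has a strictly positive density and that $\omega_\mu$ is strictly positive and $(d+1+[\beta])$-times continuously differentiable on $S^{d-1}$. Let $\kappa_1=\frac{d}{d-\beta}$ if $d>\beta$ and $\kappa_1=\infty$ otherwise. Then: (1) $Z\in C((0,\infty);L_p(\mathbb{R}^d))$ for $1\le p<\kappa_1$. Further, for each $\epsilon>0$ there exists a constant $C>0$ depending on $\epsilon,d,p,\alpha,\beta$ such that $$\|Z(t,\cdot)-Z(s,\cdot)\|_p\le C|t-s|$$ holds for all $t,s\ge\epsilon$. In the case $d<\beta$, this estimate remains true for $p=\infty$. (2) For any $v\in L_p(\mathbb{R}^d)$ with $1\le p<\infty$, we have $$\lim_{t\to0}\|Z(t,\cdot)\star v-v\|_p=0.$$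
   Context: $[\beta]$ is the largest integer not exceeding $\beta$; $\star$ denotes convolution on $\mathbb{R}^d$. Let $\mu$ (the spectral measure, fixed) be a centrally symmetric finite non-negative Borel measure on the unit sphere $S^{d-1}\subset\mathbb{R}^d$. Saying that $\mu$ has a density means $\mu(d\eta)=\varrho(\eta)\,d\eta$ with $\varrho$ continuous on $S^{d-1}$. Put $\omega_\mu(\theta)=\int_{S^{d-1}}|\theta\cdot\eta|^\beta\mu(d\eta)$ for $\theta\in S^{d-1}$, and $\psi(\xi)=\|\xi\|^\beta\omega_\mu(\xi/\|\xi\|)$ for $\xi\in\mathbb{R}^d$, $\psi(0)=0$. Let $G(t,x)=(2\pi)^{-d}\int_{\mathbb{R}^d}e^{ix\cdot\xi}e^{-t\psi(\xi)}d\xi$, the Green function of $\partial_t v+\Psi_\beta(-i\nabla)v=0$, $v|_{t=0}=\delta_0$, where $\Psi_\beta(-i\nabla)v=\mathcal{F}^{-1}[\psi\,\mathcal{F}v]$. Let $G_\alpha(t,s)$ be the Green function of $\partial_t v(t,s)+\frac{d^\alpha}{ds^\alpha}v(t,s)=0$, $G_\alpha(0,s)=\delta(s)$, where $\frac{d^\alpha}{ds^\alpha}f(s)=\frac{1}{\Gamma(-\alpha)}\int_0^\infty\frac{f(s-\tau)-f(s)}{\tau^{1+\alpha}}d\tau$ (so $G_\alpha(1,\cdot)$ is the one-sided $\alpha$-stable density with Laplace transform $e^{-\sigma^\alpha}$). For $t>0$, $x\in\mathbb{R}^d$ define $$Z(t,x)=\frac1\alpha\int_0^\infty G(t^\alpha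 s,x)s^{-1-\frac1\alpha}G_\alpha(1,s^{-\frac1\alpha})ds.$$ *)

(* Defs.v *)
From HB Require Import structures.
From mathcomp Require Import all_boot all_order all_algebra.
From mathcomp Require Import complex.
From mathcomp Require Import all_classical all_reals all_analysis.
From mathcomp Require Import measurable_realfun.
From mathcomp Require Import lra.

Set Implicit Arguments.
Unset Strict Implicit.
Unset Printing Implicit Defensive.

Import Order.TTheory GRing.Theory Num.Theory.
Import numFieldNormedType.Exports.

Local Open Scope classical_set_scope.
Local Open Scope ring_scope.
Local Open Scope complex_scope.

Section borel_rV.
Context {R : realType} {n : nat}.

Let borel_rV : set (set 'rV[R]_n) := <<s open >>.

Let borel_rV0 : borel_rV set0.
Proof. exact: sigma_algebra0. Qed.

Let borel_rVC A : borel_rV A -> borel_rV (~` A).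
Proof. exact: sigma_algebraC. Qed.

Let borel_rV_bigcup (F : (set 'rV[R]_n)^nat) :
  (forall i, borel_rV (F i)) -> borel_rV (\bigcup_i F i).
Proof. exact: sigma_algebra_bigcup. Qed.

HB.instance Definition _ :=
  @isMeasurable.Build (sigma_display (@open 'rV[R]_n)) 'rV[R]_n borel_rV
    borel_rV0 borel_rVC borel_rV_bigcup.

End borel_rV.

Section borel_rV_theory.
Context {R : realType}.

Lemma open_measurable_rV n (A : set 'rV[R]_n) : open A -> measurable A.
Proof. by move=> oA; apply: sub_sigma_algebra. Qed.

Lemma continuous_measurable_rV n (f : 'rV[R]_n -> R) :
  continuous f -> measurable_fun setT f.
Proof.
move=> /continuousP cf.
apply: (measurability _ (RGenOpens.measurableE R)) => _ [_ [a [b ->]] <-].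
rewrite setTI; apply: (@open_measurable_rV n); apply: cf; exact: interval_open.
Qed.

Lemma measurable_coord_rV n (i : 'I_n) :
  measurable_fun setT (fun x : 'rV[R]_n => x ord0 i).
Proof. by apply: continuous_measurable_rV => x; exact: coord_continuous. Qed.

Let box n (ab : 'rV[rat]_n * 'rV[rat]_n) : set 'rV[R]_n :=
  [set x | forall i, ratr (ab.1 ord0 i) < x ord0 i < ratr (ab.2 ord0 i)].

Let open_bigcup_box n (A : set 'rV[R]_n) : open A ->
  A = \bigcup_(ab in [set ab | box ab `<=` A]) box ab.
Proof.
move=> oA; apply/seteqP; split=> [x Ax|x [ab /= abA]]; last exact: abA.
have [P Px PA] : nbhs x A by exact: open_nbhs_nbhs.
have ball_coord i : exists e : {posnum R}, ball (x ord0 i) e%:num `<=` P ord0 i.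
  have := Px ord0 i; rewrite -nbhs_ballE => -[e /= e0 eP].
  by exists (PosNum e0).
have [e eP] := choice ball_coord.
have rat_below i : exists q : rat, x ord0 i - (e i)%:num < ratr q < x ord0 i.
  have /rat_in_itvoo[q] : x ord0 i - (e i)%:num < x ord0 i.
    by rewrite ltrBlDr ltrDl.
  by rewrite in_itv/= => ?; exists q.
have rat_above i : exists q : rat, x ord0 i < ratr q < x ord0 i + (e i)%:num.
  have /rat_in_itvoo[q] : x ord0 i < x ord0 i + (e i)%:num by rewrite ltrDl.
  by rewrite in_itv/= => ?; exists q.
have [a ha] := choice rat_below; have [b hb] := choice rat_above.
have abA : box (\row_i a i, \row_i b i) `<=` A.
  move=> y /= aby; apply: PA => i j; rewrite (ord1 i).
  apply: eP; rewrite /ball/= ltr_norml.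
  have := aby j; rewrite /= !mxE => /andP[ay yb].
  have /andP[ea _] := ha j; have /andP[_ be] := hb j.
  have h1 := lt_trans ea ay; have h2 := lt_trans yb be.
  by apply/andP; split; lra.
exists (\row_i a i, \row_i b i) => // i /=; rewrite !mxE.
by have /andP[_ ->] := ha i; have /andP[-> _] := hb i.
Qed.

Lemma measurable_fun_rVP d (T : measurableType d) n (f : T -> 'rV[R]_n) :
  measurable_fun setT f <->
  forall i, measurable_fun setT (fun t => f t ord0 i).
Proof.
split=> [mf i|mf].
  exact: (measurableT_comp (measurable_coord_rV i) mf).
apply: (@measurability _ _ _ _ setT f (@open 'rV[R]_n)) => // _ [A oA <-].
rewrite setTI [A in f @^-1` A]open_bigcup_box// preimage_bigcup bigcup_mkcond.
apply: countable_bigcupT_measurable => // ab; case: ifPn => // _.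
rewrite (_ : _ @^-1` _ = \bigcap_(i in [set: 'I_n])
    ((fun t => f t ord0 i) @^-1`
      [set` `]ratr (ab.1 ord0 i), ratr (ab.2 ord0 i)[%R])); last first.
  apply/seteqP; split=> t /= ht i; first by move=> _; rewrite /= in_itv/=.
  by have := ht i Logic.I; rewrite /= in_itv/=.
apply: fin_bigcap_measurable => // i _.
by rewrite -[X in measurable X]setTI; apply: mf.
Qed.

End borel_rV_theory.

Section lebesgue_rV.
Context {R : realType}.

Definition cons_rV n (x : measurableTypeR R * 'rV[R]_n) : 'rV[R]_n.+1 :=
  row_mx x.1%:M x.2.

Definition uncons_rV n (x : 'rV[R]_n.+1) : measurableTypeR R * 'rV[R]_n :=
  (x ord0 ord0, rsubmx (x : 'rV[R]_(1 + n))).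

Lemma cons_rVK n : cancel (@cons_rV n) (@uncons_rV n).
Proof.
move=> [x y]; rewrite /uncons_rV /cons_rV/=; congr (_, _).
  transitivity ((row_mx x%:M y : 'rV[R]_(1 + n)) ord0 (lshift n ord0)).
    by congr (row_mx _ _ _ _); exact: val_inj.
  by rewrite row_mxEl mxE eqxx mulr1n.
by rewrite row_mxKr.
Qed.

Lemma uncons_rVK n : cancel (@uncons_rV n) (@cons_rV n).
Proof.
move=> x; rewrite /uncons_rV /cons_rV/=.
rewrite (_ : _%:M = lsubmx (x : 'rV[R]_(1 + n))); first exact: (@hsubmxK R 1 1 n).
apply/rowP => i; rewrite (ord1 i) !mxE eqxx mulr1n.
by congr (x _ _); apply: val_inj.
Qed.

Lemma measurable_cons_rV n : measurable_fun setT (@cons_rV n).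
Proof.
apply/measurable_fun_rVP => i; rewrite /cons_rV.
case: (@split_ordP 1 n i) => j ->.
  rewrite (_ : (fun t => _) = fst); first exact: measurable_fst.
  apply/funext => t; apply: etrans (row_mxEl _ _ _ _) _.
  by rewrite (ord1 j) mxE eqxx mulr1n.
rewrite (_ : (fun t => _) = (fun x : 'rV[R]_n => x ord0 j) \o snd).
  by apply: measurableT_comp => //; exact: measurable_coord_rV.
by apply/funext => t; exact: row_mxEr.
Qed.

Lemma measurable_uncons_rV n : measurable_fun setT (@uncons_rV n).
Proof.
apply: measurable_fun_pair; first exact: measurable_coord_rV.
apply/measurable_fun_rVP => i.
rewrite (_ : (fun t => _) = fun t : 'rV[R]_n.+1 => t ord0 (rshift 1 i)).
  exact: measurable_coord_rV.
by apply/funext => t; rewrite mxE.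
Qed.

Section lebesgue_cons.
Local Open Scope ereal_scope.
Variables (n : nat) (m : {sigma_finite_measure set 'rV[R]_n -> \bar R}).

Definition lebesgue_cons : set 'rV[R]_n.+1 -> \bar R :=
  pushforward (lebesgue_measure \x m) (@cons_rV n).

Let lebesgue_cons0 : lebesgue_cons set0 = 0.
Proof. by rewrite /lebesgue_cons /pushforward preimage_set0 measure0. Qed.

Let lebesgue_cons_ge0 A : 0 <= lebesgue_cons A.
Proof. by rewrite /lebesgue_cons /pushforward measure_ge0. Qed.

Let lebesgue_cons_sigma_additive : semi_sigma_additive lebesgue_cons.
Proof.
move=> F mF tF mUF; rewrite /lebesgue_cons /pushforward preimage_bigcup.
have mcF k : measurable (@cons_rV n @^-1` F k).
  by rewrite -[X in measurable X]setTI; exact: measurable_cons_rV.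
apply: measure_semi_sigma_additive => //; last exact: bigcup_measurable.
by move: tF => /trivIsetP tF; apply/trivIsetP => i j _ _ ij;
  rewrite -preimage_setI tF// preimage_set0.
Qed.

HB.instance Definition _ := isMeasure.Build _ _ _ lebesgue_cons
  lebesgue_cons0 lebesgue_cons_ge0 lebesgue_cons_sigma_additive.

Let lebesgue_cons_sigma_finite : sigma_finite setT lebesgue_cons.
Proof.
have /sigma_finiteP[F [TF ndF Foo]] := @sigma_finiteT _ _ _ (@lebesgue_measure R).
have /sigma_finiteP[G [TG ndG Goo]] := sigma_finiteT m.
exists (fun k => @uncons_rV n @^-1` (F k `*` G k)).
  apply/seteqP; split=> // x _; rewrite -preimage_bigcup/=.
  have [i _ Fi] : (\bigcup_i F i) (uncons_rV x).1 by rewrite -TF.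
  have [j _ Gj] : (\bigcup_i G i) (uncons_rV x).2 by rewrite -TG.
  exists (maxn i j) => //; split.
    by move: Fi; exact/subsetPset/ndF/leq_maxl.
  by move: Gj; exact/subsetPset/ndG/leq_maxr.
move=> k; have [mF Fk] := Foo k; have [mG Gk] := Goo k; split.
  by rewrite -[X in measurable X]setTI; apply: measurable_uncons_rV => //;
    exact: measurableX.
rewrite /lebesgue_cons /pushforward (_ : _ @^-1` (_ @^-1` _) = F k `*` G k).
  by rewrite product_measure1E// lte_mul_pinfty// ge0_fin_numE.
by rewrite -comp_preimage (_ : _ \o _ = id)//; apply/funext; exact: cons_rVK.
Qed.

HB.instance Definition _ := Measure_isSigmaFinite.Build _ _ _ lebesgue_cons
  lebesgue_cons_sigma_finite.

End lebesgue_cons.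

(* The library has no n-dimensional Lebesgue measure: it is the n-fold product
   of the one-dimensional one, the only vector of ['rV_0] having mass 1. *)
Fixpoint lebesgue_rV n : {sigma_finite_measure set 'rV[R]_n -> \bar R} :=
  match n with
  | 0 => \d_(0 : 'rV[R]_0)
  | n.+1 => lebesgue_cons (lebesgue_rV n)
  end.

End lebesgue_rV.

Section euclidean.
Context {R : realType} {n : nat}.
Implicit Types x y : 'rV[R]_n.

Definition dotp x y : R := \sum_(i < n) x ord0 i * y ord0 i.

(* The library's norm on ['rV_n] is the sup norm. *)
Definition enorm x : R := Num.sqrt (dotp x x).

Definition sphere : set 'rV[R]_n := [set x | enorm x = 1].

Definition direction x : 'rV[R]_n := (enorm x)^-1 *: x.

Definition punctured_ball : set 'rV[R]_n := [set x | 0 < enorm x <= 1].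

Lemma measurable_enorm : measurable_fun setT enorm.
Proof.
apply: measurableT_comp.
  by apply: continuous_measurable_fun; exact: sqrt_continuous.
apply: measurable_sum => i.
by apply: measurable_funM; exact: measurable_coord_rV.
Qed.

Lemma measurable_direction : measurable_fun setT direction.
Proof.
apply/measurable_fun_rVP => i.
rewrite (_ : (fun t => _) = fun t => enorm t `^ (-1) * t ord0 i).
  apply: measurable_funM; last exact: measurable_coord_rV.
  by apply: (measurableT_comp (measurable_powR _)); exact: measurable_enorm.
by apply/funext => t; rewrite mxE powR_inv1// sqrtr_ge0.
Qed.

Lemma measurable_punctured_ball : measurable punctured_ball.
Proof.
rewrite (_ : punctured_ball = enorm @^-1` `]0, 1]%classic).
  by rewrite -[X in measurable X]setTI; exact: measurable_enorm.
by apply/seteqP; split=> x /=; rewrite in_itv.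
Qed.

(* Surface measure of the sphere in polar-coordinates form: n times the
   Lebesgue volume of the cone over A cut off at radius 1.  For n = 1 it is the
   counting measure on {-1, 1}. *)
Definition surface_measure (A : set 'rV[R]_n) : \bar R :=
  (n%:R%:E * lebesgue_rV n (punctured_ball `&` direction @^-1` A))%E.

Let mcone A : measurable A -> measurable (punctured_ball `&` direction @^-1` A).
Proof.
move=> mA; apply: measurableI; first exact: measurable_punctured_ball.
by rewrite -[X in measurable X]setTI; exact: measurable_direction.
Qed.

Let surface_measure0 : surface_measure set0 = 0%E.
Proof. by rewrite /surface_measure preimage_set0 setI0 measure0 mule0. Qed.

Let surface_measure_ge0 A : (0 <= surface_measure A)%E.
Proof. by rewrite /surface_measure mule_ge0. Qed.

Let surface_measure_sigma_additive : semi_sigma_additive surface_measure.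
Proof.
move=> F mF tF mUF; rewrite /surface_measure.
under eq_fun do rewrite -ge0_sume_distrr//.
apply: cvgeZl => //; rewrite preimage_bigcup setI_bigcupr.
apply: measure_semi_sigma_additive => [k||].
- apply: mcone; exact: mF.
- move: tF => /trivIsetP tF; apply/trivIsetP => i j _ _ ij.
  by rewrite setIACA setIid -preimage_setI tF// preimage_set0 setI0.
- by apply: bigcup_measurable => k _; apply: mcone; exact: mF.
Qed.

HB.instance Definition _ := isMeasure.Build _ _ _ surface_measure
  surface_measure0 surface_measure_ge0 surface_measure_sigma_additive.

End euclidean.

Section smoothness.
Context {R : realType} {n : nat}.

Fixpoint Ck_on (k : nat) (U : set 'rV[R]_n) (f : 'rV[R]_n -> R) : Prop :=
  match k with
  | 0 => forall x, U x -> {for x, continuous f}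
  | k.+1 => (forall x, U x -> differentiable f x) /\
            forall v, Ck_on k U (fun x => 'D_v f x)
  end.

(* C^k regularity on the embedded submanifold S^(n-1): restriction to the
   sphere of a C^k function on an open neighbourhood. *)
Definition Ck_on_sphere (k : nat) (f : 'rV[R]_n -> R) : Prop :=
  exists U F, [/\ open U, sphere `<=` U, Ck_on k U F
                & forall theta, sphere theta -> F theta = f theta].

End smoothness.

Section complex_integral.
Context {R : realType}.

Definition cintegral d (T : measurableType d) (mu : {measure set T -> \bar R})
    (D : set T) (f : T -> R[i]) : R[i] :=
  ((\int[mu]_(x in D) complex.Re (f x))
    +i* (\int[mu]_(x in D) complex.Im (f x)))%C.

Definition expi (y : R) : R[i] := (cos y +i* sin y)%C.

Context {n : nat}.

Definition Lp_norm (p : \bar R) (f : 'rV[R]_n -> R[i]) : \bar R :=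
  Lnorm (lebesgue_rV n) p (fun x => (Normc.normc (f x))%:E).

Definition in_Lp (p : \bar R) (f : 'rV[R]_n -> R[i]) : Prop :=
  [/\ measurable_fun setT (fun x => complex.Re (f x)),
      measurable_fun setT (fun x => complex.Im (f x))
    & (Lp_norm p f < +oo)%E].

Definition convolution (f g : 'rV[R]_n -> R[i]) (x : 'rV[R]_n) : R[i] :=
  cintegral (lebesgue_rV n) setT (fun y => f (x - y) * g y).

End complex_integral.

Section spectral_measure.
Context {R : realType} {n : nat}.
Variable mu : {measure set 'rV[R]_n -> \bar R}.

Definition centrally_symmetric : Prop :=
  forall A : set 'rV[R]_n, measurable A -> mu ((fun x => - x) @^-1` A) = mu A.

Definition has_positive_density : Prop :=
  exists rho : 'rV[R]_n -> R,
    [/\ {within sphere, continuous rho},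
        forall eta, sphere eta -> 0 < rho eta
      & forall A : set 'rV[R]_n, measurable A ->
          mu A = (\int[surface_measure]_(eta in A `&` sphere) (rho eta)%:E)%E].

Variable beta : R.

Definition omega (theta : 'rV[R]_n) : R :=
  \int[mu]_(eta in sphere) (`|dotp theta eta| `^ beta).

Definition psi (xi : 'rV[R]_n) : R :=
  if xi == 0 then 0 else enorm xi `^ beta * omega (direction xi).

Definition green (t : R) (x : 'rV[R]_n) : R[i] :=
  ((2 * pi) ^- n)%:C *
  cintegral (lebesgue_rV n) setT
    (fun xi => expi (dotp x xi) * (expR (- t * psi xi))%:C).

End spectral_measure.

Section fractional.
Context {R : realType}.

(* Euler's integral, valid for x > 0. *)
Definition Gamma (x : R) : R :=
  \int[lebesgue_measure]_(s in `]0, +oo[) (s `^ (x - 1) * expR (- s)).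

(* The prefactor is 1 / Gamma (- alpha), where Gamma (- alpha) is given by the
   functional equation Gamma (1 - alpha) = - alpha * Gamma (- alpha). *)
Definition frac_derive (alpha : R) (f : R -> R) (s : R) : R :=
  (Gamma (1 - alpha) / - alpha)^-1 *
  \int[lebesgue_measure]_(tau in `]0, +oo[)
    ((f (s - tau) - f s) / tau `^ (1 + alpha)).

(* The Green function: besides the equation and the initial condition, the
   last fields fix the solution as the density of the one-sided alpha-stable
   law, since the Cauchy problem alone does not specify a class of functions
   in which its solution is unique. *)
Record is_frac_green (alpha : R) (g : R -> R -> R) : Prop := {
  frac_green_integrable : forall t s : R, 0 < t ->
    lebesgue_measure.-integrable `]0, +oo[
      (fun tau => ((g t (s - tau) - g t s) / tau `^ (1 + alpha))%:E);
  frac_green_eq : forall t s : R, 0 < t ->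
    is_derive t 1 (fun r : R => g r s) (- frac_derive alpha (g t) s);
  frac_green_init : forall phi : R -> R, continuous phi -> bounded_fun phi ->
    (fun t : R => \int[lebesgue_measure]_s (g t s * phi s)) @ 0^'+ --> phi 0;
  frac_green_continuous : forall t : R, 0 < t -> continuous (g t);
  frac_green_ge0 : forall t s : R, 0 < t -> 0 <= g t s;
  frac_green_one_sided : forall t s : R, 0 < t -> s <= 0 -> g t s = 0;
  frac_green_laplace : forall t sigma : R, 0 < t -> 0 <= sigma ->
    \int[lebesgue_measure]_(s in `[0, +oo[) (expR (- sigma * s) * g t s) =
    expR (- t * sigma `^ alpha) }.

End fractional.

Section fundamental_solution.
Context {R : realType} {n : nat}.

Definition Zfun (alpha beta : R) (mu : {measure set 'rV[R]_n -> \bar R})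
    (Galpha : R -> R -> R) (t : R) (x : 'rV[R]_n) : R[i] :=
  (alpha^-1)%:C *
  cintegral lebesgue_measure `]0, +oo[
    (fun s => green mu beta (t `^ alpha * s) x *
      (s `^ (- 1 - alpha^-1) * Galpha 1 (s `^ (- alpha^-1)))%:C).

Definition kappa1 (d : nat) (beta : R) : \bar R :=
  if beta < d%:R then (d%:R / (d%:R - beta))%:E else +oo%E.

End fundamental_solution.

(* Main.v *)
(* With [gk t] the kernel of Fourier transform [exp (- t psi)] and
   [W s = s ^ (- 1 - 1 / alpha) G_alpha (1, s ^ (- 1 / alpha)) / alpha],
   [Z t = int gk (t ^ alpha s) W s ds].  The kernel [gk t] is a probability
   density: [psi] is a limit of symbols [int (1 - cos (y . xi)) nu (dy)] with [nu]
   finite, whose exponentials are power series of positive definite functions.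
   By scaling, [|gk t| <= C t ^ (- d / beta)], and the sup norm of [gk t - gk s]
   is at most [C (t - s) / s * s ^ (- d / beta)].  For the L^1 norm
   [a h = ||gk (1 + h) - gk 1||_1], the semigroup property and
   [X - 1 = (X ^ 2 - 1) / 2 - (X - 1) ^ 2 / 2] give
   [a h <= a (2 h) (1 + a (2 h)) / 2], so that [a h = O (h)] once [a] is small.
   Interpolating between L^1 and L^oo, the Lipschitz bound in L^p follows by
   Jensen's inequality from [int s ^ (- gamma) W s ds < oo], where
   [gamma = (d / beta) (1 - 1 / p)]; this moment is finite for [gamma < 1], that is,
   for [p < kappa_1], because the Laplace transform [exp (- sigma ^ alpha)]
   controls the moments of [G_alpha 1] of order less than [alpha].
   Finally [Z t] is a mixture of dilations of the probability density [gk 1], hence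
   an approximate identity, by continuity of translations in L^p. *)
Require Import Defs.
From HB Require Import structures.
From mathcomp Require Import all_boot all_order all_algebra.
From mathcomp Require Import complex.
From mathcomp Require Import all_classical all_reals all_analysis.
From mathcomp Require Import measurable_realfun.
From mathcomp Require Import ring lra.

Set Implicit Arguments.
Unset Strict Implicit.
Unset Printing Implicit Defensive.

Import Order.TTheory GRing.Theory Num.Theory.
Import numFieldNormedType.Exports.

Local Open Scope classical_set_scope.
Local Open Scope ring_scope.

(** No decay of [gk t] in space is ever proved: away from the origin the kernel is controlled by its
    sign and its mass alone. This is why positivity is the crux, and why [L^1] continuity goes
    through the semigroup instead of an explicit majorant: convolution squares can be estimated from
    mass 1 only, and the small start of the recursion comes from mass 1 together with the sup bound.
    Positivity and Fourier inversion share one device, the damping by [exp (- de |xi_i|)] in each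
    coordinate: its transform is an explicit positive product, which after rescaling becomes the
    Cauchy kernel, so that both arguments end with [de] tending to 0. Scaling makes time increments
    enter as [(t - s) / s]; this ratio does not see the subordination variable, and
    [t |-> t ^ alpha] does not increase it. A recurring technical point is that a real-valued
    integral is 0 by default when it diverges. For [d >= beta] the integral defining [Z t] may
    diverge at the origin, hence several estimates compare a real number with an extended-real
    integral by an inequality. *)

Section mfun.
Context {R : realType} d (T : measurableType d).
Implicit Types f g : T -> R.

Lemma mfun_expR f : measurable_fun setT f -> measurable_fun setT (fun x => expR (f x)).
Proof. exact: measurableT_comp. Qed.

Lemma mfun_powR p f : measurable_fun setT f -> measurable_fun setT (fun x => f x `^ p).
Proof. exact: (measurableT_comp (measurable_powR p)). Qed.

Lemma mfun_norm f : measurable_fun setT f -> measurable_fun setT (fun x => `|f x|).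
Proof. exact: measurableT_comp. Qed.

Lemma mfun_cos f : measurable_fun setT f -> measurable_fun setT (fun x => cos (f x)).
Proof.
by apply: measurableT_comp; apply: continuous_measurable_fun; exact: continuous_cos.
Qed.

Lemma mfun_sin f : measurable_fun setT f -> measurable_fun setT (fun x => sin (f x)).
Proof.
by apply: measurableT_comp; apply: continuous_measurable_fun; exact: continuous_sin.
Qed.

Lemma mfun_opp f : measurable_fun setT f -> measurable_fun setT (fun x => - f x).
Proof. exact: measurableT_comp. Qed.

Lemma mfun_add f g : measurable_fun setT f -> measurable_fun setT g ->
  measurable_fun setT (fun x => f x + g x).
Proof. exact: measurable_funD. Qed.

Lemma mfun_sub f g : measurable_fun setT f -> measurable_fun setT g ->
  measurable_fun setT (fun x => f x - g x).
Proof. exact: measurable_funB. Qed.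

Lemma mfun_mul f g : measurable_fun setT f -> measurable_fun setT g ->
  measurable_fun setT (fun x => f x * g x).
Proof. exact: measurable_funM. Qed.

Lemma mfun_cst (c : R) : measurable_fun setT (fun _ : T => c).
Proof. exact: measurable_cst. Qed.

Lemma mfun_EFin f : measurable_fun setT f -> measurable_fun setT (fun x => (f x)%:E).
Proof. exact: measurableT_comp. Qed.

Lemma mfun_bigprod (I : finType) (h : I -> T -> R) :
  (forall i, measurable_fun setT (h i)) ->
  measurable_fun setT (fun x => \prod_i h i x).
Proof. by move=> mh; apply: measurable_prod => i _. Qed.

End mfun.

Ltac mfun :=
  repeat first
    [ assumption
    | exact: measurable_fst | exact: measurable_snd | exact: measurable_id
    | apply: mfun_cst | apply: mfun_EFin | apply: mfun_sub | apply: mfun_add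
    | apply: mfun_opp | apply: mfun_mul | apply: mfun_expR | apply: mfun_cos
    | apply: mfun_sin | apply: mfun_norm | apply: mfun_powR ].

(** * Affine changes of variables *)

(** The measure structure of a pushforward depends on the measurability proof; behind the
    existential, [m'] is known only through these two equations and the proof does not reappear in
    the goals. *)
Lemma exists_pushforward (R : realType) d d' (T1 : measurableType d)
    (T2 : measurableType d') (m : {measure set T1 -> \bar R}) (f : T1 -> T2) :
  measurable_fun setT f ->
  exists2 m' : {measure set T2 -> \bar R}, m' = pushforward m f :> (set T2 -> \bar R) &
    forall g : T2 -> \bar R, measurable_fun setT g -> (forall x, 0 <= g x)%E ->
      (\int[m']_x g x = \int[m]_x g (f x))%E.
Proof.
move=> mf; eexists (pushforward m f); [by []|].
Unshelve. 2: exact: mf.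
by move=> g mg g0; rewrite ge0_integral_pushforward// preimage_setT.
Qed.

Section affine1.
Context {R : realType}.
Local Notation leb := (@lebesgue_measure R).
Local Open Scope ereal_scope.

Let aff (a c : R) : measurableTypeR R -> measurableTypeR R := fun x => (a + c * x)%R.

Let maff a c : measurable_fun setT (aff a c).
Proof. by apply: measurable_funD => //; apply: measurable_funM. Qed.

(** By uniqueness of Lebesgue measure: [c] times the pushforward gives every interval []p, q]] the
    length [q - p]. *)
Lemma lebesgue_measure_affine (a c : R) (A : set R) : (0 < c)%R -> measurable A ->
  leb A = c%:E * pushforward leb (aff a c) A.
Proof.
move=> c0 mA.
have [m mE _] := exists_pushforward leb (maff a c).
rewrite (@lebesgue_measure_unique _ (mscale (NngNum (ltW c0)) m))//=.
  by rewrite /mscale/= mE.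
move=> _ [[p q]] _ <-; rewrite /mscale/= mE /pushforward (_ : aff a c @^-1` _ = `](p - a) / c, (q - a) / c]%classic)%R; last first.
  apply/seteqP; split=> x /=; rewrite !in_itv/= /aff ltr_pdivrMr// ler_pdivlMr//;
   by rewrite ltrBlDl lerBrDl (mulrC x).
transitivity (c%:E * (if ((p - a) / c < (q - a) / c)%R
    then ((q - a) / c)%:E - ((p - a) / c)%:E else 0)); last first.
  congr (_ * _); apply/esym.
  exact: (@lebesgue_measure_itv R `]((p - a) / c)%R, ((q - a) / c)%R]).
rewrite lebesgue_measure_itv/= lte_fin ltr_pM2r ?invr_gt0// ltrD2r.
case: ifP => _; last by rewrite mule0.
by rewrite -!EFinB -EFinM; congr EFin; field; rewrite gt_eqF.
Qed.

Lemma ge0_integral_affine1 (a c : R) (f : R -> \bar R) : c != 0%R ->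
  measurable_fun setT f -> (forall x, 0 <= f x) ->
  \int[leb]_x f (a + c * x)%R = `|c|^-1%:E * \int[leb]_x f x.
Proof.
have pos (b e : R) (g : R -> \bar R) : (0 < e)%R ->
  measurable_fun setT g -> (forall x, 0 <= g x) ->
  \int[leb]_x g (b + e * x)%R = e^-1%:E * \int[leb]_x g x.
  move=> e0 mg g0.
  have [m mE mI] := exists_pushforward leb (maff b e).
  rewrite [in RHS](@eq_measure_integral _ _ _ _ (mscale (NngNum (ltW e0)) m)); last first.
    move=> A mA _; apply: etrans (lebesgue_measure_affine b e0 mA) _.
    exact: (congr1 (fun h : set R -> \bar R => e%:E * h A) (esym mE)).
  by rewrite ge0_integral_mscale//= mI// muleA -EFinM mulVf ?gt_eqF// mul1e.
move=> c0 mf f0; have [c_gt0|c_lt0|c00] := ltgtP 0%R c.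
- by rewrite pos// gtr0_norm.
(* A negative slope becomes positive after the reflection of the line, which preserves Lebesgue
   measure. *)
- have mN : measurable_fun setT (-%R : measurableTypeR R -> measurableTypeR R).
    exact: oppr_measurable.
  transitivity (\int[leb]_x f (a + - c * x)%R); last first.
    by rewrite pos ?oppr_gt0// ltr0_norm.
  have [m mE mI] := exists_pushforward leb mN.
  transitivity (\int[m]_x f (a + - c * x)%R).
    rewrite mI//.
      by apply: eq_integral => x _ /=; rewrite mulrNN.
    apply: (measurableT_comp mf).
    by apply: measurable_funD => //; apply: measurable_funM.
  apply: eq_measure_integral => //= A mA _.
  exact: etrans (congr1 (fun h : set R -> \bar R => h A) mE) (lebesgue_measureN mA).
- by move: c0; rewrite -c00 eqxx.
Qed.

End affine1.

Section lebesgue_rV_integral.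
Context {R : realType}.
Local Notation leb := (@lebesgue_measure R).
Local Open Scope ereal_scope.

Lemma measurable_uncurry_cons n (f : 'rV[R]_n.+1 -> \bar R) : measurable_fun setT f ->
  measurable_fun setT (f \o @cons_rV R n).
Proof. by move=> mf; apply: (measurableT_comp mf); exact: measurable_cons_rV. Qed.

Lemma ge0_integral_lebesgue_rVS n (f : 'rV[R]_n.+1 -> \bar R) :
  measurable_fun setT f -> (forall x, 0 <= f x) ->
  \int[lebesgue_rV n.+1]_x f x =
  \int[leb]_x \int[lebesgue_rV n]_y f (cons_rV (x, y)).
Proof.
move=> mf f0.
have [m mE mI] := exists_pushforward (leb \x lebesgue_rV n) (@measurable_cons_rV R n).
transitivity (\int[m]_x f x); first by apply: eq_measure_integral => A _ _; rewrite mE.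
rewrite mI// fubini_tonelli1//; exact: measurable_uncurry_cons.
Qed.

Lemma cons_rV0 n x (y : 'rV[R]_n) : cons_rV (x, y) ord0 ord0 = x.
Proof. by have [] := cons_rVK (x, y). Qed.

Lemma cons_rVS n x (y : 'rV[R]_n) i : cons_rV (x, y) ord0 (lift ord0 i) = y ord0 i.
Proof.
transitivity ((row_mx x%:M y : 'rV[R]_(1 + n)) ord0 (rshift 1 i)).
  by congr (row_mx _ _ _ _); exact: val_inj.
exact: row_mxEr.
Qed.

Lemma measurable_affine_rV n (a : 'rV[R]_n) (c : R) :
  measurable_fun setT (fun x : 'rV[R]_n => (a + c *: x)%R).
Proof.
apply/measurable_fun_rVP => i; under eq_fun do rewrite !mxE.
apply: measurable_funD => //; apply: measurable_funM => //; exact: measurable_coord_rV.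
Qed.

(** Induction on the dimension by Tonelli: each coordinate contributes one factor [|c|^-1], and
    ['rV_0] has a single point. *)
Lemma ge0_integral_affine_rV n (a : 'rV[R]_n) (c : R) (f : 'rV[R]_n -> \bar R) :
  c != 0%R -> measurable_fun setT f -> (forall x, 0 <= f x) ->
  \int[lebesgue_rV n]_x f (a + c *: x)%R = (`|c| ^- n)%:E * \int[lebesgue_rV n]_x f x.
Proof.
move=> c0; elim: n => [|n IH] in a f * => mf f0.
  rewrite /= !integral_dirac//; last first.
    by apply: (measurableT_comp mf); exact: measurable_affine_rV.
  by rewrite !diracT !mul1e expr0 invr1 mul1e; congr f; apply/rowP => -[].
rewrite !ge0_integral_lebesgue_rVS//; last first.
  by apply: (measurableT_comp mf); exact: measurable_affine_rV.
have mfc := measurable_uncurry_cons mf.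
pose a0 := a ord0 ord0; pose a' : 'rV[R]_n := \row_i a ord0 (lift ord0 i).
have consE (x : R) (y : 'rV[R]_n) : (a + c *: cons_rV (x, y) = cons_rV (a0 + c * x, a' + c *: y))%R.
  apply/rowP => i; rewrite [LHS]mxE [X in (_ + X)%R]mxE.
  case: (unliftP ord0 i) => [k ->|->]; first by rewrite !cons_rVS !mxE.
  by rewrite !cons_rV0.
have mfx (x : R) : measurable_fun setT (fun y => f (cons_rV (x, y))).
  by apply: (measurableT_comp mfc); exact: measurable_fun_pair.
transitivity (\int[leb]_x ((`|c| ^- n)%:E * \int[lebesgue_rV n]_y f (cons_rV (a0 + c * x, y)%R))).
  apply: eq_integral => x _; under eq_integral => y _ do rewrite consE.
  by apply: (IH a' (fun y => f (cons_rV (a0 + c * x, y)%R))).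
have mF : measurable_fun setT (fun x : measurableTypeR R => \int[lebesgue_rV n]_y f (cons_rV (x, y))).
  exact: (measurable_fun_fubini_tonelli_F (m2 := lebesgue_rV n) _ mfc (fun z => f0 (cons_rV z))).
have F0 x : 0 <= \int[lebesgue_rV n]_y f (cons_rV (x, y)) by exact: integral_ge0.
transitivity ((`|c| ^- n)%:E * \int[leb]_x (\int[lebesgue_rV n]_y f (cons_rV (a0 + c * x, y)%R))).
  apply: ge0_integralZl.
  - exact: measurableT.
  - apply: (measurableT_comp mF).
    by apply: measurable_funD => //; apply: measurable_funM.
  - by move=> x _; exact: F0.
  - by rewrite lee_fin invr_ge0 exprn_ge0.
rewrite (ge0_integral_affine1 a0 c0 mF F0) muleA -EFinM; congr (_%:E * _).
by rewrite exprSr invfM mulrC.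
Qed.

End lebesgue_rV_integral.

(** * Explicit one-dimensional integrals *)

Section integrals1.
Context {R : realType}.
Local Notation leb := (@lebesgue_measure R).

Lemma is_derive_derivable (F : R -> R) (x l : R) :
  is_derive x 1 F l -> derivable F x 1.
Proof. by case. Qed.

Lemma is_derive_derive1 (F : R -> R) (x l : R) : is_derive x 1 F l -> derive1 F x = l.
Proof. by case=> _ <-; rewrite derive1E. Qed.

Lemma is_derive_continuous (F : R -> R) (x l : R) :
  is_derive x 1 F l -> {for x, continuous F}.
Proof.
by move=> /is_derive_derivable/derivable1_diffP/differentiable_continuous.
Qed.

Lemma integral_itv_FTC (f F : R -> R) (a b : R) : a < b ->
  (forall x, a <= x <= b -> {for x, continuous f}) ->
  (forall x, a <= x <= b -> is_derive x 1 F (f x)) ->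
  (\int[leb]_(x in `[a, b]) (f x)%:E = (F b - F a)%:E)%E.
Proof.
move=> ab cf dF; rewrite (@continuous_FTC2 _ _ F)//.
- by apply: continuous_in_subspaceT => x /set_mem; rewrite /= in_itv; exact: cf.
- split.
  + move=> x; rewrite in_itv/= => /andP[ax xb].
    by apply: is_derive_derivable (dF x _); rewrite !ltW.
  + by apply: cvg_at_right_filter; apply: is_derive_continuous (dF a _); rewrite lexx ltW.
  + by apply: cvg_at_left_filter; apply: is_derive_continuous (dF b _); rewrite lexx ltW.
- move=> x; rewrite in_itv/= => /andP[ax xb]; apply: is_derive_derive1.
  by apply: dF; rewrite !ltW.
Qed.

(** An inequality instead of an equality: monotone exhaustion by compact intervals then asks for no
    limits of [F] at the ends of [D], only for the bound [M] on its increments. *)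
Lemma ge0_integral_FTC_le (D : set R) (f F : R -> R) (a b : nat -> R) (M : R) :
  measurable D -> measurable_fun D f -> (forall x, D x -> 0 <= f x) ->
  D = \bigcup_n `[a n, b n]%classic -> {homo a : m n / (m <= n)%N >-> n <= m} ->
  {homo b : m n / (m <= n)%N >-> m <= n} ->
  (forall n, a n < b n) ->
  (forall x, D x -> {for x, continuous f}) ->
  (forall x, D x -> is_derive x 1 F (f x)) ->
  (forall n, F (b n) - F (a n) <= M) ->
  (\int[leb]_(x in D) (f x)%:E <= M%:E)%E.
Proof.
move=> mD mf f0 DE aN bN ab cf dF FM.
have DS n : `[a n, b n]%classic `<=` D by rewrite DE => x ?; exists n.
have ndI : nondecreasing_seq (fun n => `[a n, b n]%classic).
  move=> m n mn; apply/subsetPset => x; rewrite /= !in_itv/= => /andP[h1 h2].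
  by rewrite (le_trans (aN _ _ mn) h1) (le_trans h2 (bN _ _ mn)).
have := @ge0_nondecreasing_set_cvg_integral _ (measurableTypeR R) R (fun n => `[a n, b n]%classic) (EFin \o f) leb ndI.
rewrite -DE => /(_ _ _ _)/cvg_lim <- //; last 2 first.
- by move=> n; apply/measurable_EFinP; apply: measurable_funS mf.
- by move=> n x /DS Dx; rewrite lee_fin f0.
apply: lime_le.
  apply: ereal_nondecreasing_is_cvgn.
  apply: ge0_nondecreasing_set_nondecreasing_integral => //.
  - by move=> n; apply/measurable_EFinP; apply: measurable_funS mf.
  - by move=> n x /DS Dx; rewrite lee_fin f0.
apply: nearW => n; rewrite [leLHS](_ : _ = (F (b n) - F (a n))%:E) ?lee_fin//.
by apply: integral_itv_FTC => // x xab; [apply: cf|apply: dF]; apply: (DS n);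
  rewrite /= in_itv.
Qed.

Lemma ge0_integral_fold (f : R -> \bar R) : measurable_fun setT f ->
  (forall x, 0 <= f x)%E ->
  (\int[leb]_x f x = \int[leb]_(x in `[0%R, +oo[) f x + \int[leb]_(x in `[0%R, +oo[) f (- x)%R)%E.
Proof.
move=> mf f0.
have mfN : measurable_fun setT (fun x : R => f (- x)).
  by apply: (measurableT_comp mf); exact: oppr_measurable.
rewrite (ge0_integration_by_substitution0 mfN) => [|x]; last exact: f0.
under [X in (_ + X)%E]eq_integral do rewrite opprK.
rewrite -[X in (_ + X)%E]integral_itv_bndo_bndc; last exact: measurable_funTS.
rewrite addeC -ge0_integral_setU//.
- by congr (integral _ _ _); apply/esym/seteqP; split => // x _ /=; rewrite !in_itv/= andbT; case: ltP; [left|right].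
- exact: measurable_funTS.
- apply/disj_setPS => x []/=; rewrite !in_itv/= andbT => h1 h2.
  by move: (lt_le_trans h1 h2); rewrite ltxx.
Qed.

Lemma integral_cauchy : (\int[leb]_x ((1 + x ^+ 2)^-1)%:E = pi%:E)%E.
Proof.
rewrite ge0_integral_fold; last 2 first.
- apply/measurable_EFinP; apply: continuous_measurable_fun => x.
  exact: (@continuous_oneDsqrV R).
- by move=> x; rewrite lee_fin invr_ge0 addr_ge0// sqr_ge0.
have h := @integral0y_oneDsqr R; rewrite /oneDsqr in h.
rewrite h; under eq_integral do rewrite sqrrN.
by rewrite h -EFinD; congr EFin; field.
Qed.

(** The summand 1 keeps the integrand nonnegative, so that the fundamental theorem on a half-line
    for nonnegative functions applies; the phase [a] will carry the other coordinates of an inner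
    product. *)
Lemma integral_expcos_half (de a x : R) : 0 < de ->
  (\int[leb]_(y in `[0%R, +oo[) (expR (- de * y) * (1 + cos (a + x * y)))%:E =
   (de^-1 + (de * cos a - x * sin a) / (de ^+ 2 + x ^+ 2))%:E)%E.
Proof.
move=> de0.
have Q0 : 0 < de ^+ 2 + x ^+ 2 by rewrite ltr_pwDl ?sqr_ge0// exprn_gt0.
(* The primitive comes from the real part of the integral of [exp ((- de + i x) y + i a)], plus the
   primitive of [exp (- de y)]. *)
pose Q (y : R) : R := - de^-1 + (x * sin (a + x * y) - de * cos (a + x * y)) / (de ^+ 2 + x ^+ 2).
pose F (y : R) : R := expR (- de * y) * Q y.
have dF (y : R) : is_derive y 1 F (expR (- de * y) * (1 + cos (a + x * y))).
  rewrite /F /Q; apply: is_derive_eq.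
  rewrite -![_%:A]/(_ * 1) -![_ *: _]/(_ * _); field.
  by rewrite !gt_eqF.
have cf (y : R) : {for y, continuous (fun y : R => expR (- de * y) * (1 + cos (a + x * y)))}.
  by apply: (@is_derive_continuous _ _ (expR (- de * y) * (- de * (1 + cos (a + x * y)) - x * sin (a + x * y)))); apply: is_derive_eq; rewrite -![_%:A]/(_ * 1) -![_ *: _]/(_ * _); ring.
rewrite (@ge0_continuous_FTC2y _ _ F _ 0).
- rewrite /F /Q mulr0 expR0 mulr0 addr0 mul1r -EFinB; congr EFin.
  by field; rewrite !gt_eqF.
- by move=> y _; rewrite mulr_ge0 ?expR_ge0// -lerBlDl sub0r cos_geN1.
- by apply: continuous_in_subspaceT => y _; exact: cf.
- apply/cvgrPdist_le => e e0.
  pose B := de^-1 + (`|x| + de) / (de ^+ 2 + x ^+ 2).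
  have B0 : 0 < B by rewrite ltr_pwDl ?invr_gt0// divr_ge0 ?(ltW Q0)// addr_ge0// ltW.
  have QB y : `|Q y| <= B.
    rewrite /Q /B (le_trans (ler_normD _ _))// normrN gtr0_norm ?invr_gt0// lerD2l.
    rewrite normrM (gtr0_norm (x := (_ + _)^-1)) ?invr_gt0// ler_wpM2r ?invr_ge0 ?(ltW Q0)//.
    apply: (le_trans (ler_normB _ _)); rewrite !normrM; apply: lerD.
      by rewrite ler_piMr// ler_norml sin_le1 sin_geN1.
    by rewrite gtr0_norm// ler_piMr ?cos_max// ltW.
  have h := @cvgr_expR R.
  have /cvgrPdist_le/(_ (e / B)) := h; rewrite divr_gt0// => /(_ erefl).
  move=> [M [Mr hM]]; exists (M / de); split; first exact: num_real.
  move=> y; rewrite ltr_pdivrMr// mulrC => /hM/=; rewrite !sub0r !normrN => hy.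
  rewrite /F normrM mulNr (le_trans (ler_wpM2l _ (QB y)))//.
  by rewrite -ler_pdivlMr.
- by move=> y _; exact: is_derive_derivable (dF y).
- by apply: cvg_at_right_filter; apply: is_derive_continuous (dF 0).
- by move=> y _; exact: is_derive_derive1 (dF y).
Qed.

(** The Fourier transform of [exp (- de |y|)], that is [2 * pi] times the usual Poisson kernel. *)
Definition poisson (de x : R) : R := 2 * de / (de ^+ 2 + x ^+ 2).

Lemma integral_expcos (de a x : R) : 0 < de ->
  (\int[leb]_y (expR (- de * `|y|) * (1 + cos (a + x * y)))%:E =
   (2 / de + cos a * poisson de x)%:E)%E.
Proof.
move=> de0.
have Q0 : 0 < de ^+ 2 + x ^+ 2 by rewrite ltr_pwDl ?sqr_ge0// exprn_gt0.
rewrite ge0_integral_fold.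
- transitivity (\int[leb]_(y in `[0%R, +oo[) (expR (- de * y) * (1 + cos (a + x * y)))%:E +
      \int[leb]_(y in `[0%R, +oo[) (expR (- de * y) * (1 + cos (a + - x * y)))%:E)%E.
    congr (_ + _)%E; apply: eq_integral => y; rewrite inE/= in_itv/= => /andP[y0 _].
      by rewrite ger0_norm.
    by rewrite normrN ger0_norm// mulrN [- x * y]mulNr.
  rewrite !integral_expcos_half// -EFinD sqrrN /poisson; congr EFin; field.
  by rewrite !gt_eqF.
- by mfun.
- by move=> y; rewrite lee_fin mulr_ge0 ?expR_ge0// -lerBlDl sub0r cos_geN1.
Qed.

Lemma integral_explaplace (de : R) : 0 < de ->
  (\int[leb]_y (expR (- de * `|y|))%:E = (2 / de)%:E)%E.
Proof.
move=> de0; have := integral_expcos 0 0 de0.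
have mE : measurable_fun setT (fun y : R => expR (- de * `|y|)).
  by mfun.
rewrite cos0 mul1r /poisson; set I := (X in _ -> X = _).
have -> : (\int[leb]_y (expR (- de * `|y|) * (1 + cos (0 + 0 * y)))%:E = 2%:E * I)%E.
  transitivity (\int[leb]_y (2%:E * (expR (- de * `|y|))%:E))%E.
    by apply: eq_integral => y _; rewrite mul0r addr0 cos0 (_ : 1 + 1 = 2)// mulrC EFinM.
  apply: ge0_integralZl.
  - exact: measurableT.
  - exact/measurable_EFinP.
  - by move=> y _; rewrite lee_fin expR_ge0.
  - by rewrite lee_fin.
move=> h.
have -> : I = ((2^-1)%:E * (2%:E * I))%E by rewrite muleA -EFinM mulVf ?mul1e.
rewrite h -EFinM; congr EFin; field.
by rewrite ?gt_eqF// expr0n addr0 exprn_gt0.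
Qed.

Lemma expR_powR_le_cauchy (c b : R) : 0 < c -> 0 < b ->
  exists2 C, 0 < C & forall y, expR (- (c * `|y| `^ b)) <= C / (1 + y ^+ 2).
Proof.
move=> c0 b0.
(* With [(n + 1) b >= 2], the term of degree [n + 1] of the exponential series dominates a multiple
   of [y ^ 2] for [|y| > 1]. *)
pose n := Num.truncn (2 / b).
have nb : 2 <= n.+1%:R * b.
  by rewrite -ler_pdivrMr// ltW// truncnS_gt.
pose K := n.+1`!%:R / c ^+ n.+1.
have K0 : 0 < K by rewrite divr_gt0// ?ltr0n ?fact_gt0 ?exprn_gt0.
exists (2 * (1 + K)) => [|y]; first by rewrite mulr_gt0// addr_gt0.
have q0 : 0 < 1 + y ^+ 2 by rewrite ltr_pwDl ?sqr_ge0.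
rewrite ler_pdivlMr// expRN -ler_pdivlMl ?invr_gt0 ?expR_gt0// invrK.
set z := c * _.
have z0 : 0 <= z by rewrite mulr_ge0 ?powR_ge0// ltW.
have e1 : 1 <= expR z by rewrite -expR0 ler_expR.
have [y1|y1] := leP `|y| 1.
  have : y ^+ 2 <= 1 by rewrite -real_normK ?num_real// exprn_ile1.
  have : 0 <= (expR z - 1) * (1 + K) by rewrite mulr_ge0 ?subr_ge0// addr_ge0// ltW.
  by have := ltW K0; nra.
have y2 : y ^+ 2 <= K * expR z.
  have := expR_ge1Dxn n z0; rewrite -/K => h.
  have : z ^+ n.+1 / n.+1`!%:R <= expR z by rewrite (le_trans _ h)// lerDr.
  rewrite ler_pdivrMr ?ltr0n ?fact_gt0// => hz.
  rewrite /K mulrAC ler_pdivlMr ?exprn_gt0// [X in _ <= X]mulrC (le_trans _ hz)//.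
  rewrite /z exprMn mulrC ler_wpM2l ?exprn_ge0 ?(ltW c0)//.
  have -> : y ^+ 2 = `|y| `^ 2 by rewrite powR_mulrn// real_normK ?num_real.
  have -> : (`|y| `^ b) ^+ n.+1 = `|y| `^ (n.+1%:R * b).
    by rewrite mulrC powRrM powR_mulrn ?powR_ge0.
  by rewrite ler_powR ?(ltW y1).
by have := K0; nra.
Qed.

Lemma integrable_expR_powR (c b : R) : 0 < c -> 0 < b ->
  (\int[leb]_y (expR (- (c * `|y| `^ b)))%:E < +oo)%E.
Proof.
move=> c0 b0; have [C C0 hC] := expR_powR_le_cauchy c0 b0.
have mc : measurable_fun setT (fun x : R => (1 + x ^+ 2)^-1).
  by apply: continuous_measurable_fun => x; exact: (@continuous_oneDsqrV R).
apply: (@le_lt_trans _ _ (\int[leb]_y (C%:E * ((1 + y ^+ 2)^-1)%:E))%E).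
  apply: ge0_le_integral.
  - exact: measurableT.
  - by move=> y _; rewrite lee_fin expR_ge0.
  - by mfun.
  - by apply: mfun_EFin; mfun.
  - by move=> y _; rewrite -EFinM lee_fin.
have -> : (\int[leb]_y (C%:E * ((1 + y ^+ 2)^-1)%:E) = C%:E * \int[leb]_y ((1 + y ^+ 2)^-1)%:E)%E.
  apply: ge0_integralZl.
  - exact: measurableT.
  - exact/measurable_EFinP.
  - by move=> y _; rewrite lee_fin invr_ge0 addr_ge0// sqr_ge0.
  - by rewrite lee_fin ltW.
by rewrite integral_cauchy -EFinM ltry.
Qed.

End integrals1.

(** * Integrals of real-valued functions *)

Section Rint.
Context {R : realType}.

Section one.
Context d (T : measurableType d) (mu : {measure set T -> \bar R}).
Local Notation ig f := (mu.-integrable setT (EFin \o f)).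
Implicit Types f g : T -> R.

Lemma ig_measurable f : ig f -> measurable_fun setT f.
Proof. by move=> /integrableP[/measurable_EFinP]. Qed.

Lemma eintZ (c : R) f : 0 <= c -> measurable_fun setT f -> (forall x, 0 <= f x) ->
  (\int[mu]_x (c * f x)%:E = c%:E * \int[mu]_x (f x)%:E)%E.
Proof.
move=> c0 mf f0; under eq_integral => x _ do rewrite EFinM.
apply: ge0_integralZl_EFin.
- exact: measurableT.
- by move=> x _; exact: f0.
- exact: mfun_EFin.
- by [].
Qed.

Lemma eintD f g : measurable_fun setT f -> (forall x, 0 <= f x) ->
  measurable_fun setT g -> (forall x, 0 <= g x) ->
  (\int[mu]_x (f x + g x)%:E = \int[mu]_x (f x)%:E + \int[mu]_x (g x)%:E)%E.
Proof.
move=> mf f0 mg g0; under eq_integral => x _ do rewrite EFinD.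
apply: ge0_integralD.
- exact: measurableT.
- by move=> x _; exact: f0.
- exact: mfun_EFin.
- by move=> x _; exact: g0.
- exact: mfun_EFin.
Qed.

Lemma eint_le f g : measurable_fun setT f -> (forall x, 0 <= f x) ->
  measurable_fun setT g -> (forall x, f x <= g x) ->
  (\int[mu]_x (f x)%:E <= \int[mu]_x (g x)%:E)%E.
Proof.
move=> mf f0 mg fg; apply: ge0_le_integral.
- exact: measurableT.
- by move=> x _; exact: f0.
- exact: mfun_EFin.
- exact: mfun_EFin.
- by move=> x _; rewrite lee_fin.
Qed.

Lemma ig_le f g : ig g -> measurable_fun setT f -> (forall x, `|f x| <= g x) -> ig f.
Proof.
move=> ig_g mf fg; apply: (le_integrable measurableT _ _ ig_g).
  exact: mfun_EFin.
by move=> x _ /=; rewrite lee_fin (le_trans (fg x))// ler_norm.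
Qed.

Lemma ge0_igP f : measurable_fun setT f -> (forall x, 0 <= f x) ->
  (\int[mu]_x (f x)%:E < +oo)%E -> ig f.
Proof.
move=> mf f0 foo; apply/integrableP; split; first exact: mfun_EFin.
rewrite (eq_integral (fun x => (f x)%:E))// => x _ /=.
by rewrite ger0_norm.
Qed.

Lemma Rint_EFin f : ig f -> (\int[mu]_x (f x)%:E = (\int[mu]_x f x)%:E)%E.
Proof. by move=> igf; rewrite /Rintegral fineK//; exact: integrable_fin_num. Qed.

Lemma igD f g : ig f -> ig g -> ig (fun x => f x + g x).
Proof. by move=> h1 h2; have := integrableD measurableT h1 h2. Qed.

Lemma igB f g : ig f -> ig g -> ig (fun x => f x - g x).
Proof. by move=> h1 h2; have := integrableB measurableT h1 h2. Qed.

Lemma igZ (c : R) f : ig f -> ig (fun x => c * f x).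
Proof. by move=> h; have := integrableZl measurableT c h. Qed.

Lemma igMb f g (M : R) : ig f -> measurable_fun setT g -> (forall x, `|g x| <= M) ->
  ig (fun x => f x * g x).
Proof.
move=> igf mg gM; apply: (@ig_le _ (fun x => M * `|f x|)).
- apply: igZ; exact: (integrable_norm igf).
- by apply: mfun_mul => //; exact: ig_measurable.
- by move=> x; rewrite normrM mulrC ler_wpM2r.
Qed.

Lemma RintD f g : ig f -> ig g ->
  \int[mu]_x (f x + g x) = \int[mu]_x f x + \int[mu]_x g x.
Proof. by move=> h1 h2; exact: RintegralD. Qed.

Lemma RintB f g : ig f -> ig g ->
  \int[mu]_x (f x - g x) = \int[mu]_x f x - \int[mu]_x g x.
Proof. by move=> h1 h2; exact: RintegralB. Qed.

Lemma RintZ (c : R) f : ig f -> \int[mu]_x (c * f x) = c * \int[mu]_x f x.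
Proof. by move=> h; exact: RintegralZl. Qed.

Lemma Rint_le f g : ig f -> ig g -> (forall x, f x <= g x) ->
  \int[mu]_x f x <= \int[mu]_x g x.
Proof. by move=> h1 h2 fg; apply: le_Rintegral. Qed.

Lemma Rint_norm_le f g : ig g -> measurable_fun setT f -> (forall x, `|f x| <= g x) ->
  `|\int[mu]_x f x| <= \int[mu]_x g x.
Proof.
move=> ig_g mf fg; have igf := ig_le ig_g mf fg.
apply: (le_trans (le_normr_Rintegral _ igf)) => //.
by apply: Rint_le => //; exact: (integrable_norm igf).
Qed.

Lemma Rint_cvg (f_ : nat -> T -> R) f g : ig g ->
  (forall n, measurable_fun setT (f_ n)) -> (forall x, f_ n x @[n --> \oo] --> f x) ->
  (forall n x, `|f_ n x| <= g x) ->
  \int[mu]_x f_ n x @[n --> \oo] --> \int[mu]_x f x.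
Proof.
move=> ig_g mf ff fg.
have mlim : measurable_fun setT f.
  by apply: (measurable_fun_cvg mf) => x _; exact: ff.
have igf_ n := ig_le ig_g (mf n) (fg n).
have fgl x : `|f x| <= g x.
  have h : `|f_ n x| @[n --> \oo] --> `|f x| by apply: cvg_norm; exact: ff.
  rewrite -(cvg_lim _ h)//; apply: limr_le; first exact: cvgP h.
  by apply: nearW => n; exact: fg.
have igf := ig_le ig_g mlim fgl.
have := @dominated_cvg _ T R mu setT measurableT (fun n => EFin \o f_ n) (EFin \o f) (EFin \o g).
have H1 n : measurable_fun setT (EFin \o f_ n) by exact: mfun_EFin.
have H2 x : setT x -> (EFin \o f_ n) x @[n --> \oo] --> (EFin \o f) x.
  by move=> _ /=; apply: cvg_EFin; [exact: nearW|exact: ff].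
move=> /(_ H1 H2 (fun _ _ => isT) ig_g (fun n x _ => fg n x)).
rewrite /= (Rint_EFin igf) => h.
exact: (fine_cvg h).
Qed.

End one.

Section two.
Context d1 d2 (T1 : measurableType d1) (T2 : measurableType d2).
Context (m1 : {sigma_finite_measure set T1 -> \bar R}).
Context (m2 : {sigma_finite_measure set T2 -> \bar R}).
Variables (f : T1 -> T2 -> R) (g1 : T1 -> R) (g2 : T2 -> R).
Hypothesis mf : measurable_fun setT (fun z : T1 * T2 => f z.1 z.2).
Hypothesis ig1 : m1.-integrable setT (EFin \o g1).
Hypothesis ig2 : m2.-integrable setT (EFin \o g2).
Hypothesis fg : forall x y, `|f x y| <= g1 x * g2 y.

Lemma mfun_curry1 x : measurable_fun setT (f x).
Proof.
have -> : f x = (fun z : T1 * T2 => f z.1 z.2) \o pair x by [].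
exact: (measurableT_comp mf (pair1_measurable x)).
Qed.

Lemma mfun_curry2 y : measurable_fun setT (f ^~ y).
Proof.
have -> : f ^~ y = (fun z : T1 * T2 => f z.1 z.2) \o pair^~ y by [].
exact: (measurableT_comp mf (pair2_measurable y)).
Qed.

Lemma ig_curry1 x : m2.-integrable setT (EFin \o f x).
Proof. by apply: (ig_le (igZ (g1 x) ig2)) => //; exact: mfun_curry1. Qed.

Lemma ig_curry2 y : m1.-integrable setT (EFin \o f ^~ y).
Proof.
apply: (ig_le (igZ (g2 y) ig1)); first exact: mfun_curry2.
by move=> x; rewrite mulrC.
Qed.

(** A majorant of product form is the certificate of joint integrability in the Fubini exchanges of
    real-valued integrals below. *)
Let igf : (m1 \x m2)%E.-integrable setT (fun z => (f z.1 z.2)%:E).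
Proof.
apply/integrable12ltyP; first exact: mfun_EFin.
have ig1n := integrable_norm ig1; have ig2n := integrable_norm ig2.
apply: (@le_lt_trans _ _ (\int[m1]_x (`|g1 x| * \int[m2]_y `|g2 y|)%:E)%E); last first.
  have /integrableP[_] := igZ (\int[m2]_y `|g2 y|) ig1n.
  apply: le_lt_trans; apply: ge0_le_integral => //.
  - by move=> x _; rewrite lee_fin mulr_ge0// Rintegral_ge0.
  - by mfun; exact: ig_measurable ig1.
  - by apply: mfun_EFin; mfun; exact: ig_measurable ig1.
  - by move=> x _ /=; rewrite lee_fin mulrC ler_norm.
apply: ge0_le_integral.
- exact: measurableT.
- by move=> x _; apply: integral_ge0.
- exact: (measurable_fun_fubini_tonelli_F (m2 := m2) _ (mfun_EFin (mfun_norm mf))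
    (fun z => normr_ge0 (f z.1 z.2))).
- by mfun; exact: ig_measurable ig1.
- move=> x _; rewrite -(RintZ _ ig2n) -(Rint_EFin (igZ _ ig2n)).
  apply: ge0_le_integral.
  - exact: measurableT.
  - by [].
  - by apply: mfun_EFin; mfun; exact: mfun_curry1.
  - by mfun; exact: ig_measurable ig2.
  - by move=> y _; rewrite lee_fin -normrM (le_trans (fg x y))// ler_norm.
Qed.

Lemma mfun_Rint1 : measurable_fun setT (fun x => \int[m2]_y f x y).
Proof.
apply: (measurableT_comp (fine_measurable measurableT)).
exact: (measurable_fubini_F igf).
Qed.

Lemma ig_Rint1 : m1.-integrable setT (EFin \o (fun x => \int[m2]_y f x y)).
Proof.
apply: eq_integrable (integrable_fubini_F igf) => // x _ /=.
by rewrite /fubini_F /= Rint_EFin//; exact: ig_curry1.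
Qed.

Lemma Rint_fubini :
  \int[m1]_x \int[m2]_y f x y = \int[m2]_y \int[m1]_x f x y.
Proof.
have := Fubini igf => /= h; rewrite /Rintegral; congr fine.
transitivity (\int[m1]_x \int[m2]_y (f x y)%:E)%E.
  by apply: eq_integral => x _; rewrite (Rint_EFin (ig_curry1 x)).
by rewrite h; apply: eq_integral => y _; rewrite (Rint_EFin (ig_curry2 y)).
Qed.

End two.

Lemma mfun_dotp d (T : measurableType d) n (f g : T -> 'rV[R]_n) :
  measurable_fun setT f -> measurable_fun setT g ->
  measurable_fun setT (fun t => dotp (f t) (g t)).
Proof.
move=> /measurable_fun_rVP mf /measurable_fun_rVP mg.
by rewrite /dotp; apply: measurable_sum => i; apply: mfun_mul; [exact: mf|exact: mg].
Qed.

Section affine.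
Variables (n : nat) (a : 'rV[R]_n) (c : R) (f : 'rV[R]_n -> R).
Hypotheses (c0 : c != 0) (igf : (lebesgue_rV n).-integrable setT (EFin \o f)).
Let mA := measurable_affine_rV a c.

Lemma ig_affine : (lebesgue_rV n).-integrable setT (EFin \o (fun x => f (a + c *: x))).
Proof.
have mf := ig_measurable igf; have /integrableP[_ foo] := igf.
apply/integrableP; split; first exact: mfun_EFin (measurableT_comp mf mA).
have := ge0_integral_affine_rV a c0 (mfun_EFin (mfun_norm mf)) (fun x => normr_ge0 (f x)).
move=> /= ->; rewrite lte_mul_pinfty ?lee_fin ?invr_ge0 ?exprn_ge0//.
Qed.

Let ge0_affine (g : 'rV[R]_n -> R) : measurable_fun setT g -> (forall x, 0 <= g x) ->
  \int[lebesgue_rV n]_x g (a + c *: x) = `|c| ^- n * \int[lebesgue_rV n]_x g x.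
Proof.
move=> mg g0; rewrite /Rintegral.
rewrite (ge0_integral_affine_rV a c0 (mfun_EFin mg) g0).
case: (\int[_]_x _)%E => [r||] //=; rewrite ?mulr0// /mule /= eqe.
  by case: ifP => //; case: ifP.
by case: ifP => //; case: ifP.
Qed.

Lemma Rint_affine :
  \int[lebesgue_rV n]_x f (a + c *: x) = `|c| ^- n * \int[lebesgue_rV n]_x f x.
Proof.
have mf := ig_measurable igf.
have ign := integrable_norm igf.
(* Writes [f] as the difference of the nonnegative functions [f + |f|] and [|f|], to which the
   extended-real formula applies. *)
pose g x := f x + `|f x|.
have igg : (lebesgue_rV n).-integrable setT (EFin \o g) by exact: igD.
have g0 x : 0 <= g x by rewrite /g; have := ler_norm (- f x); rewrite normrN; lra.
have fE x : f x = g x - `|f x| by rewrite /g addrK.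
transitivity (\int[lebesgue_rV n]_x (g (a + c *: x) - `|f (a + c *: x)|)).
  by apply: eq_Rintegral => x _; exact: fE.
have ignA : (lebesgue_rV n).-integrable setT (EFin \o (fun x => `|f (a + c *: x)|)).
  exact: (integrable_norm ig_affine).
have iggA : (lebesgue_rV n).-integrable setT (EFin \o (fun x => g (a + c *: x))).
  by apply: igD => //; exact: ig_affine.
rewrite RintB// (ge0_affine (ig_measurable igg) g0).
have -> : \int[lebesgue_rV n]_x `|f (a + c *: x)| = `|c| ^- n * \int[lebesgue_rV n]_x `|f x|.
  exact: (ge0_affine (ig_measurable ign) (fun x => normr_ge0 (f x))).
rewrite -mulrBr -RintB//; congr (_ * _); by apply: eq_Rintegral => x _; exact/esym/fE.
Qed.

End affine.

End Rint.

(** * The Poisson kernel in dimension n *)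

Section base.
Context {R : realType}.
Local Notation leb := (@lebesgue_measure R).

Lemma integral_prod_rV n (h : R -> R) (c : R) : measurable_fun setT h ->
  (forall x, 0 <= h x) -> (\int[leb]_x (h x)%:E = c%:E)%E ->
  (\int[lebesgue_rV n]_x (\prod_i h (x ord0 i))%:E = (c ^+ n)%:E)%E.
Proof.
move=> mh h0 hc.
have mp k : measurable_fun setT (fun x : 'rV[R]_k => \prod_i h (x ord0 i)).
  apply: (mfun_bigprod (h := fun i (x : 'rV[R]_k) => h (x ord0 i))) => i.
  exact: (measurableT_comp mh (measurable_coord_rV i)).
have c0 : 0 <= c.
  suff : (0 <= c%:E)%E by [].
  by rewrite -hc; apply: integral_ge0 => x _; exact: h0.
elim: n => [|n IH].
  rewrite integral_dirac//; last exact: (mfun_EFin (mp 0%N)).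
  by rewrite diracT mul1e big_ord0 expr0.
rewrite ge0_integral_lebesgue_rVS; last 2 first.
- exact: (mfun_EFin (mp n.+1)).
- by move=> x; apply: prodr_ge0 => i _; exact: h0.
transitivity (\int[leb]_x (c ^+ n * h x)%:E)%E.
  apply: eq_integral => x _; rewrite mulrC EFinM -IH -eintZ.
  - apply: eq_integral => y _; rewrite big_ord_recl cons_rV0.
    by congr (_ * _)%:E; apply: eq_bigr => i _; rewrite cons_rVS.
  - exact: h0.
  - exact: mp.
  - by move=> y; apply: prodr_ge0 => i _; exact: h0.
by rewrite eintZ ?exprn_ge0// hc -EFinM exprSr.
Qed.

(** Damping by the [l^1] norm: it factors over the coordinates, so its Fourier transform is the
    explicit nonnegative product [poissonn]. *)
Definition base n (de : R) (xi : 'rV[R]_n) : R := \prod_i expR (- de * `|xi ord0 i|).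

Definition poissonn n (de : R) (x : 'rV[R]_n) : R := \prod_i poisson de (x ord0 i).

Lemma poisson_ge0 (de x : R) : 0 < de -> 0 <= poisson de x.
Proof.
by move=> d0; rewrite /poisson divr_ge0 ?mulr_ge0 ?addr_ge0 ?sqr_ge0 ?(ltW d0).
Qed.

Lemma poissonn_ge0 n de (x : 'rV[R]_n) : 0 < de -> 0 <= poissonn de x.
Proof. by move=> d0; apply: prodr_ge0 => i _; exact: poisson_ge0. Qed.

Lemma base_ge0 n de (x : 'rV[R]_n) : 0 <= base de x.
Proof. by apply: prodr_ge0 => i _; exact: expR_ge0. Qed.

Lemma measurable_base n de : measurable_fun setT (@base n de).
Proof.
apply: (mfun_bigprod (h := fun i (x : 'rV[R]_n) => expR (- de * `|x ord0 i|))) => i.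
by mfun; exact: measurable_coord_rV.
Qed.

Lemma dotp_cons n (x : 'rV[R]_n.+1) y (z : 'rV[R]_n) :
  dotp x (cons_rV (y, z)) = x ord0 ord0 * y + dotp (\row_i x ord0 (lift ord0 i)) z.
Proof.
rewrite /dotp big_ord_recl cons_rV0; congr (_ + _).
by apply: eq_bigr => i _; rewrite cons_rVS mxE.
Qed.

Lemma base_cons n de y (z : 'rV[R]_n) :
  base de (cons_rV (y, z)) = expR (- de * `|y|) * base de z.
Proof.
rewrite /base big_ord_recl cons_rV0; congr (_ * _).
by apply: eq_bigr => i _; rewrite cons_rVS.
Qed.

Lemma cosD1_ge0 (x : R) : 0 <= 1 + cos x.
Proof. by rewrite -lerBlDl sub0r cos_geN1. Qed.

(** Induction on the dimension: the first coordinate is absorbed into the phase, which is why [a] is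
    arbitrary. *)
Lemma integral_base_cos n (de a : R) (x : 'rV[R]_n) : 0 < de ->
  (\int[lebesgue_rV n]_xi (base de xi * (1 + cos (a + dotp x xi)))%:E =
   ((2 / de) ^+ n + cos a * poissonn de x)%:E)%E.
Proof.
move=> d0.
have mF k b (u : 'rV[R]_k) : measurable_fun setT (fun xi => base de xi * (1 + cos (b + dotp u xi))).
  apply: mfun_mul; first exact: measurable_base.
  by mfun; apply: mfun_dotp.
have F0 k b (u xi : 'rV[R]_k) : 0 <= base de xi * (1 + cos (b + dotp u xi)).
  by rewrite mulr_ge0 ?base_ge0 ?cosD1_ge0.
elim: n => [|n IH] in a x *.
  rewrite integral_dirac//; last exact: (mfun_EFin (mF 0%N a x)).
  by rewrite diracT mul1e /base /dotp /poissonn !big_ord0 addr0 mul1r expr0 mulr1.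
rewrite ge0_integral_lebesgue_rVS; last 2 first.
- exact: (mfun_EFin (mF n.+1 a x)).
- by move=> xi; exact: F0.
set x' : 'rV[R]_n := \row_i x ord0 (lift ord0 i).
set P := poissonn de x'; set B := (2 / de) ^+ n.
have P0 : 0 <= P by exact: poissonn_ge0.
(* The induction hypothesis at phase [pi], where the cosine is -1, gives [P <= B]; the inner
   integral [B + P cos] thus splits into the nonnegative terms [B - P] and [P (1 + cos)]. *)
have BP : 0 <= B - P.
  have : (0 <= ((2 / de) ^+ n + cos pi * poissonn de x')%:E)%E.
    by rewrite -IH; apply: integral_ge0 => xi _; exact: F0.
  by rewrite cospi mulN1r lee_fin.
have mE1 : measurable_fun setT (fun y : R => expR (- de * `|y|)) by mfun.
have mE2 : measurable_fun setT (fun y : R => expR (- de * `|y|) * (1 + cos (a + x ord0 ord0 * y))).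
  by mfun.
transitivity (\int[leb]_y ((B - P) * expR (- de * `|y|) +
     P * (expR (- de * `|y|) * (1 + cos (a + x ord0 ord0 * y))))%:E)%E.
  apply: eq_integral => y _.
  transitivity (\int[lebesgue_rV n]_xi (expR (- de * `|y|) *
      (base de xi * (1 + cos ((a + x ord0 ord0 * y) + dotp x' xi))))%:E)%E.
    by apply: eq_integral => xi _; rewrite base_cons dotp_cons addrA mulrA.
  rewrite eintZ ?expR_ge0//.
  by rewrite IH -EFinM; congr EFin; rewrite -/B -/P; ring.
have E20 y : 0 <= expR (- de * `|y|) * (1 + cos (a + x ord0 ord0 * y)).
  by rewrite mulr_ge0 ?expR_ge0 ?cosD1_ge0.
have E10 y : 0 <= expR (- de * `|y|) by exact: expR_ge0.
rewrite eintD; last 4 first.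
- by mfun.
- by move=> y; rewrite mulr_ge0.
- by mfun.
- by move=> y; rewrite mulr_ge0.
rewrite !eintZ// integral_expcos// integral_explaplace// -!EFinM -EFinD; congr EFin.
rewrite /poissonn big_ord_recl (_ : \prod_(i < n) _ = P); last first.
  by apply: eq_bigr => i _; rewrite mxE.
by rewrite exprSr -/B; ring.
Qed.

Lemma integral_base n (de : R) : 0 < de ->
  (\int[lebesgue_rV n]_xi (base de xi)%:E = ((2 / de) ^+ n)%:E)%E.
Proof.
move=> d0; apply: (@integral_prod_rV n (fun y => expR (- de * `|y|))).
- by mfun.
- by move=> y; exact: expR_ge0.
- exact: integral_explaplace.
Qed.

Lemma ig_base n (de : R) : 0 < de ->
  (lebesgue_rV n).-integrable setT (EFin \o @base n de).
Proof.
move=> d0; apply: ge0_igP; [exact: measurable_base|exact: base_ge0|].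
by rewrite integral_base// ltry.
Qed.

Lemma ig_base_mul n (de M : R) (phi : 'rV[R]_n -> R) : 0 < de ->
  measurable_fun setT phi -> (forall xi, `|phi xi| <= M) ->
  (lebesgue_rV n).-integrable setT (EFin \o (fun xi => base de xi * phi xi)).
Proof. by move=> d0 mphi hM; apply: igMb hM => //; exact: ig_base. Qed.

Lemma Rint_base_cos n (de a : R) (x : 'rV[R]_n) : 0 < de ->
  \int[lebesgue_rV n]_xi (base de xi * cos (a + dotp x xi)) = cos a * poissonn de x.
Proof.
move=> d0.
have mc : measurable_fun setT (fun xi : 'rV[R]_n => cos (a + dotp x xi)).
  by mfun; apply: mfun_dotp.
have h : \int[lebesgue_rV n]_xi (base de xi + base de xi * cos (a + dotp x xi)) =
   (2 / de) ^+ n + cos a * poissonn de x.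
  rewrite /Rintegral; under eq_integral => xi _ do rewrite -[X in X + _]mulr1 -mulrDr.
  by rewrite integral_base_cos.
move: h; rewrite RintD; last 2 first.
- exact: ig_base.
- by apply: (ig_base_mul (M := 1)) => // xi; exact: cos_max.
rewrite [X in X + _](_ : _ = (2 / de) ^+ n); last by rewrite /Rintegral integral_base.
by move/addrI.
Qed.

End base.

(** * Positive definite functions *)

Section positive_definite.
Context {R : realType} {n : nat}.
Implicit Types (phi m : 'rV[R]_n -> R) (x xi : 'rV[R]_n).

Lemma dotpDl x y xi : dotp (x + y) xi = dotp x xi + dotp y xi :> R.
Proof. by rewrite /dotp -big_split; apply: eq_bigr => i _; rewrite mxE mulrDl. Qed.

Lemma dotpNl x xi : dotp (- x) xi = - dotp x xi :> R.
Proof. by rewrite /dotp -sumrN; apply: eq_bigr => i _; rewrite mxE mulNr. Qed.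

Lemma dotpC x xi : dotp x xi = dotp xi x :> R.
Proof. by apply: eq_bigr => i _; rewrite mulrC. Qed.

Lemma dotpZl c x xi : dotp (c *: x) xi = c * dotp x xi :> R.
Proof. by rewrite /dotp mulr_sumr; apply: eq_bigr => i _; rewrite mxE mulrA. Qed.

Lemma dot0p xi : dotp 0 xi = 0 :> R.
Proof. by rewrite /dotp big1// => i _; rewrite mxE mul0r. Qed.

Lemma dotpNr x xi : dotp xi (- x) = - dotp xi x :> R.
Proof. by rewrite dotpC dotpNl (dotpC xi). Qed.

Lemma dotpZr c x xi : dotp xi (c *: x) = c * dotp xi x :> R.
Proof. by rewrite dotpC dotpZl (dotpC xi). Qed.

Lemma measurable_dotp x : measurable_fun setT (dotp x : 'rV[R]_n -> R).
Proof. exact: mfun_dotp. Qed.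

(* Positive definiteness, tested by nonnegativity of the Fourier transform of
   phi damped by the kernels [base de]; in this form it is visibly stable under
   multiplication by cosines, hence by mixtures of cosines. *)
Definition posdef phi : Prop :=
  [/\ measurable_fun setT phi, exists M, forall xi, `|phi xi| <= M &
      forall de x, 0 < de ->
        0 <= \int[lebesgue_rV n]_xi (base de xi * (phi xi * cos (dotp x xi)))].

Lemma measurable_cosdotp x : measurable_fun setT (fun xi => cos (dotp x xi) : R).
Proof. by apply: mfun_cos; exact: measurable_dotp. Qed.

Lemma bounded_mulcos phi M x : (forall xi, `|phi xi| <= M) ->
  forall xi, `|phi xi * cos (dotp x xi)| <= M.
Proof.
by move=> h xi; rewrite normrM (le_trans _ (h xi))// ler_piMr// cos_max.
Qed.

Lemma ig_posdef phi M de x : measurable_fun setT phi -> (forall xi, `|phi xi| <= M) ->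
  0 < de ->
  (lebesgue_rV n).-integrable setT
    (EFin \o (fun xi => base de xi * (phi xi * cos (dotp x xi)))).
Proof.
move=> mphi hM d0; apply: (@ig_base_mul _ _ _ M) => //.
  by apply: mfun_mul => //; exact: measurable_cosdotp.
exact: bounded_mulcos.
Qed.

Lemma posdef_cst c : 0 <= c -> posdef (fun=> c).
Proof.
move=> c0; split; [exact: mfun_cst|by exists `|c| |move=> de x d0].
rewrite (_ : \int[_]_xi _ = \int[lebesgue_rV n]_xi (c * (base de xi * cos (0 + dotp x xi)))).
  rewrite RintZ; last first.
    apply: (@ig_base_mul _ _ _ 1) => //; last by move=> xi; exact: cos_max.
    by mfun; exact: measurable_dotp.
  by rewrite Rint_base_cos// cos0 mul1r mulr_ge0// poissonn_ge0.
by apply: eq_Rintegral => xi _; rewrite add0r mulrCA.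
Qed.

Lemma posdefD phi psi : posdef phi -> posdef psi -> posdef (fun xi => phi xi + psi xi).
Proof.
move=> [m1 [M1 b1] h1] [m2 [M2 b2] h2]; split; first exact: mfun_add.
  by exists (M1 + M2) => xi; rewrite (le_trans (ler_normD _ _))// lerD.
move=> de x d0.
rewrite (_ : \int[_]_xi _ = \int[lebesgue_rV n]_xi (base de xi * (phi xi * cos (dotp x xi)) +
   base de xi * (psi xi * cos (dotp x xi)))).
  rewrite RintD; last 2 first.
    by apply: ig_posdef d0; [exact: m1|exact: b1].
    by apply: ig_posdef d0; [exact: m2|exact: b2].
  by rewrite addr_ge0 ?h1 ?h2.
by apply: eq_Rintegral => xi _; ring.
Qed.

Lemma posdefZ c phi : 0 <= c -> posdef phi -> posdef (fun xi => c * phi xi).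
Proof.
move=> c0 [m1 [M1 b1] h1]; split; first by mfun.
  by exists (c * M1) => xi; rewrite normrM ger0_norm// ler_wpM2l.
move=> de x d0.
rewrite (_ : \int[_]_xi _ = \int[lebesgue_rV n]_xi (c * (base de xi * (phi xi * cos (dotp x xi))))).
  rewrite RintZ; last by apply: ig_posdef d0; [exact: m1|exact: b1].
  by rewrite mulr_ge0 ?h1.
by apply: eq_Rintegral => xi _; ring.
Qed.

Lemma posdef_cvg (phi_ : nat -> 'rV[R]_n -> R) phi M : (forall j, posdef (phi_ j)) ->
  (forall j xi, `|phi_ j xi| <= M) ->
  (forall xi, phi_ j xi @[j --> \oo] --> phi xi) -> posdef phi.
Proof.
move=> pd b l; split.
- apply: (measurable_fun_cvg (h := phi_)) => [j|xi _]; last exact: l.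
  by have [] := pd j.
- exists M => xi.
  have h : `|phi_ j xi| @[j --> \oo] --> `|phi xi| by apply: cvg_norm; exact: l.
  rewrite -(cvg_lim _ h)//; apply: limr_le; first exact: cvgP h.
  by apply: nearW => j; exact: b.
- move=> de x d0.
  have h : \int[lebesgue_rV n]_xi (base de xi * (phi_ j xi * cos (dotp x xi))) @[j --> \oo]
     --> \int[lebesgue_rV n]_xi (base de xi * (phi xi * cos (dotp x xi))).
    apply: (@Rint_cvg _ _ _ _ _ _ (fun xi => M * base de xi)).
    + by apply: igZ; exact: ig_base.
    + move=> j; have [mj _ _] := pd j; apply: mfun_mul; first exact: measurable_base.
      by apply: mfun_mul => //; exact: measurable_cosdotp.
    + by move=> xi; apply: cvgMr; apply: cvgMl; exact: l.
    + move=> j xi; rewrite normrM ger0_norm ?base_ge0// mulrC.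
      by rewrite ler_wpM2r ?base_ge0// bounded_mulcos.
  rewrite -(cvg_lim _ h)//; apply: limr_ge; first exact: cvgP h.
  by apply: nearW => j; have [_ _ ->] := pd j.
Qed.

Section mixture.
Context d (Y : measurableType d) (nu : {sigma_finite_measure set Y -> \bar R}).
Variables (k : Y -> R) (v : Y -> 'rV[R]_n).
Hypotheses (k0 : forall y, 0 <= k y) (igk : nu.-integrable setT (EFin \o k)).
Hypothesis mv : measurable_fun setT v.

(** The real part of the Fourier transform of the image under [v] of the finite measure with density
    [k]. *)
Definition cos_mixture xi : R := \int[nu]_y (k y * cos (dotp (v y) xi)).

Let mk : measurable_fun setT k. Proof. exact: ig_measurable igk. Qed.

Lemma ig_cos_mixture xi : nu.-integrable setT (EFin \o (fun y => k y * cos (dotp (v y) xi))).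
Proof.
apply: (igMb igk (M := 1)) => [|y]; last exact: cos_max.
by apply: mfun_cos; apply: mfun_dotp.
Qed.

Lemma cos_mixture_bounded xi : `|cos_mixture xi| <= \int[nu]_y k y.
Proof.
apply: Rint_norm_le igk _ _.
  by apply: mfun_mul => //; apply: mfun_cos; apply: mfun_dotp.
by move=> y; rewrite normrM ger0_norm// ler_piMr ?cos_max.
Qed.

(** For fixed [y], the product of the cosines at [v y] and [x] is half the sum of those at [v y + x]
    and [v y - x], so the test of the product at [x] is a nonnegative mixture of tests of [phi] at
    shifted frequencies. *)
Lemma posdef_mixture phi : posdef phi -> posdef (fun xi => phi xi * cos_mixture xi).
Proof.
move=> [mphi [M b] h].
have mphi1 : measurable_fun setT (fun z : 'rV[R]_n * Y => phi z.1).
  exact: measurableT_comp mphi measurable_fst.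
have mb1 de : measurable_fun setT (fun z : 'rV[R]_n * Y => base de z.1).
  exact: measurableT_comp (measurable_base _) measurable_fst.
have mk2 : measurable_fun setT (fun z : 'rV[R]_n * Y => k z.2).
  exact: measurableT_comp mk measurable_snd.
have mv2 : measurable_fun setT (fun z : 'rV[R]_n * Y => v z.2).
  exact: measurableT_comp mv measurable_snd.
have mc2 : measurable_fun setT (fun z : 'rV[R]_n * Y => cos (dotp (v z.2) z.1)).
  by apply: mfun_cos; apply: mfun_dotp.
have mx1 x : measurable_fun setT (fun z : 'rV[R]_n * Y => cos (dotp x z.1)).
  exact: measurableT_comp (measurable_cosdotp x) measurable_fst.
have kc y xi : `|k y * cos (dotp (v y) xi)| <= k y.
  by rewrite normrM ger0_norm// ler_piMr ?cos_max.
have mm : measurable_fun setT cos_mixture.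
  (* Measurability is obtained through joint integrability, although Lebesgue measure is infinite:
     [base 1] makes the integrand integrable and [base (- 1)] undoes it. *)
  have : measurable_fun setT (fun xi => base (- 1) xi *
      \int[nu]_y (base 1 xi * (k y * cos (dotp (v y) xi)))).
    apply: mfun_mul; first exact: measurable_base.
    apply: (@mfun_Rint1 _ _ _ _ _ (lebesgue_rV n) nu
      (fun xi y => base 1 xi * (k y * cos (dotp (v y) xi))) (base 1) k) => //.
    - by mfun.
    - exact: ig_base.
    - by move=> xi y; rewrite normrM ger0_norm ?base_ge0// ler_wpM2l ?base_ge0.
  congr (measurable_fun _ _); apply/funext => xi.
  rewrite RintZ; last exact: ig_cos_mixture.
  rewrite mulrA /base -big_split/= big1 ?mul1r// => i _.
  by rewrite -expRD -mulrDl addNr mul0r expR0.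
split.
- exact: mfun_mul.
- exists (M * \int[nu]_y k y) => xi.
  by rewrite normrM ler_pM ?cos_mixture_bounded.
move=> de x d0.
pose F xi y := base de xi * (phi xi * (k y * (cos (dotp (v y) xi) * cos (dotp x xi)))).
have FE : \int[lebesgue_rV n]_xi (base de xi * (phi xi * cos_mixture xi * cos (dotp x xi))) =
    \int[lebesgue_rV n]_xi \int[nu]_y F xi y.
  apply: eq_Rintegral => xi _; rewrite /F.
  rewrite [RHS](_ : _ = \int[nu]_y (base de xi * phi xi * cos (dotp x xi) * (k y * cos (dotp (v y) xi)))).
    rewrite RintZ; last exact: ig_cos_mixture.
    by rewrite /cos_mixture; ring.
  by apply: eq_Rintegral => y _; ring.
rewrite FE (@Rint_fubini _ _ _ _ _ (lebesgue_rV n) nu F (fun xi => M * base de xi) k).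
- apply: Rintegral_ge0 => y _; rewrite /F.
  rewrite [X in 0 <= X](_ : _ = \int[lebesgue_rV n]_xi (k y / 2 *
     (base de xi * (phi xi * cos (dotp (v y + x) xi)) +
      base de xi * (phi xi * cos (dotp (v y - x) xi))))).
    rewrite RintZ; last by apply: igD; apply: ig_posdef d0; [exact: mphi|exact: b|exact: mphi|exact: b].
    rewrite RintD; [|by apply: ig_posdef d0; [exact: mphi|exact: b]..].
    by rewrite mulr_ge0 ?divr_ge0// addr_ge0 ?h.
  by apply: eq_Rintegral => xi _; rewrite !dotpDl dotpNl cosD cosB; field.
- by have mb1d := mb1 de; have mx1x := mx1 x; rewrite /F; mfun.
- by apply: igZ; exact: ig_base.
- exact: igk.
- move=> xi y; rewrite /F !normrM ger0_norm ?base_ge0// [`|k y|]ger0_norm//.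
  have h1 := cos_max (dotp (v y) xi); have h2 := cos_max (dotp x xi).
  rewrite [M * _]mulrC -mulrA ler_wpM2l ?base_ge0// ler_pM ?mulr_ge0// ler_piMr//.
  by rewrite mulr_ile1.
Qed.

End mixture.

(** Powers of [m] are built from the constant 1 by repeated multiplication, so the last hypothesis
    asks that [m] act on positive definite functions as a multiplier. The partial sums of the series
    have nonnegative coefficients and are dominated by [expR (s * M)]. *)
Lemma posdef_expR (s M : R) m : 0 <= s -> measurable_fun setT m ->
  (forall xi, `|m xi| <= M) -> (forall phi, posdef phi -> posdef (fun xi => phi xi * m xi)) ->
  posdef (fun xi => expR (s * m xi)).
Proof.
move=> s0 mm mM pdm.
have M0 : 0 <= M by apply: le_trans (mM 0).
have pdX j : posdef (fun xi => m xi ^+ j).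
  elim: j => [|j IH]; first exact: posdef_cst.
  rewrite (_ : (fun xi => m xi ^+ j.+1) = (fun xi => m xi ^+ j * m xi)); first exact: pdm.
  by apply/funext => xi; rewrite exprSr.
have pdS j : posdef (fun xi => series (exp_coeff (s * m xi)) j).
  elim: j => [|j IH].
    rewrite (_ : (fun xi => _) = fun=> 0); first exact: posdef_cst.
    by apply/funext => xi; rewrite /series/= big_geq.
  rewrite (_ : (fun xi => _) = (fun xi => series (exp_coeff (s * m xi)) j +
     s ^+ j / j`!%:R * m xi ^+ j)).
    by apply: posdefD => //; apply: posdefZ => //; rewrite divr_ge0 ?exprn_ge0.
  apply/funext => xi; rewrite /series/= big_nat_recr//=; congr (_ + _).
  by rewrite /exp_coeff/= exprMn mulrAC.
apply: (posdef_cvg (M := expR (s * M)) pdS) => [j xi|xi]; last first.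
  exact: is_cvg_series_exp_coeff.
apply: (@le_trans _ _ (series (exp_coeff (s * M)) j)).
  rewrite /series/= (le_trans (ler_norm_sum _ _ _))// ler_sum// => i _.
  rewrite /exp_coeff/= normrM normrX [`|_^-1|]ger0_norm// ler_wpM2r// lerXn2r ?nnegrE ?mulr_ge0//.
  by rewrite normrM ger0_norm// ler_wpM2l.
apply: nondecreasing_cvgn_le; last exact: is_cvg_series_exp_coeff.
apply/nondecreasing_seqP => i; rewrite /series/= big_nat_recr//= lerDl.
by rewrite /exp_coeff/= divr_ge0// exprn_ge0// mulr_ge0.
Qed.

Section levy.
Context d (Y : measurableType d) (nu : {sigma_finite_measure set Y -> \bar R}).
Variables (k : nat -> Y -> R) (v : Y -> 'rV[R]_n) (psi : 'rV[R]_n -> R).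
Hypotheses (k0 : forall j y, 0 <= k j y).
Hypothesis igk : forall j, nu.-integrable setT (EFin \o k j).
Hypothesis mv : measurable_fun setT v.
Hypothesis psiE : forall xi,
  \int[nu]_y (k j y * (1 - cos (dotp (v y) xi))) @[j --> \oo] --> psi xi.

(** With [L j] the total mass and [m j] the cosine mixture, the exponential factors into the
    positive constant [exp (- t L j)] and [exp (t m j)]; since [m j <= L j], the approximations are
    bounded by 1. *)
Lemma posdef_levy t : 0 <= t -> posdef (fun xi => expR (- t * psi xi)).
Proof.
move=> t0.
pose m j := cos_mixture nu (k j) v.
pose L j := \int[nu]_y k j y.
have kE j xi : \int[nu]_y (k j y * (1 - cos (dotp (v y) xi))) = L j - m j xi.
  rewrite /L /m /cos_mixture -RintB//; last exact: ig_cos_mixture.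
  by apply: eq_Rintegral => y _; rewrite mulrBr mulr1.
have mb j xi := cos_mixture_bounded (k0 j) (igk j) mv xi.
have pm j phi : posdef phi -> posdef (fun xi => phi xi * m j xi) by exact: posdef_mixture.
have mm j : measurable_fun setT (m j).
  have [] := pm j _ (posdef_cst ler01).
  by rewrite (_ : (fun xi => _) = m j)//; apply/funext => xi; rewrite mul1r.
apply: (@posdef_cvg (fun j xi => expR (- t * (L j - m j xi))) _ 1).
- move=> j; rewrite (_ : (fun xi => _) = (fun xi => expR (- t * L j) * expR (t * m j xi))).
    by apply: posdefZ; [exact: expR_ge0|exact: (posdef_expR t0 (mm j) (mb j) (pm j))].
  by apply/funext => xi; rewrite -expRD; congr expR; ring.
- move=> j xi; rewrite ger0_norm ?expR_ge0// -expR0 ler_expR mulNr oppr_le0.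
  by rewrite mulr_ge0// subr_ge0; exact: (le_trans (ler_norm _) (mb j xi)).
- move=> xi; apply: continuous_cvg; first exact: continuous_expR.
  apply: cvgMr; have := @psiE xi.
  by under eq_fun do rewrite kE.
Qed.

End levy.

End positive_definite.

(** * The stable kernel *)

Section Rint_extra.
Context {R : realType} d1 d2 (T1 : measurableType d1) (T2 : measurableType d2).

(** A divergent integral counts as 0 on the left, and the bound survives. *)
Lemma abs_Rint_le (mu : {measure set T1 -> \bar R}) (f : T1 -> R) :
  measurable_fun setT f -> ((`|\int[mu]_x f x|)%:E <= \int[mu]_x (`|f x|)%:E)%E.
Proof.
move=> mf; apply: (@le_trans _ _ `|\int[mu]_x (f x)%:E|%E).
  by rewrite /Rintegral; case: (\int[mu]_x (f x)%:E)%E => [r||] /=; rewrite ?normr0 ?leey.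
exact: (le_abse_integral mu measurableT (mfun_EFin mf)).
Qed.

(** Tonelli is applied to the positive and to the negative part separately; the passage from
    extended reals to reals is measurable. *)
Lemma mfun_Rint (m2 : {sigma_finite_measure set T2 -> \bar R}) (f : T1 -> T2 -> R) :
  measurable_fun setT (fun z : T1 * T2 => f z.1 z.2) ->
  measurable_fun setT (fun x => \int[m2]_y f x y).
Proof.
move=> mf; apply: (measurableT_comp (fine_measurable measurableT)).
rewrite [X in measurable_fun _ X](_ : _ = (fun x =>
   \int[m2]_y (Num.max (f x y) 0)%:E - \int[m2]_y (Num.max (- f x y) 0)%:E)%E).
  have mp (g : T1 * T2 -> R) : measurable_fun setT g ->
      measurable_fun setT (fun x => \int[m2]_y (Num.max (g (x, y)) 0)%:E)%E.
    move=> mg.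
    have mg1 : measurable_fun setT (fun z => (Num.max (g z) 0)%:E).
      by apply: mfun_EFin; exact: measurable_maxr.
    have g0 z : (0 <= (Num.max (g z) 0)%:E)%E by rewrite lee_fin le_max lexx orbT.
    exact: (measurable_fun_fubini_tonelli_F (m2 := m2) _ mg1 g0).
  apply: emeasurable_funB; first exact: mp mf.
  by apply: (mp (fun z => - f z.1 z.2)); exact: mfun_opp.
apply/funext => x; rewrite integralE.
by congr (_ - _)%E; apply: eq_integral => y _; rewrite ?funeposE ?funenegE/= -?EFinN -EFin_max.
Qed.

End Rint_extra.

Section base_limit.
Context {R : realType} {n : nat}.
Implicit Types xi : 'rV[R]_n.

Lemma base_cvg1 xi : base j.+1%:R^-1 xi @[j --> \oo] --> (1 : R).
Proof.
set S := \sum_i `|xi ord0 i|.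
have : - j.+1%:R^-1 * S @[j --> \oo] --> - 0 * S.
  by apply: cvgMl; apply: cvgN; exact: cvg_harmonic.
rewrite oppr0 mul0r => h0.
have : expR (- j.+1%:R^-1 * S) @[j --> \oo] --> expR 0.
  by apply: continuous_cvg => //; exact: continuous_expR.
by rewrite expR0 /S; under eq_fun do rewrite mulr_sumr expR_sum.
Qed.

Lemma base_le1 de xi : 0 <= de -> base de xi <= 1.
Proof.
move=> d0; rewrite /base -expR_sum -expR0 ler_expR -mulr_sumr mulNr oppr_le0.
by rewrite mulr_ge0// sumr_ge0.
Qed.

Lemma base_homo (a b : R) xi : a <= b -> base b xi <= base a xi.
Proof.
move=> ab; rewrite /base -!expR_sum ler_expR -!mulr_sumr !mulNr lerN2.
by rewrite ler_wpM2r// sumr_ge0.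
Qed.

End base_limit.

(* The properties of the characteristic exponent [psi] that the argument uses. *)
Record is_symbol (R : realType) (n : nat) (q : 'rV[R]_n -> R) (beta c : R) : Prop := {
  symbol_beta_gt0 : 0 < beta;
  symbol_c_gt0 : 0 < c;
  symbol_measurable : measurable_fun setT q;
  symbol_even : forall xi, q (- xi) = q xi;
  symbol_homogeneous : forall (a : R) xi, 0 < a -> q (a *: xi) = a `^ beta * q xi;
  symbol_lower : forall xi : 'rV[R]_n, c * \sum_i `|xi ord0 i| `^ beta <= q xi;
  symbol_ray : forall zeta z : 'rV[R]_n,
    q (zeta + j.+1%:R^-1 *: z) @[j --> \oo] --> q zeta;
  symbol_posdef : forall t, 0 <= t -> posdef (fun xi => expR (- t * q xi)) }.

Fact gk_key : unit.
Proof. by []. Qed.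

Section symbol.
Context {R : realType} {n : nat}.
Local Notation lam := (lebesgue_rV n : {sigma_finite_measure set 'rV[R]_n -> \bar R}).
Variables (q : 'rV[R]_n -> R) (beta c : R).
Hypothesis H : is_symbol q beta c.
Let beta0 := symbol_beta_gt0 H.
Let c0 := symbol_c_gt0 H.
Let q_measurable := symbol_measurable H.
Let q_homogeneous := symbol_homogeneous H.
Let q_lower := symbol_lower H.
Let q_posdef := symbol_posdef H.

Lemma q_ge0 (xi : 'rV[R]_n) : 0 <= q xi.
Proof.
apply: le_trans (q_lower xi); rewrite mulr_ge0 ?(ltW c0)//.
by apply: sumr_ge0 => i _; exact: powR_ge0.
Qed.

(** Homogeneity with factor 2 gives [q 0 = 2 ^ beta q 0], and [2 ^ beta > 1]. *)
Lemma q0 : q 0 = 0.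
Proof.
have := q_homogeneous 0 (ltr0Sn R 1); rewrite scaler0.
have h : 1 < 2%:R `^ beta :> R.
  have := @gt0_ltr_powR R beta beta0 1 2; rewrite powR1; apply.
  - by rewrite nnegrE.
  - by rewrite nnegrE.
  - by rewrite ltr1n.
by move=> e; have := q_ge0 0; nra.
Qed.

Lemma expRq_le1 t xi : 0 <= t -> expR (- t * q xi) <= 1.
Proof. by move=> t0; rewrite -expR0 ler_expR mulNr oppr_le0 mulr_ge0 ?q_ge0. Qed.

Lemma measurable_expRq t : measurable_fun setT (fun xi => expR (- t * q xi)).
Proof. by mfun. Qed.

(** The lower bound on the symbol is a sum over the coordinates, so the majorant is a product of
    one-dimensional integrable functions. *)
Lemma ig_expRq t : 0 < t -> lam.-integrable setT (EFin \o (fun xi => expR (- t * q xi))).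
Proof.
move=> t0; pose h (y : R) := expR (- (t * c * `|y| `^ beta)).
have mh : measurable_fun setT h by rewrite /h; mfun.
have h0 y : 0 <= h y by exact: expR_ge0.
have hoo : (\int[lebesgue_measure]_y (h y)%:E < +oo)%E.
  by apply: integrable_expR_powR => //; exact: mulr_gt0.
have hE : (\int[lebesgue_measure]_y (h y)%:E = (\int[lebesgue_measure]_y h y)%:E)%E.
  by rewrite Rint_EFin//; exact: ge0_igP.
have mp : measurable_fun setT (fun x : 'rV[R]_n => \prod_i h (x ord0 i)).
  apply: (mfun_bigprod (h := fun i (x : 'rV[R]_n) => h (x ord0 i))) => i.
  exact: (measurableT_comp mh (measurable_coord_rV i)).
have igp : lam.-integrable setT (EFin \o (fun x => \prod_i h (x ord0 i))).
  apply: ge0_igP => //; first by move=> x; apply: prodr_ge0 => i _.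
  by rewrite (integral_prod_rV n mh h0 hE) ltry.
apply: ig_le igp (measurable_expRq t) _ => xi.
rewrite ger0_norm ?expR_ge0// /h -expR_sum ler_expR sumrN mulNr lerN2.
rewrite -mulr_sumr -mulrA ler_wpM2l ?(ltW t0)//.
Qed.

(* Sealed, since unification would otherwise unfold the integral. *)
Definition gk : R -> 'rV[R]_n -> R := locked_with gk_key (fun t x =>
  (2 * pi) ^- n * \int[lam]_xi (cos (dotp x xi) * expR (- t * q xi))).

Lemma gkE t x : gk t x =
  (2 * pi) ^- n * \int[lam]_xi (cos (dotp x xi) * expR (- t * q xi)).
Proof. by rewrite /gk unlock. Qed.

Let k2pi0 : 0 < ((2 * pi) ^- n : R).
Proof. by rewrite invr_gt0 exprn_gt0// mulr_gt0// pi_gt0. Qed.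

Lemma ig_cosexpRq t x : 0 < t ->
  lam.-integrable setT (EFin \o (fun xi => cos (dotp x xi) * expR (- t * q xi))).
Proof.
move=> t0; apply: (ig_le (ig_expRq t0)).
  by apply: mfun_mul; [exact: measurable_cosdotp|exact: measurable_expRq].
by move=> xi; rewrite normrM [`|expR _|]ger0_norm ?expR_ge0// ler_piMl ?expR_ge0// cos_max.
Qed.

(** Positive definiteness of [exp (- t q)] says that the damped inverse transforms are nonnegative;
    the damping is removed by dominated convergence. *)
Lemma gk_ge0 t x : 0 < t -> 0 <= gk t x.
Proof.
move=> t0; rewrite gkE mulr_ge0 ?(ltW k2pi0)//.
have h : \int[lam]_xi (base j.+1%:R^-1 xi * (expR (- t * q xi) * cos (dotp x xi)))
   @[j --> \oo] --> \int[lam]_xi (cos (dotp x xi) * expR (- t * q xi)).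
  apply: (@Rint_cvg _ _ _ _ _ _ (fun xi => expR (- t * q xi))).
  - exact: ig_expRq.
  - move=> j; apply: mfun_mul; first exact: measurable_base.
    by apply: mfun_mul; [exact: measurable_expRq|exact: measurable_cosdotp].
  - move=> xi; rewrite [X in _ --> X](_ : _ = 1 * (expR (- t * q xi) * cos (dotp x xi))); last by ring.
    by apply: cvgMl; exact: base_cvg1.
  - move=> j xi; rewrite normrM ger0_norm ?base_ge0//.
    rewrite normrM [`|expR _|]ger0_norm ?expR_ge0//.
    rewrite -[leRHS]mul1r ler_pM ?base_ge0 ?mulr_ge0 ?expR_ge0 ?base_le1//.
    by rewrite ler_piMr ?expR_ge0 ?cos_max.
rewrite -(cvg_lim _ h)//; apply: limr_ge; first exact: cvgP h.
by apply: nearW => j; have [_ _ ->] := q_posdef (ltW t0).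
Qed.

Lemma gkN t x : gk t (- x) = gk t x.
Proof.
by rewrite !gkE; congr (_ * _); apply: eq_Rintegral => xi _; rewrite dotpNl cosN.
Qed.

Lemma gk_scale r t x : 0 < r -> 0 < t -> gk (r `^ beta * t) x = r ^- n * gk t (r^-1 *: x).
Proof.
move=> r0 t0; rewrite !gkE mulrCA; congr (_ * _).
have ig1 := ig_cosexpRq (r^-1 *: x) t0.
have rn0 : r != 0 by rewrite gt_eqF.
have := Rint_affine 0 rn0 ig1; rewrite gtr0_norm// => <-.
apply: eq_Rintegral => xi _; rewrite add0r dotpZl dotpZr mulrA mulVf// mul1r.
by rewrite q_homogeneous//; congr (_ * expR _); ring.
Qed.

Lemma measurable_gk2 d (T : measurableType d) (f : T -> R) (g : T -> 'rV[R]_n) :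
  measurable_fun setT f -> measurable_fun setT g ->
  measurable_fun setT (fun z => gk (f z) (g z)).
Proof.
move=> mf mg; under eq_fun do rewrite gkE.
apply: mfun_mul; first exact: mfun_cst.
apply: (@mfun_Rint R _ _ T _ lam (fun z xi => cos (dotp (g z) xi) * expR (- f z * q xi))).
have mf1 : measurable_fun setT (fun z : T * 'rV[R]_n => f z.1).
  exact: measurableT_comp mf measurable_fst.
have mg1 : measurable_fun setT (fun z : T * 'rV[R]_n => g z.1).
  exact: measurableT_comp mg measurable_fst.
have mq1 : measurable_fun setT (fun z : T * 'rV[R]_n => q z.2).
  exact: measurableT_comp q_measurable measurable_snd.
by mfun; apply: mfun_dotp => //; exact: measurable_snd.
Qed.

Lemma measurable_gk t : measurable_fun setT (gk t).
Proof. by apply: measurable_gk2 => //; exact: mfun_cst. Qed.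

Definition gk_sup : R := gk 1 0.

Lemma gk_le0 t x : 0 < t -> gk t x <= gk t 0.
Proof.
move=> t0; rewrite !gkE ler_wpM2l ?(ltW k2pi0)//.
apply: Rint_le; [exact: ig_cosexpRq|exact: ig_cosexpRq|].
by move=> xi; rewrite dot0p cos0 mul1r ler_piMl ?expR_ge0 ?cos_le1.
Qed.

Lemma gk0E t : 0 < t -> gk t 0 = t `^ (- (n%:R / beta)) * gk_sup.
Proof.
move=> t0; pose r := t `^ beta^-1.
have r0 : 0 < r by rewrite powR_gt0.
have rb : r `^ beta = t by rewrite -powRrM mulVf ?gt_eqF// powRr1 ?(ltW t0).
have -> : gk t 0 = gk (r `^ beta * 1) 0 by rewrite rb mulr1.
rewrite gk_scale// scaler0 /gk_sup; congr (_ * _).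
by rewrite /r -powR_mulrn ?powR_ge0// -powRrM -powRN; congr powR; rewrite mulrC.
Qed.

Lemma gk_sup_ge0 : 0 <= gk_sup.
Proof. exact: gk_ge0. Qed.

Lemma gk_bound t x : 0 < t -> gk t x <= t `^ (- (n%:R / beta)) * gk_sup.
Proof. by move=> t0; rewrite -gk0E// gk_le0. Qed.

(** [exp (- s q)] is split into two halves. One pays for the factor [q] coming from
    [1 - exp (- (t - s) q)], through [q exp (- s q / 2) <= 2 / s]; the other is integrable, with
    integral proportional to [gk (s / 2) 0]. *)
Lemma gk_lipschitz_sup s t x : 0 < s -> s <= t ->
  `|gk t x - gk s x| <= (t - s) * (2 / s) * gk (s / 2) 0.
Proof.
move=> s0 st; have t0 := lt_le_trans s0 st; have s20 : 0 < s / 2 by rewrite divr_gt0.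
rewrite !gkE -mulrBr normrM gtr0_norm// [leRHS]mulrCA ler_wpM2l ?(ltW k2pi0)//.
rewrite -RintB; [|exact: ig_cosexpRq|exact: ig_cosexpRq].
rewrite -RintZ; last exact: ig_cosexpRq.
apply: Rint_norm_le.
- by apply: igZ; exact: ig_cosexpRq.
- have := measurable_cosdotp x; have := measurable_expRq t; have := measurable_expRq s.
  by move=> *; mfun.
move=> xi; rewrite -mulrBr normrM dot0p cos0 mul1r.
apply: le_trans (_ : `|expR (- t * q xi) - expR (- s * q xi)| <= _).
  by rewrite ler_piMl ?cos_max.
have q0 := q_ge0 xi.
have -> : expR (- t * q xi) = expR (- s * q xi) * expR (- ((t - s) * q xi)).
  by rewrite -expRD; congr expR; ring.
have E1 : expR (- ((t - s) * q xi)) <= 1.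
  by rewrite -expR0 ler_expR oppr_le0 mulr_ge0 ?subr_ge0.
have -> : expR (- s * q xi) = expR (- (s / 2) * q xi) * expR (- (s / 2 * q xi)).
  by rewrite -expRD; congr expR; field.
set E := expR (- (s / 2) * q xi); set E2 := expR (- (s / 2 * q xi)).
set E3 := expR (- ((t - s) * q xi)) in E1 *.
have -> : `|E * E2 * E3 - E * E2| = E * (E2 * (1 - E3)).
  rewrite -[X in _ - X]mulr1 -mulrBr normrM ger0_norm ?mulr_ge0 ?expR_ge0//.
  by rewrite distrC ger0_norm ?subr_ge0// mulrA.
rewrite [leRHS]mulrC ler_wpM2l ?expR_ge0//.
have h3 : 1 - E3 <= (t - s) * q xi.
  by have := expR_ge1Dx (- ((t - s) * q xi)); rewrite -/E3; lra.
have h2 : q xi * E2 <= 2 / s.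
  rewrite /E2 expRN ler_pdivrMr ?expR_gt0//.
  have := expR_ge1Dx (s / 2 * q xi); set X := expR _ => h.
  by rewrite mulrAC ler_pdivlMr//; lra.
apply: le_trans (_ : E2 * ((t - s) * q xi) <= _).
  by rewrite ler_wpM2l ?expR_ge0.
by rewrite mulrCA [E2 * _]mulrC ler_wpM2l// subr_ge0.
Qed.

End symbol.

(** * Fourier inversion and the semigroup property *)

Section cauchy_kernel.
Context {R : realType} {n : nat}.
Local Notation lam := (lebesgue_rV n : {sigma_finite_measure set 'rV[R]_n -> \bar R}).
Implicit Types x z xi zeta : 'rV[R]_n.

Definition cauchyn z : R := \prod_i (1 + z ord0 i ^+ 2)^-1.

Let mc1 : measurable_fun setT (fun x : R => (1 + x ^+ 2)^-1).
Proof. by apply: continuous_measurable_fun => x; exact: (@continuous_oneDsqrV R). Qed.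

Let c1_ge0 (x : R) : 0 <= (1 + x ^+ 2)^-1.
Proof. by rewrite invr_ge0 addr_ge0// sqr_ge0. Qed.

Lemma cauchyn_ge0 z : 0 <= cauchyn z.
Proof. by apply: prodr_ge0. Qed.

Lemma measurable_cauchyn : measurable_fun setT cauchyn.
Proof.
apply: (mfun_bigprod (h := fun i (x : 'rV[R]_n) => (1 + x ord0 i ^+ 2)^-1)) => i.
exact: (measurableT_comp mc1 (measurable_coord_rV i)).
Qed.

Lemma integral_cauchyn : (\int[lam]_z (cauchyn z)%:E = (pi ^+ n)%:E)%E.
Proof. exact: (integral_prod_rV n mc1 c1_ge0 integral_cauchy). Qed.

Lemma ig_cauchyn : lam.-integrable setT (EFin \o cauchyn).
Proof.
apply: ge0_igP; [exact: measurable_cauchyn|exact: cauchyn_ge0|].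
by rewrite integral_cauchyn ltry.
Qed.

Lemma Rint_cauchyn : \int[lam]_z cauchyn z = pi ^+ n.
Proof. by rewrite /Rintegral integral_cauchyn. Qed.

Lemma poissonnN de x : poissonn de (- x) = poissonn de x.
Proof. by apply: eq_bigr => i _; rewrite mxE /poisson sqrrN. Qed.

Lemma measurable_poissonn de : measurable_fun setT (poissonn de : 'rV[R]_n -> R).
Proof.
apply: (mfun_bigprod (h := fun i (x : 'rV[R]_n) => poisson de (x ord0 i))) => i.
have mp : measurable_fun setT (poisson de : R -> R).
  have [->|d0] := eqVneq de 0.
    rewrite (_ : poisson 0 = fun=> 0); first exact: mfun_cst.
    by apply/funext => x; rewrite /poisson mulr0 mul0r.
  apply: continuous_measurable_fun => x; apply: cvgMr; apply: cvgV.
    by rewrite gt_eqF// ltr_pwDl ?sqr_ge0// exprn_even_gt0.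
  by apply: cvgD; [exact: cvg_cst|exact: exprn_continuous].
exact: (measurableT_comp mp (measurable_coord_rV i)).
Qed.

Lemma poissonn_le de x : 0 < de -> `|poissonn de x| <= (2 / de) ^+ n.
Proof.
move=> d0; have := Rint_base_cos 0 x d0; rewrite cos0 mul1r => <-.
have -> : (2 / de) ^+ n = \int[lam]_xi base de xi by rewrite /Rintegral integral_base.
apply: Rint_norm_le; first exact: ig_base.
  by apply: mfun_mul; [exact: measurable_base|mfun; exact: measurable_dotp].
by move=> xi; rewrite normrM ger0_norm ?base_ge0// ler_piMr ?base_ge0 ?cos_max.
Qed.

Lemma poissonn_scale de z : 0 < de -> de ^+ n * poissonn de (de *: z) = 2 ^+ n * cauchyn z.
Proof.
move=> d0; rewrite /poissonn /cauchyn.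
have prodc (a : R) : a ^+ n = \prod_(i < n) a by rewrite prodr_const card_ord.
rewrite !prodc -!big_split/=; apply: eq_bigr => i _; rewrite mxE /poisson exprMn.
have -> : de ^+ 2 + de ^+ 2 * z ord0 i ^+ 2 = de ^+ 2 * (1 + z ord0 i ^+ 2) by ring.
rewrite invfM -exprVn; set v := (1 + _)^-1; field.
by rewrite gt_eqF.
Qed.

End cauchy_kernel.

Section inversion.
Context {R : realType} {n : nat}.
Local Notation lam := (lebesgue_rV n : {sigma_finite_measure set 'rV[R]_n -> \bar R}).
Variables (q : 'rV[R]_n -> R) (beta c : R).
Hypothesis H : is_symbol q beta c.
Implicit Types x z xi zeta : 'rV[R]_n.

Let k2pi0 : 0 < ((2 * pi) ^- n : R).
Proof. by rewrite invr_gt0 exprn_gt0// mulr_gt0// pi_gt0. Qed.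

(** Damped inversion. Fubini turns the left side into the integral of [exp (- t q)] against the
    Poisson kernel centred at [zeta]; the substitution [xi = zeta + de *: z] makes this an average
    over the fixed Cauchy density, of mass [pi ^ n]. *)
Lemma Rint_base_gk de t zeta : 0 < de -> 0 < t ->
  \int[lam]_x (base de x * (gk q t x * cos (dotp zeta x))) =
  pi ^- n * \int[lam]_z (cauchyn z * expR (- t * q (zeta + de *: z))).
Proof.
move=> d0 t0.
have igq := ig_expRq H t0; have mq := ig_measurable igq.
pose F x xi := base de x * (cos (dotp x xi) * expR (- t * q xi) * cos (dotp zeta x)).
have m1 : measurable_fun setT (fun z : 'rV[R]_n * 'rV[R]_n => base de z.1).
  exact: measurableT_comp (measurable_base _) measurable_fst.
have m2 : measurable_fun setT (fun z : 'rV[R]_n * 'rV[R]_n => expR (- t * q z.2)).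
  exact: measurableT_comp mq measurable_snd.
have m3 : measurable_fun setT (fun z : 'rV[R]_n * 'rV[R]_n => cos (dotp zeta z.1)).
  exact: measurableT_comp (measurable_cosdotp _) measurable_fst.
have m4 : measurable_fun setT (fun z : 'rV[R]_n * 'rV[R]_n => cos (dotp z.1 z.2)).
  by apply: mfun_cos; apply: mfun_dotp; [exact: measurable_fst|exact: measurable_snd].
have mF : measurable_fun setT (fun z : 'rV[R]_n * 'rV[R]_n => F z.1 z.2).
  rewrite /F; apply: (mfun_mul m1); apply: mfun_mul => //; exact: mfun_mul.
have dF x xi : `|F x xi| <= base de x * expR (- t * q xi).
  rewrite /F !normrM ger0_norm ?base_ge0// [`|expR _|]ger0_norm ?expR_ge0//.
  rewrite ler_wpM2l ?base_ge0// mulrAC ler_piMl ?expR_ge0// mulr_ile1 ?cos_max//.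
have igb := ig_base n d0.
transitivity ((2 * pi) ^- n * \int[lam]_x \int[lam]_xi F x xi).
  rewrite -RintZ; last exact: ig_Rint1 mF igb igq dF.
  apply: eq_Rintegral => x _; rewrite /F gkE.
  rewrite [in RHS](_ : (fun xi => _) = (fun xi => base de x * cos (dotp zeta x) * (cos (dotp x xi) * expR (- t * q xi)))).
    by rewrite RintZ; [ring|exact: (ig_cosexpRq H)].
  by apply/funext => xi; ring.
rewrite (Rint_fubini mF igb igq dF).
pose f xi := expR (- t * q xi) * poissonn de (xi - zeta).
have mpz w : measurable_fun setT (fun xi => poissonn de (xi - w)).
  apply: (measurableT_comp (measurable_poissonn de)).
  have := measurable_affine_rV (- w) 1.
  by under eq_fun do rewrite scale1r addrC.
have igf w : lam.-integrable setT (EFin \o (fun xi => expR (- t * q xi) * poissonn de (xi - w))).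
  by apply: (igMb igq (M := (2 / de) ^+ n)) => // xi; exact: poissonn_le.
have E1 : \int[lam]_xi \int[lam]_x F x xi = \int[lam]_xi f xi.
  (* The product of two cosines yields Poisson kernels centred at [zeta] and at [- zeta]; as [q] is
     even the two integrals coincide, which is exhibited by averaging [f] with its reflection. *)
  transitivity (2^-1 * (\int[lam]_xi f xi + \int[lam]_xi f (0 + (-1) *: xi))).
    have igf' : lam.-integrable setT (EFin \o (fun xi => f (0 + (-1) *: xi))).
      by apply: ig_affine; [rewrite oppr_eq0 oner_eq0|exact: igf].
    rewrite -RintD; [|exact: igf|exact: igf'].
    rewrite -RintZ; last by apply: igD; [exact: igf|exact: igf'].
    apply: eq_Rintegral => xi _.
    rewrite /f add0r scaleN1r (symbol_even H) -opprD poissonnN.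
    have h := Rint_base_cos 0 (xi + zeta) d0; have h' := Rint_base_cos 0 (xi - zeta) d0.
    rewrite cos0 mul1r in h; rewrite cos0 mul1r in h'; rewrite -h -h'.
    have igc w : lam.-integrable setT (EFin \o (fun x => base de x * cos (0 + dotp w x))).
      apply: (ig_base_mul d0 (M := 1)) => [|x]; last exact: cos_max.
      by mfun; exact: measurable_dotp.
    rewrite -mulrDr -RintD; [|exact: igc|exact: igc].
    rewrite mulrA -RintZ; last by apply: igD; exact: igc.
    apply: eq_Rintegral => x _; rewrite /F !add0r !dotpDl dotpNl !cosD cosN sinN (dotpC x xi).
    by field.
  rewrite Rint_affine; [|by rewrite oppr_eq0 oner_eq0|exact: igf].
  by rewrite normrN normr1 expr1n invr1 mul1r; field.
rewrite E1.
have igf0 : lam.-integrable setT (EFin \o f) := igf zeta.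
have dn0 : de != 0 by rewrite gt_eqF.
have dnn : de ^+ n != 0 by rewrite expf_neq0.
have -> : \int[lam]_xi f xi = de ^+ n * \int[lam]_z f (zeta + de *: z).
  have := @Rint_affine _ _ zeta de f dn0 igf0; rewrite gtr0_norm// => ->.
  by rewrite mulrA mulfV// mul1r.
have igz : lam.-integrable setT (EFin \o (fun z : 'rV[R]_n => f (zeta + de *: z))).
  exact: (@ig_affine _ _ zeta de f dn0 igf0).
rewrite -(RintZ _ igz) exprMn invfM -mulrA [X in _ = X](_ : _ =
    2 ^- n * (pi ^- n * (2 ^+ n * \int[lam]_z (cauchyn z * expR (- t * q (zeta + de *: z)))))); last first.
  by rewrite mulrCA [2 ^- n * _]mulrA mulVf ?mul1r// expf_neq0.
congr (_ * (_ * _)); rewrite -RintZ.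
  apply: eq_Rintegral => z _; rewrite /f addrAC subrr add0r mulrCA poissonn_scale//.
  by ring.
apply: (igMb ig_cauchyn (M := 1)) => [|z].
  apply: (measurableT_comp mq); exact: measurable_affine_rV.
by rewrite ger0_norm ?expR_ge0 ?(expRq_le1 H)// ltW.
Qed.

Lemma ig_base_gk de t zeta : 0 < de -> 0 < t ->
  lam.-integrable setT (EFin \o (fun x => base de x * (gk q t x * cos (dotp zeta x)))).
Proof.
move=> d0 t0; apply: (ig_base_mul d0 (M := gk q t 0)) => [|x].
  by apply: mfun_mul; [exact: measurable_gk H _|exact: measurable_cosdotp].
rewrite normrM ger0_norm ?(gk_ge0 H)// (le_trans _ (gk_le0 H x t0))//.
by rewrite ler_piMr ?(gk_ge0 H) ?cos_max.
Qed.

(** Integrability is not visible from the definition of [gk]. As the damping decreases to 0,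
    positivity allows monotone convergence, and by [Rint_base_gk] each damped integral is an average
    of values at most 1 against the normalized Cauchy kernel. *)
Lemma ig_gk t : 0 < t -> lam.-integrable setT (EFin \o gk q t).
Proof.
move=> t0; apply: ge0_igP; [exact: measurable_gk H _|by move=> x; exact: gk_ge0 H _ _ t0|].
pose g (j : nat) x := base j.+1%:R^-1 x * gk q t x.
have g0 j x : 0 <= g j x by rewrite mulr_ge0 ?base_ge0 ?(gk_ge0 H).
have mg j : measurable_fun setT (g j).
  by apply: mfun_mul; [exact: measurable_base|exact: measurable_gk H _].
have h : (\int[lam]_x (g j x)%:E @[j --> \oo] --> \int[lam]_x (limn (fun j => (g j x)%:E)))%E.
  apply: cvg_monotone_convergence.
  - exact: measurableT.
  - by move=> j; exact: mfun_EFin.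
  - by move=> j x _; rewrite lee_fin.
  - move=> x _ i j ij; rewrite lee_fin ler_wpM2r ?(gk_ge0 H)// base_homo//.
    by rewrite lef_pV2 ?posrE// ler_nat.
have gl x : g j x @[j --> \oo] --> gk q t x.
  by rewrite -[X in _ --> X]mul1r; apply: cvgMl; exact: base_cvg1.
have -> : (\int[lam]_x (gk q t x)%:E = \int[lam]_x (limn (fun j => (g j x)%:E)))%E.
  apply: eq_integral => x _; apply/esym/cvg_lim => //.
  by apply: cvg_EFin; [exact: nearW|exact: gl].
apply: (@le_lt_trans _ _ 1%E); last exact: ltry.
rewrite -(cvg_lim _ h)//; apply: lime_le; first exact: cvgP h.
apply: nearW => j.
have d0 : 0 < j.+1%:R^-1 :> R by rewrite invr_gt0.
have gE : g j = (fun x => base j.+1%:R^-1 x * (gk q t x * cos (dotp 0 x))).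
  by apply/funext => x; rewrite dot0p cos0 mulr1.
rewrite gE (Rint_EFin (ig_base_gk 0 d0 t0)) lee_fin (Rint_base_gk _ d0 t0).
rewrite ler_pdivrMl ?exprn_gt0 ?pi_gt0// mulr1 -(@Rint_cauchyn R n).
apply: Rint_le; [|exact: ig_cauchyn|].
  apply: (igMb ig_cauchyn (M := 1)) => [|z].
    apply: (measurableT_comp (measurable_expRq H t)); exact: measurable_affine_rV.
  by rewrite ger0_norm ?expR_ge0 ?(expRq_le1 H)// ltW.
by move=> z; rewrite ler_piMr ?cauchyn_ge0 ?(expRq_le1 H)// ltW.
Qed.

Lemma ig_gkcos t zeta : 0 < t -> lam.-integrable setT (EFin \o (fun x => gk q t x * cos (dotp zeta x))).
Proof.
move=> t0; apply: (igMb (ig_gk t0) (M := 1)); first exact: measurable_cosdotp.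
by move=> x; exact: cos_max.
Qed.

(** The damping vanishes on both sides of [Rint_base_gk]; on the right the average concentrates at
    [zeta], by continuity of [q] along rays. *)
Lemma gk_fourier t zeta : 0 < t ->
  \int[lam]_x (gk q t x * cos (dotp zeta x)) = expR (- t * q zeta).
Proof.
move=> t0.
have h1 : \int[lam]_x (base j.+1%:R^-1 x * (gk q t x * cos (dotp zeta x))) @[j --> \oo] -->
    \int[lam]_x (gk q t x * cos (dotp zeta x)).
  apply: (@Rint_cvg _ _ _ _ _ _ (gk q t)).
  - exact: ig_gk.
  - move=> j; apply: mfun_mul; first exact: measurable_base.
    exact: ig_measurable (ig_gkcos zeta t0).
  - by move=> x; rewrite -[X in _ --> X]mul1r; apply: cvgMl; exact: base_cvg1.
  - move=> j x; rewrite normrM (ger0_norm (base_ge0 _ _)) normrM (ger0_norm (gk_ge0 H x t0)).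
    have g0 := gk_ge0 H x t0.
    rewrite -[leRHS]mul1r; apply: ler_pM; first exact: base_ge0.
    - exact: mulr_ge0.
    - by apply: base_le1; rewrite invr_ge0.
    - by rewrite ler_piMr ?cos_max.
have h2 : pi ^- n * \int[lam]_z (cauchyn z * expR (- t * q (zeta + j.+1%:R^-1 *: z))) @[j --> \oo] -->
    pi ^- n * \int[lam]_z (cauchyn z * expR (- t * q zeta)).
  apply: cvgMr; apply: (@Rint_cvg _ _ _ _ _ _ cauchyn).
  - exact: ig_cauchyn.
  - move=> j; apply: mfun_mul; first exact: measurable_cauchyn.
    apply: (measurableT_comp (measurable_expRq H t)); exact: measurable_affine_rV.
  - move=> z; apply: cvgMr; apply: continuous_cvg; first exact: continuous_expR.
    by apply: cvgMr; exact: (symbol_ray H).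
  - move=> j z; rewrite normrM ger0_norm ?cauchyn_ge0// ger0_norm ?expR_ge0//.
    by rewrite ler_piMr ?cauchyn_ge0 ?(expRq_le1 H)// ltW.
have : pi ^- n * \int[lam]_z (cauchyn z * expR (- t * q zeta)) = expR (- t * q zeta).
  rewrite (_ : \int[_]_z _ = expR (- t * q zeta) * \int[lam]_z cauchyn z); last first.
    by rewrite -RintZ; [apply: eq_Rintegral => z _; rewrite mulrC|exact: ig_cauchyn].
  by rewrite Rint_cauchyn mulrCA mulVf ?mulr1// expf_neq0// gt_eqF// pi_gt0.
move=> <-; rewrite -(cvg_lim _ h1)// -(cvg_lim _ h2)//.
congr (limn _); apply/funext => j; apply: Rint_base_gk t0.
by rewrite invr_gt0.
Qed.

Lemma Rint_gk t : 0 < t -> \int[lam]_x gk q t x = 1.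
Proof.
move=> t0; have := gk_fourier 0 t0; rewrite (q0 H) mulr0 expR0 => <-.
by apply: eq_Rintegral => x _; rewrite dot0p cos0 mulr1.
Qed.

Lemma gk_sin t zeta : 0 < t -> \int[lam]_x (gk q t x * sin (dotp zeta x)) = 0.
Proof.
move=> t0.
have igs : lam.-integrable setT (EFin \o (fun x => gk q t x * sin (dotp zeta x))).
  apply: (igMb (ig_gk t0) (M := 1)); first by mfun; exact: measurable_dotp.
  by move=> x; rewrite ler_norml sin_geN1 sin_le1.
have N1 : -1 != 0 :> R by rewrite oppr_eq0 oner_eq0.
have := Rint_affine 0 N1 igs; rewrite normrN normr1 expr1n invr1 mul1r.
set I := (X in _ = X) => e.
have {}e : - 1 * I = I.
  rewrite -[RHS]e -RintZ//; apply: eq_Rintegral => x _.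
  by rewrite add0r scaleN1r gkN dotpNr sinN; ring.
have /eqP : I *+ 2 = 0 by rewrite mulr2n -{1}e mulN1r addNr.
by rewrite mulrn_eq0 => /eqP.
Qed.

(** Expanding [gk t (x - y)] as an inverse transform and exchanging the integrals leaves the
    transform of [gk s], which is [exp (- s q)] by inversion; the sine terms cancel by evenness. *)
Lemma gk_semigroup s t x : 0 < s -> 0 < t ->
  \int[lam]_y (gk q s y * gk q t (x - y)) = gk q (s + t) x.
Proof.
move=> s0 t0.
pose F y xi := gk q s y * (cos (dotp (x - y) xi) * expR (- t * q xi)).
have igq := ig_expRq H t0; have mq := ig_measurable igq.
have igs := ig_gk s0.
have mxy : measurable_fun setT (fun y : 'rV[R]_n => x - y).
  have := measurable_affine_rV x (-1).
  by under eq_fun do rewrite scaleN1r.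
have mF : measurable_fun setT (fun z : 'rV[R]_n * 'rV[R]_n => F z.1 z.2).
  apply: mfun_mul; first exact: measurableT_comp (measurable_gk H s) measurable_fst.
  apply: mfun_mul; last exact: measurableT_comp mq measurable_snd.
  apply: mfun_cos; apply: mfun_dotp; last exact: measurable_snd.
  exact: measurableT_comp mxy measurable_fst.
have dF y xi : `|F y xi| <= gk q s y * expR (- t * q xi).
  rewrite /F normrM (ger0_norm (gk_ge0 H y s0)) normrM [`|expR _|]ger0_norm ?expR_ge0//.
  by rewrite ler_wpM2l ?(gk_ge0 H)// ler_piMl ?expR_ge0// cos_max.
transitivity ((2 * pi) ^- n * \int[lam]_y \int[lam]_xi F y xi).
  rewrite -RintZ; last exact: ig_Rint1 mF igs igq dF.
  apply: eq_Rintegral => y _; rewrite /F RintZ; last exact: (ig_cosexpRq H (x - y) t0).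
  by rewrite [gk q t _]gkE; ring.
rewrite (Rint_fubini mF igs igq dF) gkE; congr (_ * _).
apply: eq_Rintegral => xi _.
have igc := ig_gkcos xi s0.
have igsn : lam.-integrable setT (EFin \o (fun y => gk q s y * sin (dotp xi y))).
  apply: (igMb igs (M := 1)); first by mfun; exact: measurable_dotp.
  by move=> y; rewrite ler_norml sin_geN1 sin_le1.
transitivity (\int[lam]_y (cos (dotp x xi) * expR (- t * q xi) * (gk q s y * cos (dotp xi y)) +
    sin (dotp x xi) * expR (- t * q xi) * (gk q s y * sin (dotp xi y)))).
  apply: eq_Rintegral => y _; rewrite /F dotpDl dotpNl cosB (dotpC y xi); ring.
rewrite RintD; [|exact: igZ|exact: igZ].
rewrite RintZ// RintZ// gk_sin// mulr0 addr0 gk_fourier// -mulrA -expRD.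
by congr (_ * expR _); ring.
Qed.

End inversion.

(** * Lipschitz continuity of the kernel in L^1 *)

(* The recursion says that [a] almost halves with its argument; [a + 5 a ^ 2] does halve. *)
Lemma halving_linear_bound (R : realType) (a : R -> R) (h0 : R) : 0 < h0 ->
  (forall h, 0 < h -> 0 <= a h <= 2) ->
  (forall h, 0 < h -> h <= h0 -> a h <= 4^-1) ->
  (forall h, 0 < h -> a h <= 2^-1 * a (2 * h) * (1 + a (2 * h))) ->
  forall h, 0 < h -> a h <= 2 / h0 * h.
Proof.
move=> h00 a02 a4 rec.
(* A coefficient [k] of the square works if [1 / 2 + 25 k / 64 <= k / 2], for the halving with
   [b <= 5 / 8 x], and if [1 / 4 + k / 16 <= 1], for the start: any value between [32 / 7] and
   12. *)
pose phi (x : R) := x + 5 * x ^+ 2.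
have P j h : 0 < h -> 2 ^+ j * h <= h0 -> phi (a h) <= 2 ^- j.
  elim: j h => [|j IH] h hp hh.
    rewrite expr0 mul1r in hh; rewrite expr0 invr1.
    have := a4 _ hp hh; have /andP[+ _] := a02 _ hp; rewrite /phi; nra.
  have h2 : 0 < 2 * h by rewrite mulr_gt0.
  have hh2 : 2 ^+ j * (2 * h) <= h0 by rewrite mulrA -exprSr.
  have h2h : 2 * h <= h0.
    by apply: (le_trans _ hh2); rewrite ler_peMl ?(ltW h2)// exprn_ege1// ler1n.
  have := IH _ h2 hh2; have := a4 _ h2 h2h; have := rec _ hp.
  have /andP[+ _] := a02 _ h2; have /andP[+ _] := a02 _ hp.
  rewrite exprS invfM /phi; set b := a h; set x := a (2 * h); set y := 2 ^- j.
  move=> b0 x0 bx x4 xy.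
  have : b + 5 * b ^+ 2 <= 2^-1 * (x + 5 * x ^+ 2).
    have bx1 : b <= 5 / 8 * x by nra.
    have : b ^+ 2 <= 25 / 64 * x ^+ 2 by nra.
    by nra.
  by nra.
move=> h hp.
have [hh|hh] := leP h h0; last first.
  have /andP[_ h2] := a02 _ hp; apply: le_trans h2 _.
  by rewrite mulrAC ler_pdivlMr// ler_pM2l// ltW.
(* [j] will be the last number of doublings that stays in the range of smallness:
   [2 ^ j h <= h0 < 2 ^ (j + 1) h], whence [2 ^- j < 2 h / h0]. This is the origin of the constant
   [2 / h0], which also covers [h > h0] because [a <= 2]. *)
have ex : exists m, h0 < 2 ^+ m.+1 * h.
  exists (Num.truncn (h0 / h)); rewrite -ltr_pdivrMr//.
  apply: lt_le_trans (truncnS_gt _) _.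
  by rewrite -natrX ler_nat ltnW// ltn_expl.
case: (ex_minnP ex) => j hj minj.
have hj' : 2 ^+ j * h <= h0.
  case: j => [|j] in hj minj *; first by rewrite expr0 mul1r.
  by rewrite leNgt; apply/negP => /minj; rewrite ltnn.
have := P _ _ hp hj'; rewrite /phi => h1.
have : a h <= 2 ^- j by apply: le_trans h1; rewrite lerDl mulr_ge0 ?sqr_ge0.
move=> h2; apply: (le_trans h2); rewrite mulrAC ler_pdivlMr//.
rewrite mulrC ler_pdivrMr ?exprn_gt0//.
by rewrite (_ : 2 * h * 2 ^+ j = 2 ^+ j.+1 * h) ?(ltW hj)// exprS; ring.
Qed.

Section L1_distance.
Context {R : realType} {n : nat}.
Local Notation lam := (lebesgue_rV n : {sigma_finite_measure set 'rV[R]_n -> \bar R}).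
Implicit Types x y : 'rV[R]_n.

Lemma measurable_sub_rV x : measurable_fun setT (fun y : 'rV[R]_n => x - y).
Proof.
have := measurable_affine_rV x (-1).
by under eq_fun do rewrite scaleN1r.
Qed.

Lemma measurable_sub2_rV d (T : measurableType d) (f g : T -> 'rV[R]_n) :
  measurable_fun setT f -> measurable_fun setT g ->
  measurable_fun setT (fun z => f z - g z).
Proof.
move=> /measurable_fun_rVP mf /measurable_fun_rVP mg.
apply/measurable_fun_rVP => i; under eq_fun do rewrite !mxE.
by apply: mfun_sub; [exact: mf|exact: mg].
Qed.

(** Young's inequality for [L^1]: Tonelli and translation invariance. *)
Lemma convolution_norm_le (A B : 'rV[R]_n -> R) :
  lam.-integrable setT (EFin \o A) -> lam.-integrable setT (EFin \o B) ->
  (\int[lam]_x (`|\int[lam]_y (A y * B (x - y))|)%:E <=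
   ((\int[lam]_y `|A y|) * (\int[lam]_y `|B y|))%:E)%E.
Proof.
move=> igA igB; have mA := ig_measurable igA; have mB := ig_measurable igB.
have igAn := integrable_norm igA; have igBn := integrable_norm igB.
have mF : measurable_fun setT (fun z : 'rV[R]_n * 'rV[R]_n => A z.2 * B (z.1 - z.2)).
  apply: mfun_mul; first exact: measurableT_comp mA measurable_snd.
  apply: (measurableT_comp mB); apply: measurable_sub2_rV.
    exact: measurable_fst.
  exact: measurable_snd.
have mFn := mfun_norm mF.
have mFx x : measurable_fun setT (fun y => A y * B (x - y)).
  by apply: mfun_mul => //; exact: measurableT_comp mB (measurable_sub_rV x).
apply: (@le_trans _ _ (\int[lam]_x \int[lam]_y (`|A y * B (x - y)|)%:E)%E).
  apply: ge0_le_integral.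
  - exact: measurableT.
  - by move=> x _; rewrite lee_fin.
  - apply: mfun_EFin; apply: mfun_norm.
    exact: (@mfun_Rint R _ _ _ _ lam (fun x y => A y * B (x - y)) mF).
  - exact: (measurable_fun_fubini_tonelli_F (m2 := lam) _ (mfun_EFin mFn)
      (fun z => normr_ge0 (A z.2 * B (z.1 - z.2)))).
  - by move=> x _; exact: abs_Rint_le.
rewrite (fubini_tonelli (m1 := lam) (m2 := lam) _ (mfun_EFin mFn)
   (fun z => normr_ge0 (A z.2 * B (z.1 - z.2)))) /=.
rewrite le_eqVlt; apply/orP; left; apply/eqP.
rewrite mulrC -(RintZ _ igAn) -(Rint_EFin (igZ _ igAn)).
apply: eq_integral => y _.
have mBy : measurable_fun setT (fun x => `|B (x - y)|).
  apply: mfun_norm; apply: (measurableT_comp mB).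
  by apply: measurable_sub2_rV => //; exact: measurable_cst.
transitivity (\int[lam]_x (`|A y| * `|B (x - y)|)%:E)%E.
  by apply: eq_integral => x _; rewrite normrM.
rewrite eintZ// mulrC EFinM -(Rint_EFin igBn); congr (_ * _)%E.
have := ge0_integral_affine_rV (- y) (oner_neq0 R) (mfun_EFin (mfun_norm mB)) (fun x => normr_ge0 (B x)).
rewrite normr1 expr1n invr1 mul1e => <-.
by apply: eq_integral => x _; rewrite scale1r addrC.
Qed.

End L1_distance.

Section L1_lipschitz.
Context {R : realType} {n : nat}.
Local Notation lam := (lebesgue_rV n : {sigma_finite_measure set 'rV[R]_n -> \bar R}).
Variables (q : 'rV[R]_n -> R) (beta c : R).
Hypothesis H : is_symbol q beta c.
Implicit Types x y : 'rV[R]_n.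

Definition gkdist (s t : R) : R := \int[lam]_x `|gk q t x - gk q s x|.

Let ig_gkB s t : 0 < s -> 0 < t -> lam.-integrable setT (EFin \o (fun x => gk q t x - gk q s x)).
Proof. by move=> s0 t0; apply: igB; apply: ig_gk H _ _. Qed.

Let ig_gkBn s t : 0 < s -> 0 < t ->
  lam.-integrable setT (EFin \o (fun x => `|gk q t x - gk q s x|)).
Proof. by move=> s0 t0; exact: (integrable_norm (ig_gkB s0 t0)). Qed.

Lemma gkdist_ge0 s t : 0 <= gkdist s t.
Proof. exact: Rintegral_ge0. Qed.

Lemma gkdist_le2 s t : 0 < s -> 0 < t -> gkdist s t <= 2.
Proof.
move=> s0 t0; have igs := ig_gk H s0; have igt := ig_gk H t0.
have -> : 2 = \int[lam]_x (gk q t x + gk q s x) :> R.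
  by rewrite (RintD igt igs) (Rint_gk H s0) (Rint_gk H t0).
apply: Rint_le; [exact: ig_gkBn|exact: igD|].
move=> x; apply: le_trans (ler_normB _ _) _.
by rewrite !ger0_norm ?(gk_ge0 H).
Qed.

(** By [gk_scale] a change of the time unit is a dilation that preserves [L^1] norms, so the
    distance depends on the ratio of the times only. *)
Lemma gkdist_scale l s t : 0 < l -> 0 < s -> 0 < t -> gkdist (l * s) (l * t) = gkdist s t.
Proof.
move=> l0 s0 t0; pose r := l `^ beta^-1.
have r0 : 0 < r by rewrite powR_gt0.
have b0 := symbol_beta_gt0 H.
have rb : r `^ beta = l by rewrite -powRrM mulVf ?gt_eqF// powRr1 ?(ltW l0).
have ig1 := ig_gkBn s0 t0.
have rV0 : r^-1 != 0 by rewrite invr_eq0 gt_eqF.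
have := @Rint_affine _ _ 0 r^-1 (fun x => `|gk q t x - gk q s x|) rV0 ig1.
have r10 : 0 < r^-1 by rewrite invr_gt0.
rewrite (gtr0_norm r10) exprVn invrK => e.
rewrite /gkdist -rb.
transitivity (\int[lam]_x (r ^- n * `|gk q t (0 + r^-1 *: x) - gk q s (0 + r^-1 *: x)|)).
  apply: eq_Rintegral => x _; rewrite (gk_scale H _ r0 t0) (gk_scale H _ r0 s0) -mulrBr normrM add0r.
  by rewrite ger0_norm// invr_ge0 exprn_ge0// ltW.
rewrite RintZ; last exact: (@ig_affine _ _ 0 r^-1 (fun x => `|gk q t x - gk q s x|) rV0 ig1).
have rnV : r ^- n * r ^+ n = 1 by rewrite mulVf// expf_neq0// gt_eqF.
by rewrite e mulrA rnV mul1r.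
Qed.

(** With [X] the shift of time by [h], the function [(X - 1) ^ 2 gk 1] is the convolution square of
    [D]: time 1 is cut into two halves because each factor [X - 1] must act on a kernel. By scaling,
    the norm of [D] is again the distance from 1 to [1 + 2 * h], which closes the recursion. *)
Lemma gkdist_rec h : 0 < h ->
  gkdist 1 (1 + h) <= 2^-1 * gkdist 1 (1 + 2 * h) * (1 + gkdist 1 (1 + 2 * h)).
Proof.
move=> h0; pose A := gk q (2^-1 + h); pose B := gk q 2^-1.
have hh : 0 < 2^-1 + h by rewrite addr_gt0// invr_gt0.
have hp : 0 < 2^-1 :> R by rewrite invr_gt0.
have p1 : 0 < 1 + h by rewrite addr_gt0.
have p2 : 0 < 1 + 2 * h by rewrite addr_gt0// mulr_gt0.
have igA := ig_gk H hh; have igB' := ig_gk H hp.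
pose D y := A y - B y.
have igD' : lam.-integrable setT (EFin \o D) by exact: igB.
pose Br x := gk q (1 + 2 * h) x - 2 * gk q (1 + h) x + gk q 1 x.
have igBr : lam.-integrable setT (EFin \o Br).
  by apply: igD; [apply: igB; [|apply: igZ]|]; apply: ig_gk H _ _.
have BrE x : Br x = \int[lam]_y (D y * D (x - y)).
  have igm s t : 0 < s -> 0 < t -> lam.-integrable setT (EFin \o (fun y => gk q s y * gk q t (x - y))).
    move=> s0 t0; apply: (igMb (ig_gk H s0) (M := gk q t 0)).
      exact: measurableT_comp (measurable_gk H t) (measurable_sub_rV x).
    by move=> y; rewrite ger0_norm ?(gk_ge0 H)// (gk_le0 H).
  transitivity (\int[lam]_y ((A y * A (x - y) - B y * A (x - y)) - (A y * B (x - y) - B y * B (x - y)))).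
    rewrite RintB; [|by apply: igB; exact: igm|by apply: igB; exact: igm].
    rewrite RintB; [|exact: igm|exact: igm].
    rewrite RintB; [|exact: igm|exact: igm].
    rewrite /A /B (gk_semigroup H _ hh hh) (gk_semigroup H _ hp hh).
    rewrite (gk_semigroup H _ hh hp) (gk_semigroup H _ hp hp).
    have -> : 2^-1 + h + (2^-1 + h) = 1 + 2 * h by field.
    have -> : 2^-1 + (2^-1 + h) = 1 + h by field.
    have -> : 2^-1 + h + 2^-1 = 1 + h by field.
    have -> : 2^-1 + 2^-1 = 1 :> R by field.
    by rewrite /Br; ring.
  by apply: eq_Rintegral => y _; rewrite /D; ring.
have NBr : \int[lam]_x `|Br x| <= gkdist 1 (1 + 2 * h) ^+ 2.
  rewrite -lee_fin -Rint_EFin; last exact: (integrable_norm igBr).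
  have := convolution_norm_le igD' igD'.
  rewrite -/(gkdist 2^-1 (2^-1 + h)).
  have -> : gkdist 2^-1 (2^-1 + h) = gkdist 1 (1 + 2 * h).
    by rewrite -(gkdist_scale hp ltr01 p2) mulr1; congr gkdist; field.
  rewrite expr2; apply: le_trans; rewrite le_eqVlt; apply/orP; left; apply/eqP.
  by apply: eq_integral => x _; rewrite BrE.
have : 2 * gkdist 1 (1 + h) <= gkdist 1 (1 + 2 * h) + \int[lam]_x `|Br x|.
  rewrite /gkdist -RintZ; last exact: ig_gkBn.
  rewrite -RintD; [|exact: ig_gkBn|exact: (integrable_norm igBr)].
  apply: Rint_le; [by apply: igZ; exact: ig_gkBn| |].
    by apply: igD; [exact: ig_gkBn|exact: (integrable_norm igBr)].
  move=> x; have -> : 2 * `|gk q (1 + h) x - gk q 1 x| = `|2 * (gk q (1 + h) x - gk q 1 x)|.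
    by rewrite normrM ger0_norm.
  have -> : 2 * (gk q (1 + h) x - gk q 1 x) = (gk q (1 + 2 * h) x - gk q 1 x) - Br x.
    by rewrite /Br; ring.
  exact: ler_normB.
by move: NBr; set a := gkdist 1 (1 + h); set b := gkdist _ _; set e := \int[_]_x _; lra.
Qed.

(* Scheffé's argument. *)
Lemma gkdist_small : exists2 h0 : R, 0 < h0 &
  forall h, 0 < h -> h <= h0 -> gkdist 1 (1 + h) <= 4^-1.
Proof.
pose K := 2 * gk q 2^-1 0.
have K0 : 0 <= K by rewrite mulr_ge0 ?(gk_ge0 H) ?invr_gt0.
have ig1 := ig_gk H (ltr01 : 0 < 1 :> R).
pose w (e : R) := \int[lam]_x Num.min (gk q 1 x) e.
have mw e : measurable_fun setT (fun x => Num.min (gk q 1 x) e).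
  by apply: measurable_minr => //; exact: measurable_gk H _.
have igw e : 0 <= e -> lam.-integrable setT (EFin \o (fun x => Num.min (gk q 1 x) e)).
  move=> e0; apply: (ig_le ig1) => // x; rewrite ger0_norm ?ge_min ?lexx//.
  by rewrite le_min (gk_ge0 H)//.
(* Both kernels have mass 1, so [|u|] integrates to twice the negative part of [u], which is at most
   [gk 1] by positivity and at most [K h] by the sup bound. *)
have key h : 0 < h -> gkdist 1 (1 + h) <= 2 * w (K * h).
  move=> h0; have p1 : 0 < 1 + h by rewrite addr_gt0.
  have Kh0 : 0 <= K * h by rewrite mulr_ge0// ltW.
  pose u x := gk q (1 + h) x - gk q 1 x.
  have igu : lam.-integrable setT (EFin \o u) by apply: ig_gkB.
  have u0 : \int[lam]_x u x = 0.
    rewrite RintB; [|exact: ig_gk H _ _|exact: ig_gk H _ _].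
    by rewrite (Rint_gk H p1) (Rint_gk H ltr01) subrr.
  have igw2 := igZ 2 (igw _ Kh0).
  rewrite -[leRHS]add0r -u0 /w -(RintZ _ (igw _ Kh0)) -(RintD igu igw2).
  apply: Rint_le; [exact: ig_gkBn|exact: igD|].
  move=> x; rewrite -/(u x).
  have lip : `|u x| <= K * h.
    have h11 : 1 <= 1 + h by rewrite lerDl ltW.
    have := gk_lipschitz_sup H x ltr01 h11; rewrite -/(u x) => hl.
    apply: (le_trans hl); rewrite /K le_eqVlt; apply/orP; left; apply/eqP.
    by rewrite mul1r; field.
  have g1 := gk_ge0 H x (ltr01 : 0 < 1 :> R); have g2 := gk_ge0 H x p1.
  have [ux|ux] := leP 0 (u x).
    by rewrite ger0_norm// lerDl mulr_ge0// le_min g1.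
  rewrite ltr0_norm// in lip *.
  have : - u x <= Num.min (gk q 1 x) (K * h).
    rewrite le_min lip andbT /u; lra.
  by set m := Num.min _ _ => hm; lra.
have : w (K * j.+1%:R^-1) @[j --> \oo] --> \int[lam]_x cst (0 : R) x.
  apply: (@Rint_cvg _ _ _ _ _ _ (gk q 1)) => //.
  - move=> x; have h1 : K * j.+1%:R^-1 @[j --> \oo] --> (0 : R).
      by rewrite -[X in _ --> X](mulr0 K); apply: cvgMr; exact: cvg_harmonic.
    apply: (squeeze_cvgr _ (cvg_cst (0 : R)) h1).
    apply: nearW => j; have e0 : 0 <= K * j.+1%:R^-1 by rewrite mulr_ge0.
    by rewrite le_min (gk_ge0 H)//= e0/= ge_min lexx orbT.
  - move=> j x; have e0 : 0 <= K * j.+1%:R^-1 by rewrite mulr_ge0.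
    by rewrite ger0_norm ?ge_min ?lexx// le_min (gk_ge0 H)//.
rewrite Rintegral_cst// mul0r => /cvgrPdist_le/(_ 8^-1).
rewrite invr_gt0 ltr0n => /(_ isT)[N _ /(_ N (leqnn N))]/=.
rewrite sub0r normrN => hN.
exists N.+1%:R^-1; first by rewrite invr_gt0.
move=> h h0 hN1; apply: (le_trans (key _ h0)).
apply: (@le_trans _ _ (2 * w (K * N.+1%:R^-1))).
  rewrite ler_pM2l//; apply: Rint_le.
  - by apply: igw; rewrite mulr_ge0// ltW.
  - by apply: igw; rewrite mulr_ge0.
  - move=> x; rewrite le_min ge_min lexx/= ge_min.
    by rewrite (_ : K * h <= K * N.+1%:R^-1) ?orbT// ler_wpM2l.
have := le_trans (ler_norm _) hN.
by set ww := w _ => hw; lra.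
Qed.

Lemma gkdist_lipschitz : exists2 C : R, 0 < C &
  forall s t, 0 < s -> s <= t -> gkdist s t <= C * (t - s) / s.
Proof.
have [h0 h00 hs] := gkdist_small.
have C0 : 0 < 2 / h0 by rewrite divr_gt0.
exists (2 / h0) => // s t s0; rewrite le_eqVlt => /predU1P[->|st].
  rewrite subrr mulr0 mul0r /gkdist (_ : \int[_]_x _ = \int[lam]_x cst (0 : R) x).
    by rewrite Rintegral_cst// mul0r.
  by apply: eq_Rintegral => x _; rewrite subrr normr0.
have h : 0 < (t - s) / s by rewrite divr_gt0// subr_gt0.
have p1 : 0 < 1 + (t - s) / s by rewrite addr_gt0.
have := gkdist_scale s0 ltr01 p1; rewrite mulr1.
have -> : s * (1 + (t - s) / s) = t by field; rewrite gt_eqF.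
move=> ->; rewrite -mulrA.
apply: (@halving_linear_bound _ (fun h => gkdist 1 (1 + h))) => //.
- by move=> e e0; rewrite gkdist_ge0 gkdist_le2// addr_gt0.
- exact: gkdist_rec.
Qed.

End L1_lipschitz.

(** * The Lévy measure of a power *)

Section indicator.
Context {R : realType} d (T : measurableType d) (mu : {measure set T -> \bar R}).

Lemma eint_indic (D : set T) (h : T -> R) :
  (\int[mu]_(x in D) (h x)%:E = \int[mu]_x (\1_D x * h x)%:E)%E.
Proof.
rewrite integral_mkcond; apply: eq_integral => x _.
by rewrite patchE indicE; case: (x \in D); rewrite ?mul1r ?mul0r.
Qed.

Lemma Rint_indic (D : set T) (h : T -> R) :
  \int[mu]_(x in D) h x = \int[mu]_x (\1_D x * h x).
Proof. by rewrite /Rintegral eint_indic. Qed.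

Lemma indic_ge0 (D : set T) x : 0 <= \1_D x :> R.
Proof. by rewrite indicE. Qed.

Lemma indic_le1 (D : set T) x : \1_D x <= 1 :> R.
Proof. by rewrite indicE; case: (_ \in _). Qed.

End indicator.

Section levy_power.
Context {R : realType}.
Local Notation leb := (@lebesgue_measure R).

Lemma sin_le_id (x : R) : 0 <= x -> sin x <= x.
Proof.
move=> x0.
have [c _] := @MVT_segment R sin cos 0 x x0 (fun y _ => is_derive_sin y)
  (@continuous_subspaceT _ _ _ _ (@continuous_sin R)).
rewrite sin0 !subr0 => ->; rewrite ler_piMl//; exact: cos_le1.
Qed.

Lemma one_minus_cos_le (x : R) : 0 <= x -> 1 - cos x <= x ^+ 2.
Proof.
move=> x0.
have [c] := @MVT_segment R cos (fun y => - sin y) 0 x x0 (fun y _ => is_derive_cos y)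
  (@continuous_subspaceT _ _ _ _ (@continuous_cos R)).
rewrite in_itv/= cos0 subr0 => /andP[c0 cx] e.
have -> : 1 - cos x = sin c * x by rewrite -[LHS]opprB e mulNr opprK.
by rewrite expr2 ler_wpM2r// (le_trans (sin_le_id c0)).
Qed.

Lemma is_derive_powR_div (p x : R) : 0 < x -> p + 1 != 0 ->
  is_derive x 1 (fun r => (p + 1)^-1 * r `^ (p + 1)) (x `^ p).
Proof.
move=> x0 p1; have d1 := is_derive1_powR (p + 1) x0.
have -> : x `^ p = (p + 1)^-1 * ((p + 1) * x `^ (p + 1 - 1)).
  by rewrite mulrA mulVf// mul1r addrK.
exact: is_deriveZ.
Qed.

Lemma continuous_powR_pos (p x : R) : 0 < x -> {for x, continuous (fun y : R => y `^ p)}.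
Proof. by move=> x0; apply: is_derive_continuous (is_derive1_powR p x0). Qed.

Lemma integral_powR_le1 (p : R) : -1 < p ->
  (\int[leb]_(r in `]0%R, 1%R]) (r `^ p)%:E <= ((p + 1)^-1)%:E)%E.
Proof.
move=> p1; have p0 : 0 < p + 1 by rewrite -ltrBlDr sub0r.
(* [n + 2] instead of [n + 1] keeps the first interval nondegenerate. *)
apply: (@ge0_integral_FTC_le _ _ _ (fun r => (p + 1)^-1 * r `^ (p + 1))
  (fun n => n.+2%:R^-1) (fun=> 1)).
- exact: measurable_itv.
- exact: measurable_funTS.
- by move=> x _; exact: powR_ge0.
- apply/seteqP; split=> [x|x [n _]]; rewrite /= !in_itv/=.
    move=> /andP[x0 xle1]; exists (Num.truncn x^-1) => //.
    rewrite /= in_itv/= xle1 andbT -[leRHS]invrK lef_pV2 ?posrE ?invr_gt0//.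
    by rewrite (le_trans (ltW (truncnS_gt _)))// ler_nat.
  by move=> /andP[h ->]; rewrite andbT; apply: lt_le_trans h; rewrite invr_gt0.
- by move=> m n mn; rewrite lef_pV2 ?posrE// ler_nat.
- by [].
- by move=> n; rewrite invf_lt1// ltr1n.
- by move=> x; rewrite /= in_itv/= => /andP[x0 _]; exact: continuous_powR_pos.
- move=> x; rewrite /= in_itv/= => /andP[x0 _].
  by apply: is_derive_powR_div => //; rewrite gt_eqF.
- by move=> n; rewrite powR1 mulr1 lerBlDr lerDl mulr_ge0 ?powR_ge0// invr_ge0 (ltW p0).
Qed.

Lemma integral_powR_gt1 (p : R) : p < -1 ->
  (\int[leb]_(r in `]1%R, +oo[) (r `^ p)%:E <= ((- (p + 1))^-1)%:E)%E.
Proof.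
move=> p1; have p0 : p + 1 < 0 by rewrite -ltrBrDr sub0r.
have pN0 : 0 < - (p + 1) by rewrite oppr_gt0.
(* The intervals are nondegenerate from the start: [1 + 1 / (n + 1) <= 2 < 3 <= n + 3]. *)
apply: (@ge0_integral_FTC_le _ _ _ (fun r => (p + 1)^-1 * r `^ (p + 1))
  (fun n => 1 + n.+1%:R^-1) (fun n => n.+3%:R)).
- exact: measurable_itv.
- exact: measurable_funTS.
- by move=> x _; exact: powR_ge0.
- apply/seteqP; split=> [x|x [n _]]; rewrite /= !in_itv/= andbT.
    move=> x1; have x10 : 0 < x - 1 by rewrite subr_gt0.
    exists (maxn (Num.truncn (x - 1)^-1) (Num.truncn x)) => //.
    rewrite /= in_itv/=; apply/andP; split.
      rewrite -lerBrDl -[leRHS]invrK lef_pV2 ?posrE ?invr_gt0//.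
      by rewrite (le_trans (ltW (truncnS_gt _)))// ler_nat ltnS leq_maxl.
    rewrite (le_trans (ltW (truncnS_gt _)))// ler_nat ltnS.
    by do 2 apply: leqW; exact: leq_maxr.
  by move=> /andP[h _]; apply: lt_le_trans h; rewrite ltrDl invr_gt0.
- by move=> m n mn; rewrite lerD2l lef_pV2 ?posrE// ler_nat.
- by move=> m n mn; rewrite ler_nat.
- move=> n; apply: (@le_lt_trans _ _ 2); last by rewrite ltr_nat.
  by rewrite -[leRHS]/(1 + 1) lerD2l invf_le1// ler1n.
- by move=> x; rewrite /= in_itv/= andbT => x1; apply: continuous_powR_pos; exact: lt_trans x1.
- move=> x; rewrite /= in_itv/= andbT => x1.
  by apply: is_derive_powR_div; [exact: lt_trans x1|rewrite lt_eqF].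
- move=> n; set a := 1 + _; set b := n.+3%:R.
  have -> : (p + 1)^-1 * b `^ (p + 1) - (p + 1)^-1 * a `^ (p + 1) =
            (- (p + 1))^-1 * a `^ (p + 1) - (- (p + 1))^-1 * b `^ (p + 1).
    by rewrite invrN; ring.
  apply: (@le_trans _ _ ((- (p + 1))^-1 * a `^ (p + 1))).
    by rewrite lerBlDr lerDl mulr_ge0 ?powR_ge0// invr_ge0 ltW.
  rewrite ler_piMr ?invr_ge0 ?(ltW pN0)//.
  rewrite -[leRHS](powRr0 a) ler_powR ?(ltW p0)// /a lerDl invr_ge0//.
Qed.

Variable beta : R.
Hypothesis hbeta : 0 < beta < 2.

Let beta0 : 0 < beta. Proof. by case/andP: hbeta. Qed.
Let beta2 : beta < 2. Proof. by case/andP: hbeta. Qed.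

Definition levy_density (r : R) : R := \1_(`]0, +oo[%classic : set R) r * r `^ (- 1 - beta).

Lemma levy_density_ge0 r : 0 <= levy_density r.
Proof. by rewrite mulr_ge0 ?indic_ge0 ?powR_ge0. Qed.

Lemma measurable_levy_density : measurable_fun setT levy_density.
Proof.
by apply: mfun_mul; [exact: measurable_indic|exact: measurable_powR].
Qed.

Lemma one_minus_cos_ge0 (x : R) : 0 <= 1 - cos x.
Proof. by rewrite subr_ge0 cos_le1. Qed.

Lemma one_minus_cos_le2 (x : R) : 1 - cos x <= 2.
Proof. by have := cos_geN1 x; lra. Qed.

Let mlc (a : R) : measurable_fun setT (fun r : R => levy_density r * (1 - cos (r * a))).
Proof. by apply: mfun_mul; [exact: measurable_levy_density|mfun]. Qed.

Let lc_ge0 a r : 0 <= levy_density r * (1 - cos (r * a)).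
Proof. by rewrite mulr_ge0 ?levy_density_ge0 ?one_minus_cos_ge0. Qed.

(** Near 0 the bound [1 - cos r <= r ^ 2] leaves [r ^ (1 - beta)], integrable as [beta < 2]; beyond
    1 the tail [2 r ^ (- 1 - beta)] is integrable as [beta > 0]. *)
Let levy1_lty : (\int[leb]_r (levy_density r * (1 - cos (r * 1)))%:E < +oo)%E.
Proof.
pose u (r : R) := \1_(`]0, 1]%classic : set R) r * r `^ (1 - beta).
pose w (r : R) := \1_(`]1, +oo[%classic : set R) r * r `^ (- 1 - beta).
have mu_ : measurable_fun setT u by apply: mfun_mul; [exact: measurable_indic|exact: measurable_powR].
have mw : measurable_fun setT w by apply: mfun_mul; [exact: measurable_indic|exact: measurable_powR].
have u0 r : 0 <= u r by rewrite mulr_ge0 ?indic_ge0 ?powR_ge0.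
have w0 r : 0 <= w r by rewrite mulr_ge0 ?indic_ge0 ?powR_ge0.
apply: (@le_lt_trans _ _ (\int[leb]_r (u r + 2 * w r)%:E)%E); last first.
  rewrite eintD ?eintZ//; [|by mfun|by move=> r; rewrite mulr_ge0].
  rewrite -!eint_indic lte_add_pinfty//.
    apply: le_lt_trans (integral_powR_le1 (_ : -1 < 1 - beta)) _; last exact: ltry.
    by have := beta2; lra.
  rewrite lte_mul_pinfty//.
  apply: le_lt_trans (integral_powR_gt1 (_ : - 1 - beta < -1)) _; last exact: ltry.
  by rewrite ltrBlDr ltrDl.
apply: eint_le; [exact: mlc|exact: lc_ge0|by mfun|].
move=> r; rewrite mulr1 /levy_density /u /w !indicE !mem_setE !in_itv/= !andbT.
have [r0|r0] := ltP 0 r; last first.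
  by rewrite (le_gtF (le_trans r0 ler01))/= !mul0r mulr0 addr0.
have [r1|r1] /= := leP r 1; last first.
  by rewrite !mul1r mul0r add0r mulrC ler_wpM2r ?powR_ge0 ?one_minus_cos_le2.
rewrite !mul1r mul0r mulr0 addr0.
apply: (@le_trans _ _ (r `^ (- 1 - beta) * r ^+ 2)).
  by rewrite ler_wpM2l ?powR_ge0 ?one_minus_cos_le// ltW.
rewrite -(powR_mulrn 2 (ltW r0)) -powRD; last by rewrite (gt_eqF r0) implybT.
by rewrite le_eqVlt; apply/orP; left; apply/eqP; congr powR; lra.
Qed.

Definition levy_const : R := \int[leb]_r (levy_density r * (1 - cos (r * 1))).

Let levy_constE : (\int[leb]_r (levy_density r * (1 - cos (r * 1)))%:E = levy_const%:E)%E.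
Proof.
apply: Rint_EFin; apply: ge0_igP; [exact: mlc|exact: lc_ge0|exact: levy1_lty].
Qed.

Lemma levy_const_gt0 : 0 < levy_const.
Proof.
rewrite -lte_fin -levy_constE.
(* On [[1, 2]], which lies in the interval [[0, pi]] where the cosine decreases, the integrand is at
   least [m]. *)
pose m := (1 - cos 1) * 2 `^ (- 1 - beta) : R.
have pi2 : 2 <= pi :> R := pi_ge2 R.
have cos11 : cos 1 < 1 :> R.
  by rewrite -[ltRHS]cos0 ltr_cos// in_itv/=; apply/andP; split; lra.
have m0 : 0 < m by rewrite mulr_gt0 ?powR_gt0// subr_gt0.
apply: (@lt_le_trans _ _ m%:E) => //.
apply: (@le_trans _ _ (\int[leb]_(r in `[1%R, 2%R]) m%:E)%E).
  rewrite integral_cst//= lebesgue_measure_itv/= lte_fin ltr1n -EFinB -EFinM lee_fin.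
  by rewrite -[X in m * (X - _)]/(1 + 1) addrK mulr1.
rewrite eint_indic; apply: eint_le.
- by apply: mfun_mul; [exact: measurable_indic|exact: mfun_cst].
- by move=> r; rewrite mulr_ge0 ?indic_ge0// ltW.
- exact: mlc.
move=> r; rewrite indicE mem_setE in_itv/=.
have [/andP[r1 r2]|_] := boolP (1 <= r <= 2); last by rewrite mul0r.
have r0 : 0 < r by rewrite (lt_le_trans _ r1).
rewrite mul1r mulr1 /levy_density indicE mem_setE in_itv/= andbT r0 mul1r /m mulrC.
apply: ler_pM; rewrite ?powR_ge0 ?one_minus_cos_ge0//.
  rewrite -opprD !powRN lef_pV2 ?posrE ?powR_gt0//.
  by apply: ge0_ler_powR; rewrite ?nnegrE ?addr_ge0 ?(ltW r0) ?(ltW beta0).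
rewrite lerD2l lerN2 le_eqVlt; have [->|r1'] := eqVneq r 1; first by rewrite eqxx.
by apply/orP; right; rewrite ltr_cos ?in_itv/=; [rewrite lt_def r1' r1|lra|lra].
Qed.

(** The density is homogeneous of degree [- 1 - beta], so the substitution [r |-> r b] extracts
    [b ^ beta]; evenness of the cosine covers negative [a]. *)
Lemma eint_levy (a : R) :
  (\int[leb]_r (levy_density r * (1 - cos (r * a)))%:E = (levy_const * `|a| `^ beta)%:E)%E.
Proof.
have pos b : 0 < b ->
    (\int[leb]_r (levy_density r * (1 - cos (r * b)))%:E = (levy_const * b `^ beta)%:E)%E.
  move=> b0; have bN0 : b != 0 by rewrite gt_eqF.
  have := ge0_integral_affine1 0 bN0 (mfun_EFin (mlc 1)) (fun r => lc_ge0 1 r).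
  rewrite levy_constE gtr0_norm// -EFinM => h.
  have e : (\int[leb]_r (b `^ (- 1 - beta) * (levy_density r * (1 - cos (r * b))))%:E =
       (b^-1 * levy_const)%:E)%E.
    rewrite -h; apply: eq_integral => r _; rewrite add0r mulr1 mulrA (mulrC r b).
    congr (_ * _)%:E; rewrite /levy_density !indicE !mem_setE !in_itv/= !andbT pmulr_rgt0//.
    have [r0|_] := ltP 0 r; last by rewrite !mul0r mulr0.
    by rewrite !mul1r powRM// ltW.
  set E := (X in X = _); have {}e : ((b `^ (- 1 - beta))%:E * E = (b^-1 * levy_const)%:E)%E.
    by apply: etrans e; apply/esym; apply: eintZ; [exact: powR_ge0|exact: mlc|exact: lc_ge0].
  have p1 : b `^ (1 + beta) * b `^ (- 1 - beta) = 1.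
    rewrite -powRD ?bN0 ?implybT// (_ : _ + _ = 0) ?powRr0//; ring.
  rewrite -[LHS]mul1e -[1%E]/(1%:E) -p1 EFinM -muleA e -EFinM; congr EFin.
  rewrite powRD ?bN0 ?implybT// powRr1 ?(ltW b0)//.
  by rewrite mulrA [b * _]mulrC mulfK// mulrC.
have [a0|a0|->] := ltgtP a 0.
- rewrite ltr0_norm// -pos ?oppr_gt0//; apply: eq_integral => r _.
  by rewrite mulrN cosN.
- by rewrite gtr0_norm// pos.
- rewrite normr0 powR0 ?gt_eqF// mulr0 integral0_eq// => r _.
  by rewrite mulr0 cos0 subrr mulr0.
Qed.

Lemma ig_levy a : leb.-integrable setT (EFin \o (fun r : R => levy_density r * (1 - cos (r * a)))).
Proof.
by apply: ge0_igP; [exact: mlc|exact: lc_ge0|rewrite eint_levy ltry].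
Qed.

Lemma Rint_levy a :
  \int[leb]_r (levy_density r * (1 - cos (r * a))) = levy_const * `|a| `^ beta.
Proof. by rewrite /Rintegral eint_levy. Qed.

(* Truncating the jumps makes the Lévy measure finite. *)
Definition levy_trunc (j : nat) (r : R) : R :=
  \1_(`]j.+1%:R^-1, +oo[%classic : set R) r * r `^ (- 1 - beta).

Lemma levy_trunc_ge0 j r : 0 <= levy_trunc j r.
Proof. by rewrite mulr_ge0 ?indic_ge0 ?powR_ge0. Qed.

Lemma measurable_levy_trunc j : measurable_fun setT (levy_trunc j).
Proof. by apply: mfun_mul; [exact: measurable_indic|exact: measurable_powR]. Qed.

Lemma levy_trunc_le j r : levy_trunc j r <= levy_density r.
Proof.
rewrite /levy_trunc /levy_density !indicE !mem_setE !in_itv/= !andbT.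
rewrite ler_wpM2r ?powR_ge0//; have [h|//] := ltP j.+1%:R^-1 r.
by rewrite (lt_trans _ h).
Qed.

Lemma ig_levy_trunc j : leb.-integrable setT (EFin \o levy_trunc j).
Proof.
(* The power decreases, so [M], its value at the cut-off, bounds it on the rest of []0, 1]]. *)
pose M := (j.+1%:R^-1 : R) `^ (- 1 - beta).
pose u (r : R) : R := \1_(`]0, 1]%classic : set R) r.
pose w (r : R) := \1_(`]1, +oo[%classic : set R) r * r `^ (- 1 - beta).
have mw : measurable_fun setT w by apply: mfun_mul; [exact: measurable_indic|exact: measurable_powR].
have w0 r : 0 <= w r by rewrite mulr_ge0 ?indic_ge0 ?powR_ge0.
have igw : leb.-integrable setT (EFin \o w).
  apply: ge0_igP => //; rewrite -eint_indic.
  apply: le_lt_trans (integral_powR_gt1 (_ : - 1 - beta < -1)) _; last exact: ltry.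
  by rewrite ltrBlDr ltrDl.
have igu : leb.-integrable setT (EFin \o u).
  apply: ge0_igP; [exact: measurable_indic|by move=> r; exact: indic_ge0|].
  apply: (@le_lt_trans _ _ (leb `]0%R, 1%R]%classic)); last first.
    by rewrite lebesgue_measure_itv/= lte_fin ltr01 -EFinB ltry.
  by rewrite /u integral_indic ?setIT//; exact: measurable_itv.
apply: (ig_le (igD (igZ M igu) igw)); first exact: measurable_levy_trunc.
move=> r; rewrite ger0_norm ?levy_trunc_ge0//.
rewrite /levy_trunc /u /w !indicE !mem_setE !in_itv/= !andbT.
have [h|h] := ltP j.+1%:R^-1 r; last first.
  by rewrite mul0r addr_ge0 ?mulr_ge0 ?powR_ge0.
have r0 : 0 < r by rewrite (lt_trans _ h).
rewrite r0 mul1r; have [r1|r1] /= := leP r 1; last by rewrite mulr0 mul1r add0r.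
rewrite mulr1 mul0r addr0 /M -opprD !powRN lef_pV2 ?posrE ?powR_gt0//.
by rewrite ge0_ler_powR ?nnegrE ?(ltW h) ?(ltW r0)// addr_ge0// ltW.
Qed.

Lemma Rint_levy_trunc_cvg a :
  \int[leb]_r (levy_trunc j r * (1 - cos (r * a))) @[j --> \oo] --> levy_const * `|a| `^ beta.
Proof.
rewrite -Rint_levy.
apply: (@Rint_cvg R _ _ leb (fun j r => levy_trunc j r * (1 - cos (r * a)))
  (fun r => levy_density r * (1 - cos (r * a)))
  (fun r => levy_density r * (1 - cos (r * a)))).
- exact: ig_levy.
- by move=> j; apply: mfun_mul; [exact: measurable_levy_trunc|mfun].
- move=> r; apply: cvgMl.
  have [r0|r0] := ltP 0 r; last first.
    rewrite (_ : (fun j => levy_trunc j r) = fun=> levy_density r); first exact: cvg_cst.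
    apply/funext => j; apply/eqP; rewrite eq_le levy_trunc_le/=.
    by rewrite {1}/levy_density indicE mem_setE in_itv/= andbT ltNge r0 mul0r levy_trunc_ge0.
  apply: cvg_near_cst; have := near_infty_natSinv_lt (PosNum r0).
  apply: filterS => j /= h; rewrite /levy_trunc /levy_density !indicE !mem_setE !in_itv/= !andbT.
  by rewrite h r0.
- move=> j r; rewrite (ger0_norm (mulr_ge0 (levy_trunc_ge0 _ _) (one_minus_cos_ge0 _))).
  by rewrite ler_wpM2r ?one_minus_cos_ge0 ?levy_trunc_le.
Qed.

Lemma Rint_levy_trunc_le j a :
  `|\int[leb]_r (levy_trunc j r * (1 - cos (r * a)))| <= levy_const * `|a| `^ beta.
Proof.
rewrite -Rint_levy; apply: Rint_norm_le; first exact: ig_levy.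
  by apply: mfun_mul; [exact: measurable_levy_trunc|mfun].
move=> r; rewrite (ger0_norm (mulr_ge0 (levy_trunc_ge0 _ _) (one_minus_cos_ge0 _))).
by rewrite ler_wpM2r ?one_minus_cos_ge0 ?levy_trunc_le.
Qed.

End levy_power.

(** * The symbol of a spectral measure *)

Section Rint_product.
Context {R : realType} d1 d2 (T1 : measurableType d1) (T2 : measurableType d2).
Context (m1 : {sigma_finite_measure set T1 -> \bar R}).
Context (m2 : {sigma_finite_measure set T2 -> \bar R}).

Lemma ig_product (f : T1 * T2 -> R) (g1 : T1 -> R) (g2 : T2 -> R) :
  measurable_fun setT f ->
  m1.-integrable setT (EFin \o g1) -> m2.-integrable setT (EFin \o g2) ->
  (forall x y, `|f (x, y)| <= g1 x * g2 y) ->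
  (m1 \x m2)%E.-integrable setT (EFin \o f).
Proof.
move=> mf ig1 ig2 fg; apply/integrable12ltyP; first exact: mfun_EFin.
have ig1n := integrable_norm ig1; have ig2n := integrable_norm ig2.
apply: (@le_lt_trans _ _ (\int[m1]_x (\int[m2]_y `|g2 y| * `|g1 x|)%:E)%E); last first.
  by rewrite (Rint_EFin (igZ _ ig1n)) ltry.
apply: ge0_le_integral.
- exact: measurableT.
- by move=> x _; apply: integral_ge0.
- exact: (measurable_fun_fubini_tonelli_F (m2 := m2) _ (mfun_EFin (mfun_norm mf))
    (fun z => normr_ge0 (f z))).
- by mfun; exact: ig_measurable ig1.
- move=> x _; rewrite mulrC -(RintZ _ ig2n) -(Rint_EFin (igZ _ ig2n)).
  apply: eint_le.
  + apply: mfun_norm; exact: measurableT_comp mf (pair1_measurable x).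
  + by move=> y; exact: normr_ge0.
  + by mfun; exact: ig_measurable ig2.
  + by move=> y; rewrite -normrM (le_trans (fg x y))// ler_norm.
Qed.

Lemma Rint_product2 (f : T1 -> T2 -> R) (g1 : T1 -> R) (g2 : T2 -> R) :
  measurable_fun setT (fun z : T1 * T2 => f z.1 z.2) ->
  m1.-integrable setT (EFin \o g1) -> m2.-integrable setT (EFin \o g2) ->
  (forall x y, `|f x y| <= g1 x * g2 y) ->
  \int[(m1 \x m2)%E]_z f z.1 z.2 = \int[m2]_y \int[m1]_x f x y.
Proof.
move=> mf ig1 ig2 fg; rewrite -(Rint_fubini mf ig1 ig2 fg).
have igf : (m1 \x m2)%E.-integrable setT (EFin \o (fun z => f z.1 z.2)).
  exact: ig_product mf ig1 ig2 _.
rewrite {1}/Rintegral -(integral12_prod_meas1 igf); congr fine.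
apply: eq_integral => x _; rewrite /fubini_F /=.
exact: Rint_EFin (ig_curry1 mf ig2 fg x).
Qed.

(* The library's instance is shadowed by the one for finite measures. *)
Definition sfprod : set (T1 * T2) -> \bar R := (m1 \x m2)%E.

HB.instance Definition _ := Measure.on sfprod.

Let sfprod_sigma_finite : sigma_finite setT sfprod.
Proof.
have /sigma_finiteP[F [TF ndF Foo]] := sigma_finiteT m1.
have /sigma_finiteP[G [TG ndG Goo]] := sigma_finiteT m2.
exists (fun k => F k `*` G k).
  apply/seteqP; split=> // x _.
  have [i _ Fi] : (\bigcup_i F i) x.1 by rewrite -TF.
  have [j _ Gj] : (\bigcup_i G i) x.2 by rewrite -TG.
  exists (maxn i j) => //; split.
    by move: Fi; exact/subsetPset/ndF/leq_maxl.
  by move: Gj; exact/subsetPset/ndG/leq_maxr.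
move=> k; have [mF Fk] := Foo k; have [mG Gk] := Goo k; split; first exact: measurableX.
by rewrite /sfprod product_measure1E// lte_mul_pinfty// ge0_fin_numE.
Qed.

HB.instance Definition _ := Measure_isSigmaFinite.Build _ _ _ sfprod sfprod_sigma_finite.

End Rint_product.

Section powR_continuity.
Context {R : realType}.

Lemma cvg_norm_powR (p : R) (u : nat -> R) (l : R) : 0 < p ->
  u j @[j --> \oo] --> l -> `|u j| `^ p @[j --> \oo] --> `|l| `^ p.
Proof.
move=> p0 ul; have ul' : `|u j| @[j --> \oo] --> `|l| by exact: cvg_norm.
(* Away from 0 the power is differentiable, hence continuous; at 0 its smallness is checked
   directly. *)
have [l0|l0] := eqVneq l 0; last first.
  have lp : 0 < `|l| by rewrite normr_gt0.
  apply: (@cvg_comp _ _ _ (fun j => `|u j|) (fun y => y `^ p) _ _ _ ul').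
  exact: (@continuous_powR_pos _ p _ lp).
rewrite l0 normr0 in ul' *; rewrite powR0 ?gt_eqF//.
apply/cvgrPdist_le => e e0.
have ep : 0 < e `^ p^-1 by rewrite powR_gt0.
move/cvgrPdist_le : ul' => /(_ _ ep).
apply: filterS => j; rewrite !sub0r !normrN normr_id => h.
rewrite ger0_norm ?powR_ge0//.
apply: (@le_trans _ _ ((e `^ p^-1) `^ p)).
  by apply: ge0_ler_powR; rewrite ?nnegrE ?(ltW p0) ?(ltW ep).
by rewrite -powRrM mulVf ?gt_eqF// powRr1 ?(ltW e0).
Qed.

End powR_continuity.

Section spectral.
Context {R : realType} {n : nat}.
Variable mu : {finite_measure set 'rV[R]_n -> \bar R}.
Variable beta : R.
Hypothesis hbeta : 0 < beta < 2.
Implicit Types xi eta theta zeta z : 'rV[R]_n.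
Local Notation leb := (@lebesgue_measure R : {sigma_finite_measure set (measurableTypeR R) -> \bar R}).

Let beta0 : 0 < beta. Proof. by case/andP: hbeta. Qed.

Lemma measurable_sphere : measurable (@sphere R n).
Proof.
rewrite (_ : sphere = enorm @^-1` [set 1]); last by [].
by rewrite -[X in measurable X]setTI; apply: measurable_enorm.
Qed.

(* Vanishing off the sphere, so that integrals need not be restricted to it. *)
Definition on_sphere eta : 'rV[R]_n := \1_(@sphere R n) eta *: eta.

Lemma measurable_on_sphere : measurable_fun setT on_sphere.
Proof.
apply/measurable_fun_rVP => i; rewrite /on_sphere.
under eq_fun do rewrite mxE.
apply: mfun_mul; last exact: measurable_coord_rV.
exact: measurable_indic measurable_sphere.
Qed.

Lemma coord_le_enorm xi i : `|xi ord0 i| <= enorm xi.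
Proof.
rewrite -sqrtr_sqr /enorm ler_sqrt; last first.
  by apply: sumr_ge0 => k _; rewrite -expr2 sqr_ge0.
rewrite /dotp (bigD1 i)//= -expr2 lerDl.
by apply: sumr_ge0 => k _; rewrite -expr2 sqr_ge0.
Qed.

Lemma on_sphere_coord eta i : `|on_sphere eta ord0 i| <= 1.
Proof.
rewrite mxE indicE; have [/set_mem h|_] := boolP (eta \in sphere).
  by rewrite mul1r -[leRHS]h coord_le_enorm.
by rewrite mul0r normr0.
Qed.

Definition norm1 xi : R := \sum_i `|xi ord0 i|.

Lemma dotp_on_sphere xi eta : `|dotp xi (on_sphere eta)| <= norm1 xi.
Proof.
rewrite /dotp (le_trans (ler_norm_sum _ _ _))// ler_sum// => i _.
by rewrite normrM ler_piMr// on_sphere_coord.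
Qed.

Lemma norm1_ge0 xi : 0 <= norm1 xi.
Proof. exact: sumr_ge0. Qed.

Let ig_cst (a : R) : mu.-integrable setT (EFin \o (fun=> a)).
Proof. exact: finite_measure_integrable_cst. Qed.

Let mpow xi : measurable_fun setT (fun eta => `|dotp xi (on_sphere eta)| `^ beta).
Proof.
apply: mfun_powR; apply: mfun_norm; apply: mfun_dotp => //.
exact: measurable_on_sphere.
Qed.

Let pow_le xi eta : `| `|dotp xi (on_sphere eta)| `^ beta | <= norm1 xi `^ beta.
Proof.
rewrite ger0_norm ?powR_ge0//; apply: ge0_ler_powR.
- exact: ltW.
- by rewrite nnegrE.
- by rewrite nnegrE norm1_ge0.
- exact: dotp_on_sphere.
Qed.

Let ig_pow xi : mu.-integrable setT (EFin \o (fun eta => `|dotp xi (on_sphere eta)| `^ beta)).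
Proof. exact: ig_le (ig_cst _) (mpow xi) (pow_le xi). Qed.

Lemma omegaE theta : omega mu beta theta = \int[mu]_eta (`|dotp theta (on_sphere eta)| `^ beta).
Proof.
rewrite /omega Rint_indic; apply: eq_Rintegral => eta _.
rewrite /on_sphere dotpZr indicE; case: (_ \in _); rewrite ?mul1r//.
by rewrite !mul0r normr0 powR0// gt_eqF.
Qed.

Lemma enorm0 : enorm (0 : 'rV[R]_n) = 0.
Proof. by rewrite /enorm dot0p sqrtr0. Qed.

Lemma enorm_eq0 xi : (enorm xi == 0) = (xi == 0).
Proof.
apply/idP/idP => [/eqP h|/eqP ->]; last by rewrite enorm0.
apply/eqP/rowP => i; rewrite mxE; apply/eqP.
by rewrite -normr_le0 (le_trans (coord_le_enorm xi i))// h.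
Qed.

Lemma enorm_ge0 xi : 0 <= enorm xi. Proof. exact: sqrtr_ge0. Qed.

(** Homogeneity collapses the polar form of [psi] into one integral, valid at the origin too: [psi]
    is a mixture over [mu] of one-dimensional powers. *)
Lemma psiE xi : psi mu beta xi = \int[mu]_eta (`|dotp xi (on_sphere eta)| `^ beta).
Proof.
rewrite /psi; case: eqVneq => [->|xi0].
  rewrite (_ : \int[_]_eta _ = \int[mu]_eta (0 : R)); first by rewrite Rintegral_cst// mul0r.
  by apply: eq_Rintegral => eta _; rewrite dot0p normr0 powR0// gt_eqF.
have e0 : 0 < enorm xi by rewrite lt_def enorm_eq0 xi0 enorm_ge0.
rewrite omegaE -RintZ//; apply: eq_Rintegral => eta _.
rewrite /direction dotpZl normrM [`|_^-1|]ger0_norm ?invr_ge0 ?enorm_ge0//.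
rewrite powRM ?invr_ge0 ?enorm_ge0// mulrA -powRM ?invr_ge0 ?enorm_ge0//.
by rewrite mulfV ?gt_eqF// powR1 mul1r.
Qed.

Lemma measurable_psi : measurable_fun setT (psi mu beta).
Proof.
rewrite (_ : psi mu beta = fun xi => \int[mu]_eta (`|dotp xi (on_sphere eta)| `^ beta)); last first.
  by apply/funext => xi; exact: psiE.
apply: (@mfun_Rint R _ _ _ _ mu (fun xi eta => `|dotp xi (on_sphere eta)| `^ beta)).
apply: mfun_powR; apply: mfun_norm; apply: mfun_dotp; first exact: measurable_fst.
exact: measurableT_comp measurable_on_sphere measurable_snd.
Qed.

Lemma psiN xi : psi mu beta (- xi) = psi mu beta xi.
Proof.
by rewrite !psiE; apply: eq_Rintegral => eta _; rewrite dotpNl normrN.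
Qed.

Lemma psiZ a xi : 0 < a -> psi mu beta (a *: xi) = a `^ beta * psi mu beta xi.
Proof.
move=> a0; rewrite !psiE -RintZ//; apply: eq_Rintegral => eta _.
by rewrite dotpZl normrM gtr0_norm// powRM// ltW.
Qed.

Lemma psi_ray zeta z :
  psi mu beta (zeta + j.+1%:R^-1 *: z) @[j --> \oo] --> psi mu beta zeta.
Proof.
rewrite psiE; under eq_fun do rewrite psiE.
apply: (@Rint_cvg _ _ _ _ _ _ (fun=> (norm1 zeta + norm1 z) `^ beta)) => //.
- move=> eta; apply: cvg_norm_powR => //; set e := on_sphere eta.
  have h : dotp zeta e + j.+1%:R^-1 * dotp z e @[j --> \oo] --> dotp zeta e + 0 * dotp z e.
    by apply: cvgD; [exact: cvg_cst|apply: cvgMl; exact: cvg_harmonic].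
  by rewrite mul0r addr0 in h; under eq_fun do rewrite dotpDl dotpZl.
- move=> j eta; rewrite ger0_norm ?powR_ge0//; apply: ge0_ler_powR.
  + exact: ltW.
  + by rewrite nnegrE.
  + by rewrite nnegrE addr_ge0 ?norm1_ge0.
  + rewrite dotpDl dotpZl (le_trans (ler_normD _ _))// lerD ?dotp_on_sphere//.
    rewrite normrM ger0_norm// -[leRHS]mul1r ler_pM ?dotp_on_sphere//.
    by rewrite invf_le1// ler1n.
Qed.

(** The jump measure in polar form: the radius has density [r ^ (- 1 - beta)] cut off near 0, the
    direction is distributed by [mu]. As the cut-off is removed, the radial integral of
    [1 - cos (r a)] normalized by [C] tends to [|a| ^ beta], and integrating over the directions
    gives [psi]. *)
Lemma posdef_psi t : 0 <= t -> posdef (fun xi => expR (- t * psi mu beta xi)).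
Proof.
move=> t0; pose C := (levy_const beta)^-1.
have C0 : 0 <= C by rewrite invr_ge0 ltW// levy_const_gt0.
pose k (j : nat) (y : measurableTypeR R * 'rV[R]_n) : R := C * levy_trunc beta j y.1.
pose v (y : measurableTypeR R * 'rV[R]_n) := y.1 *: on_sphere y.2.
have mk j : measurable_fun setT (k j).
  apply: mfun_mul; first exact: mfun_cst.
  exact: measurableT_comp (measurable_levy_trunc beta j) measurable_fst.
have mv : measurable_fun setT v.
  apply/measurable_fun_rVP => i; rewrite /v; under eq_fun do rewrite mxE.
  apply: mfun_mul; first exact: measurable_fst.
  have /measurable_fun_rVP := measurable_on_sphere => /(_ i) h.
  exact: measurableT_comp h measurable_snd.
have igt j := igZ C (ig_levy_trunc hbeta j).
have igk j : (leb \x mu)%E.-integrable setT (EFin \o k j).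
  apply: (ig_product (mk j) (igt j) (ig_cst 1)) => x y.
  by rewrite mulr1 ger0_norm// mulr_ge0// levy_trunc_ge0.
have k0 j y : 0 <= k j y by rewrite mulr_ge0// levy_trunc_ge0.
suff kpsi : forall xi, \int[(leb \x mu)%E]_y (k j y * (1 - cos (dotp (v y) xi)))
    @[j --> \oo] --> psi mu beta xi.
  pose nu : {sigma_finite_measure set (measurableTypeR R * 'rV[R]_n)%type -> \bar R} :=
    sfprod leb mu.
  exact: (@posdef_levy R n _ _ nu k v (psi mu beta) k0 igk mv kpsi t t0).
move=> xi.
pose g j (a : R) := \int[leb]_r (levy_trunc beta j r * (1 - cos (r * a))).
have E j : \int[(leb \x mu)%E]_y (k j y * (1 - cos (dotp (v y) xi))) =
    \int[mu]_eta (C * g j (dotp (on_sphere eta) xi)).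
  pose f (r : measurableTypeR R) eta := C * levy_trunc beta j r * (1 - cos (r * dotp (on_sphere eta) xi)).
  rewrite (_ : \int[_]_y _ = \int[(leb \x mu)%E]_y f y.1 y.2); last first.
    by apply: eq_Rintegral => y _; rewrite /f /k /v dotpZl.
  rewrite (@Rint_product2 _ _ _ _ _ leb mu f (fun r => C * levy_trunc beta j r) (fun=> 2)).
  - apply: eq_Rintegral => eta _; rewrite /g -RintZ.
      by apply: eq_Rintegral => r _; rewrite /f mulrA.
    apply: (igMb (ig_levy_trunc hbeta j) (M := 2)) => [|r].
      by mfun.
    by rewrite ger0_norm ?one_minus_cos_ge0 ?one_minus_cos_le2.
  - rewrite /f; apply: mfun_mul.
      apply: mfun_mul; first exact: mfun_cst.
      exact: measurableT_comp (measurable_levy_trunc beta j) measurable_fst.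
    apply: mfun_sub; first exact: mfun_cst.
    apply: mfun_cos; apply: mfun_mul; first exact: measurable_fst.
    apply: mfun_dotp; last exact: measurable_cst.
    exact: measurableT_comp measurable_on_sphere measurable_snd.
  - exact: igt.
  - exact: ig_cst.
  - move=> r eta; rewrite /f normrM [X in _ * X]ger0_norm ?one_minus_cos_ge0//.
    rewrite ger0_norm; last by rewrite mulr_ge0// levy_trunc_ge0.
    by rewrite ler_wpM2l ?one_minus_cos_le2// mulr_ge0// levy_trunc_ge0.
under eq_fun do rewrite E.
rewrite psiE; apply: (@Rint_cvg _ _ _ mu _ _ (fun eta => `|dotp xi (on_sphere eta)| `^ beta)) => //.
- move=> j; apply: mfun_mul; first exact: mfun_cst.
  apply: (@mfun_Rint R _ _ _ _ leb (fun eta r => levy_trunc beta j r * (1 - cos (r * dotp (on_sphere eta) xi)))).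
  apply: mfun_mul; first exact: measurableT_comp (measurable_levy_trunc beta j) measurable_snd.
  apply: mfun_sub; first exact: mfun_cst.
  apply: mfun_cos; apply: mfun_mul; first exact: measurable_snd.
  apply: mfun_dotp; last exact: measurable_cst.
  exact: measurableT_comp measurable_on_sphere measurable_fst.
- move=> eta; rewrite (dotpC xi).
  have h : C * g j (dotp (on_sphere eta) xi) @[j --> \oo] -->
      C * (levy_const beta * `|dotp (on_sphere eta) xi| `^ beta).
    by apply: cvgMr; exact: Rint_levy_trunc_cvg hbeta _.
  have lc0 : levy_const beta != 0 by rewrite gt_eqF// levy_const_gt0.
  by rewrite mulrA mulVf// mul1r in h; exact: h.
- move=> j eta; rewrite normrM ger0_norm// mulrC ler_pdivrMr ?levy_const_gt0//.
  by rewrite mulrC (dotpC xi) Rint_levy_trunc_le.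
Qed.

Lemma continuous_enorm : continuous (@enorm R n).
Proof.
move=> x; apply: continuous_comp; last exact: sqrt_continuous.
rewrite /dotp; apply: (continuous_big (op := +%R) add_continuous) => i _ y.
have hc : continuous (fun x : 'rV[R]_n => x ord0 i) by move=> ?; exact: coord_continuous.
exact: (cvgM (hc y) (hc y)).
Qed.

Lemma compact_sphere : compact (@sphere R n).
Proof.
apply: bounded_closed_compact.
  exists 1; split; first exact: num_real.
  move=> M M1 eta h; change ((mx_norm eta : R) <= M); rewrite mx_normrE.
  apply/bigmax_leP; split; first by rewrite (le_trans _ (ltW M1)).
  move=> [i j] _ /=; rewrite (ord1 i) (le_trans (coord_le_enorm eta j))//.
  by rewrite h ltW.
have -> : @sphere R n = enorm @^-1` [set 1] by [].
apply: (@closed_comp _ _ (@enorm R n)) => [x _|]; first exact: continuous_enorm.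
exact: closed_eq.
Qed.

Lemma Ck_on_continuous k U (f : 'rV[R]_n -> R) : Ck_on k U f ->
  forall x, U x -> {for x, continuous f}.
Proof.
case: k => [//|k] [df _] x Ux.
exact: differentiable_continuous (df x Ux).
Qed.

Hypothesis hn : (0 < n)%N.
Hypothesis omega_gt0 : forall theta, sphere theta -> 0 < omega mu beta theta.

(** A continuous positive function attains its minimum on the compact sphere, which is nonempty
    because [n > 0]. *)
Lemma omega_lower k : Ck_on_sphere k (omega mu beta) ->
  exists2 c, 0 < c & forall theta, sphere theta -> c <= omega mu beta theta.
Proof.
move=> [U [F [oU SU CF FE]]].
have S0 : @sphere R n !=set0.
  exists (delta_mx ord0 (Ordinal hn)); rewrite /sphere /= /enorm /dotp.
  rewrite (bigD1 (Ordinal hn))//= big1 => [|i i0]; last by rewrite !mxE (negbTE i0) mulr0.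
  by rewrite !mxE !eqxx mulr1 addr0 sqrtr1.
have cF : {within sphere, continuous F}.
  apply: continuous_in_subspaceT => x /set_mem Sx.
  exact: Ck_on_continuous CF _ (SU _ Sx).
have [th /set_mem Sth h] := EVT_min_rV S0 compact_sphere cF.
exists (omega mu beta th); first exact: omega_gt0.
by move=> x Sx; rewrite -!FE// h//; exact/mem_set.
Qed.

Lemma psi_is_symbol k : Ck_on_sphere k (omega mu beta) ->
  exists c, is_symbol (psi mu beta) beta c.
Proof.
move=> /omega_lower[c c0 hc]; have n0 : 0 < n%:R :> R by rewrite ltr0n.
(* Each [|xi_i| ^ beta] is at most [enorm xi ^ beta]; dividing by [n] makes room for the sum over
   the coordinates. *)
exists (c / n%:R); split.
- exact: beta0.
- exact: divr_gt0.
- exact: measurable_psi.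
- exact: psiN.
- exact: psiZ.
- move=> xi; rewrite /psi; case: eqVneq => [->|xi0].
    rewrite big1 ?mulr0// => i _; rewrite mxE normr0 powR0// gt_eqF//.
  have e0 : 0 < enorm xi by rewrite lt_def enorm_eq0 xi0 enorm_ge0.
  have Sd : sphere (direction xi).
    rewrite /sphere /= /enorm /direction dotpZl dotpZr mulrA -expr2.
    rewrite sqrtrM ?sqr_ge0// sqrtr_sqr -/(enorm xi) ger0_norm ?invr_ge0 ?enorm_ge0//.
    by rewrite mulVf// gt_eqF.
  apply: (@le_trans _ _ (enorm xi `^ beta * c)); last by rewrite ler_wpM2l ?powR_ge0 ?hc.
  rewrite mulrAC ler_pdivrMr//.
  rewrite [leLHS]mulrC -mulrA [c * _]mulrC mulrA ler_wpM2r ?(ltW c0)//.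
  rewrite (_ : _ * n%:R = \sum_(i < n) enorm xi `^ beta); last first.
    by rewrite sumr_const card_ord mulr_natr.
  apply: ler_sum => i _; apply: ge0_ler_powR; rewrite ?nnegrE ?(ltW beta0)//.
    exact: enorm_ge0.
  exact: coord_le_enorm.
- exact: psi_ray.
- exact: posdef_psi.
Qed.

End spectral.

(** * Jensen's inequality and a substitution *)

Section jensen.
Context {R : realType}.

(** Young's inequality for [a / l] and 1 with exponents [p] and [p / (p - 1)], multiplied by [l].
    The scale [l] is left free for the caller to optimize; [p = 1] is separate, its conjugate
    exponent being infinite. *)
Lemma young_powR (p a l : R) : 1 <= p -> 0 <= a -> 0 < l ->
  a <= a `^ p * l `^ (1 - p) / p + (1 - p^-1) * l.
Proof.
rewrite le_eqVlt => /predU1P[<- a0 l0|p1 a0 l0].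
  by rewrite subrr powRr0 powRr1// mulr1 invr1 subrr mul0r mulr1 addr0.
have p0 : 0 < p by apply: lt_trans p1.
have q0 : 0 < p / (p - 1) by rewrite divr_gt0// subr_gt0.
have pq : p^-1 + (p / (p - 1))^-1 = 1.
  by rewrite invf_div; field; rewrite gt_eqF.
have := conjugate_powR (divr_ge0 a0 (ltW l0)) ler01 p0 q0 pq.
rewrite mulr1 powR1 mul1r ler_pdivrMr// => h; apply: (le_trans h).
have -> : (p / (p - 1))^-1 = 1 - p^-1 by apply: (addrI p^-1); rewrite pq addrC subrK.
rewrite powRM ?invr_ge0 ?(ltW l0)// -[l^-1]powR_inv1 ?(ltW l0)// -powRrM mulN1r.
rewrite mulrDl lerD2r -!mulrA ler_wpM2l ?powR_ge0//.
rewrite [p^-1 * l]mulrC mulrA ler_pM2r ?invr_gt0// powRD ?(gt_eqF l0) ?implybT//.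
by rewrite powRr1 ?(ltW l0)// mulrC.
Qed.

Context d (T : measurableType d) (mu : {measure set T -> \bar R}).

(** Jensen's inequality for the weight [m / M] of mass at most 1, by integrating Young's inequality
    pointwise. The number [b] is only a lower bound of the integral, so that it may come from a
    real-valued integral with default value 0. *)
Lemma jensen_powR (p M b : R) (a m : T -> R) : 1 <= p -> 0 < M -> 0 <= b ->
  measurable_fun setT a -> measurable_fun setT m ->
  (forall x, 0 <= a x) -> (forall x, 0 <= m x) ->
  (\int[mu]_x (m x)%:E <= M%:E)%E -> (b%:E <= \int[mu]_x (a x * m x)%:E)%E ->
  ((b `^ p)%:E <= (M `^ (p - 1))%:E * \int[mu]_x (a x `^ p * m x)%:E)%E.
Proof.
move=> p1 M0 b0 ma mm a0 m0 mM bI.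
have p0 : 0 < p by apply: lt_le_trans p1.
have Mp : 0 < M `^ (p - 1) by rewrite powR_gt0.
have I0 : (0 <= \int[mu]_x (a x `^ p * m x)%:E)%E.
  by apply: integral_ge0 => x _; rewrite lee_fin mulr_ge0 ?powR_ge0.
have map : measurable_fun setT (fun x => a x `^ p * m x).
  by apply: mfun_mul => //; exact: mfun_powR.
move: b0; rewrite le_eqVlt => /predU1P[<-|b0].
  by rewrite powR0 ?gt_eqF// mule_ge0// lee_fin ltW.
have [Ioo|] := ltP (\int[mu]_x (a x `^ p * m x)%:E)%E +oo%E; last first.
  by rewrite leye_eq => /eqP ->; rewrite gt0_muley ?leey// lte_fin.
move: I0 Ioo map; set I := (\int[mu]_x (a x `^ p * m x)%:E)%E => I0 Ioo map.
have IE : I = (fine I)%:E by rewrite fineK// ge0_fin_numE.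
(* The scale [b / M] absorbs the linear term of Young's inequality. *)
pose l := b / M; have l0 : 0 < l by rewrite divr_gt0.
have q0 : 0 <= 1 - p^-1 by rewrite subr_ge0 invf_le1.
have k0 : 0 <= l `^ (1 - p) / p by rewrite divr_ge0 ?powR_ge0 ?(ltW p0).
have ql0 : 0 <= (1 - p^-1) * l by rewrite mulr_ge0// ltW.
have h : (b%:E <= (l `^ (1 - p) / p)%:E * I + ((1 - p^-1) * l)%:E * M%:E)%E.
  apply: (le_trans bI); apply: (@le_trans _ _ (\int[mu]_x
      (l `^ (1 - p) / p * (a x `^ p * m x) + (1 - p^-1) * l * m x)%:E)%E).
    apply: eint_le.
    - exact: mfun_mul.
    - by move=> x; exact: mulr_ge0.
    - by apply: mfun_add; apply: mfun_mul => //; exact: mfun_cst.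
    - move=> x; have := ler_wpM2r (m0 x) (young_powR p1 (a0 x) l0).
      rewrite mulrDl => h; apply: (le_trans h); rewrite lerD2r le_eqVlt.
      by apply/orP; left; apply/eqP; ring.
  rewrite eintD.
  - rewrite eintZ//; last by move=> x; rewrite mulr_ge0 ?powR_ge0.
    rewrite (eintZ _ ql0 mm m0); apply: leeD2l.
    by apply: lee_wpmul2l => //; rewrite lee_fin.
  - by apply: mfun_mul => //; exact: mfun_cst.
  - by move=> x; rewrite mulr_ge0// mulr_ge0 ?powR_ge0.
  - by apply: mfun_mul => //; exact: mfun_cst.
  - by move=> x; rewrite mulr_ge0// mulr_ge0 ?(ltW l0).
move: h; rewrite IE -!EFinM -EFinD !lee_fin /l -[(1 - p^-1) * _ * M]mulrA divfK ?gt_eqF//.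
move=> h; have {h} : b <= (b / M) `^ (1 - p) * fine I.
  have v0 : 0 < p^-1 by rewrite invr_gt0.
  by rewrite -(ler_pM2l v0); move: h; set L := (b / M) `^ _; set v := p^-1; lra.
rewrite powRM ?invr_ge0 ?(ltW b0) ?(ltW M0)// -[M^-1]powR_inv1 ?(ltW M0)// -powRrM mulN1r opprB => h.
have -> : b `^ p = b * b `^ (p - 1).
  by rewrite -[X in X * _]powRr1 ?(ltW b0)// -powRD ?(gt_eqF b0) ?implybT// addrC subrK.
have bp : 0 < b `^ (p - 1) by rewrite powR_gt0.
rewrite -ler_pdivlMr// (le_trans h)// le_eqVlt; apply/orP; left; apply/eqP.
by rewrite -powRN opprB; ring.
Qed.

Lemma eintB_norm_sub (f g : T -> R) : measurable_fun setT f -> measurable_fun setT g ->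
  (forall x, 0 <= f x) -> (forall x, 0 <= g x) ->
  (\int[mu]_x (f x)%:E <= \int[mu]_x (g x)%:E + \int[mu]_x (`|f x - g x|)%:E)%E.
Proof.
move=> mf mg f0 g0; rewrite -eintD//; last by apply: mfun_norm; exact: mfun_sub.
apply: eint_le => //.
  by apply: mfun_add => //; apply: mfun_norm; exact: mfun_sub.
by move=> x; rewrite -lerBlDl ler_norm.
Qed.

(* [Rintegral] is 0 when the integral is infinite, and the bound survives this. *)
Lemma abs_RintB_le (f g : T -> R) : measurable_fun setT f -> measurable_fun setT g ->
  (forall x, 0 <= f x) -> (forall x, 0 <= g x) ->
  ((`|\int[mu]_x f x - \int[mu]_x g x|)%:E <= \int[mu]_x (`|f x - g x|)%:E)%E.
Proof.
move=> mf mg f0 g0.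
have mfg : measurable_fun setT (fun x => f x - g x) by exact: mfun_sub.
have F0 : (0 <= \int[mu]_x (f x)%:E)%E by apply: integral_ge0 => x _; rewrite lee_fin.
have G0 : (0 <= \int[mu]_x (g x)%:E)%E by apply: integral_ge0 => x _; rewrite lee_fin.
have D0 : (0 <= \int[mu]_x (`|f x - g x|)%:E)%E.
  by apply: integral_ge0 => x _; rewrite lee_fin.
have [Doo|] := ltP (\int[mu]_x (`|f x - g x|)%:E)%E +oo%E; last first.
  by rewrite leye_eq => /eqP ->; rewrite leey.
have fg := eintB_norm_sub mf mg f0 g0.
have gf := eintB_norm_sub mg mf g0 f0.
rewrite (_ : (fun x => (`|g x - f x|)%:E) = (fun x => (`|f x - g x|)%:E)) in gf; last first.
  by apply/funext => x; rewrite distrC.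
have [Foo|] := ltP (\int[mu]_x (f x)%:E)%E +oo%E.
  have Goo : (\int[mu]_x (g x)%:E < +oo)%E.
    by apply: (le_lt_trans gf); rewrite lte_add_pinfty.
  have igf := ge0_igP mf f0 Foo; have igg := ge0_igP mg g0 Goo.
  by rewrite -RintB// abs_Rint_le.
rewrite leye_eq => /eqP Fy.
have Gy : (\int[mu]_x (g x)%:E = +oo)%E.
  apply/eqP; rewrite -leye_eq leNgt; apply/negP => Goo.
  by move: fg; rewrite Fy leye_eq => /eqP h; move: (lte_add_pinfty Goo Doo); rewrite h.
by rewrite {1 2}/Rintegral Fy Gy /= subrr normr0.
Qed.

(** When the integral diverges both sides are 0 by default. *)
Lemma ge0_RintZ (k : R) (f : T -> R) : 0 <= k -> measurable_fun setT f ->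
  (forall x, 0 <= f x) -> \int[mu]_x (k * f x) = k * \int[mu]_x f x.
Proof.
move=> k0 mf f0; rewrite /Rintegral eintZ//.
move: k0; rewrite le_eqVlt => /predU1P[<-|k0]; first by rewrite mul0e mul0r.
have : (0 <= \int[mu]_x (f x)%:E)%E by apply: integral_ge0 => x _; rewrite lee_fin.
case: (\int[mu]_x (f x)%:E)%E => [r _//|_|//].
by rewrite gt0_muley ?lte_fin//= mulr0.
Qed.

Lemma Rint_EFin_le (f : T -> R) : (forall x, 0 <= f x) ->
  ((\int[mu]_x f x)%:E <= \int[mu]_x (f x)%:E)%E.
Proof.
move=> f0; have : (0 <= \int[mu]_x (f x)%:E)%E by apply: integral_ge0 => x _; rewrite lee_fin.
by rewrite /Rintegral; case: (\int[mu]_x (f x)%:E)%E => [r _||//] /=; rewrite ?leey.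
Qed.

End jensen.

Section substitution.
Context {R : realType}.
Local Notation leb := (@lebesgue_measure R).

Lemma ge0_integral_exhaust (D : set R) (f : R -> R) (a b : nat -> R) :
  measurable_fun D f -> (forall x, D x -> 0 <= f x) ->
  D = \bigcup_n `[a n, b n]%classic -> {homo a : m n / (m <= n)%N >-> n <= m} ->
  {homo b : m n / (m <= n)%N >-> m <= n} -> measurable D ->
  ((\int[leb]_(x in `[a n, b n]) (f x)%:E) @[n --> \oo] --> \int[leb]_(x in D) (f x)%:E)%E.
Proof.
move=> mf f0 DE aN bN mD.
have DS n : `[a n, b n]%classic `<=` D by rewrite DE => x ?; exists n.
have ndI : nondecreasing_seq (fun n => `[a n, b n]%classic).
  move=> m n mn; apply/subsetPset => x; rewrite /= !in_itv/= => /andP[h1 h2].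
  by rewrite (le_trans (aN _ _ mn) h1) (le_trans h2 (bN _ _ mn)).
have := @ge0_nondecreasing_set_cvg_integral _ (measurableTypeR R) R
  (fun n => `[a n, b n]%classic) (EFin \o f) leb ndI.
rewrite -DE; apply.
- by move=> n; exact: measurable_itv.
- by move=> n; apply/measurable_EFinP; apply: measurable_funS mf.
- by move=> n x /DS Dx; rewrite lee_fin f0.
Qed.

Lemma derive1_powR_near (p x : R) : 0 < x ->
  {for x, continuous (derive1 (fun y : R => y `^ p))}.
Proof.
move=> x0; rewrite /prop_for /continuous_at.
rewrite (is_derive_derive1 (is_derive1_powR p x0)).
have h : p * y `^ (p - 1) @[y --> x] --> p * x `^ (p - 1).
  by apply: cvgMr; exact: (@continuous_powR_pos _ (p - 1) _ x0).
apply: cvg_trans h; apply: near_eq_cvg; near=> y.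
have y0 : 0 < y by near: y; exact: lt_nbhsr.
by rewrite (is_derive_derive1 (is_derive1_powR p y0)).
Unshelve. all: by end_near. Qed.

(** The substitution [u = s ^ (- a)] is carried out on [[1 / (n + 1), n + 1]], away from the
    singularity at 0; since it reverses the order, the images exhaust the half-line with their end
    points exchanged. *)
Lemma ge0_integral_powRN (a : R) (G : R -> R) : 0 < a ->
  (forall u, 0 < u -> {for u, continuous G}) -> (forall u, 0 < u -> 0 <= G u) ->
  measurable_fun setT G ->
  (\int[leb]_(s in `]0%R, +oo[) (a * s `^ (- 1 - a) * G (s `^ (- a)))%:E =
   \int[leb]_(u in `]0%R, +oo[) (G u)%:E)%E.
Proof.
move=> a0 cG G0 mG.
pose F := fun s : R => s `^ (- a).
pose x_ n : R := n.+1%:R^-1; pose y_ n : R := n.+1%:R.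
have x0 n : 0 < x_ n by rewrite invr_gt0.
have y0 n : 0 < y_ n by rewrite ltr0n.
have F0 s : 0 < s -> 0 < F s by move=> s0; rewrite powR_gt0.
have Fdecr s t : 0 < s -> s < t -> F t < F s.
  move=> s0 st; have t0 := lt_trans s0 st.
  rewrite /F !powRN ltf_pV2 ?posrE ?powR_gt0//.
  by apply: gt0_ltr_powR; rewrite ?nnegrE ?(ltW s0) ?(ltW t0).
have Fdecrw s t : 0 < s -> s <= t -> F t <= F s.
  by move=> s0; rewrite le_eqVlt => /predU1P[->//|/(Fdecr _ _ s0)/ltW].
have sub n : (\int[leb]_(u in `[F (y_ n), F (x_ n)]) (G u)%:E =
    \int[leb]_(s in `[x_ n, y_ n]) (a * s `^ (- 1 - a) * G (s `^ (- a)))%:E)%E.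
  rewrite (@integration_by_substitution_decreasing R F G (x_ n) (y_ n)).
  - apply: eq_integral => s; rewrite inE /= in_itv/= => /andP[xs sy].
    have s0 : 0 < s by apply: lt_le_trans xs.
    rewrite !fctE /= /F (is_derive_derive1 (is_derive1_powR (- a) s0)).
    by congr EFin; rewrite mulNr opprK mulrC [- 1 - a]addrC.
  - by rewrite (@le_trans _ _ 1)// ?invf_le1 ?ler1n.
  - move=> s t; rewrite !in_itv/= => _ /andP[xt _] ts; apply: Fdecr => //.
    exact: lt_le_trans xt.
  - move=> s; rewrite in_itv/= => /andP[xs _]; apply: derive1_powR_near.
    exact: lt_trans xs.
  - by apply: cvgP; apply: cvg_at_right_filter; exact: derive1_powR_near (x0 n).
  - by apply: cvgP; apply: cvg_at_left_filter; exact: derive1_powR_near (y0 n).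
  - split.
    + move=> s; rewrite in_itv/= => /andP[xs _].
      exact: is_derive_derivable (is_derive1_powR _ (lt_trans (x0 n) xs)).
    + by apply: cvg_at_right_filter; exact: (@continuous_powR_pos _ (- a) _ (x0 n)).
    + by apply: cvg_at_left_filter; exact: (@continuous_powR_pos _ (- a) _ (y0 n)).
  - apply: continuous_in_subspaceT => u /set_mem; rewrite /= in_itv/= => /andP[yu _].
    by apply: cG; apply: lt_le_trans yu; exact: F0.
have ndx : {homo x_ : m n / (m <= n)%N >-> n <= m}.
  by move=> m n mn; rewrite lef_pV2 ?posrE// ler_nat.
have ndy : {homo y_ : m n / (m <= n)%N >-> m <= n}.
  by move=> m n mn; rewrite ler_nat.
have trunc_gt (x : R) : 0 < x -> x <= (Num.truncn x).+1%:R.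
  by move=> ?; rewrite (ltW (truncnS_gt _)).
have mH : measurable_fun setT (fun s : R => a * s `^ (- 1 - a) * G (s `^ (- a))).
  apply: mfun_mul; first by apply: mfun_mul; [exact: mfun_cst|exact: measurable_powR].
  exact: measurableT_comp mG (measurable_powR _).
have exh (x : R) : 0 < x -> exists n, (x_ n <= x) && (x <= y_ n).
  move=> xp; exists (maxn (Num.truncn x) (Num.truncn x^-1)); apply/andP; split.
    rewrite /x_ invf_ple ?posrE// (le_trans (trunc_gt _ _))// ?invr_gt0// ler_nat.
    by rewrite ltnS leq_maxr.
  by rewrite (le_trans (trunc_gt _ xp))// ler_nat ltnS leq_maxl.
have h1 := @ge0_integral_exhaust `]0, +oo[%classic
   (fun s => a * s `^ (- 1 - a) * G (s `^ (- a))) x_ y_ (measurable_funTS mH).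
have h2 := @ge0_integral_exhaust `]0, +oo[%classic
   G (F \o y_) (F \o x_) (measurable_funTS mG).
have {}h1 := cvg_lim (@ereal_hausdorff R) (h1 _ _ ndx ndy (measurable_itv _)).
rewrite -h1; first 1 last.
- move=> s; rewrite /= in_itv/= andbT => s0.
  by rewrite mulr_ge0 ?G0 ?powR_gt0// mulr_ge0 ?powR_ge0 ?(ltW a0).
- apply/seteqP; split=> [x|x [n _]] /=; rewrite !in_itv/= andbT.
    by move=> /exh[n xn]; exists n => //=; rewrite in_itv.
  by move=> /andP[h _]; apply: lt_le_trans h.
have {}h2 := cvg_lim (@ereal_hausdorff R) (h2 _ _ _ _ (measurable_itv _)).
rewrite -h2; first 1 last.
- by move=> s; rewrite /= in_itv/= andbT; exact: G0.
- apply/seteqP; split=> [u|u [n _]] /=; rewrite !in_itv/= andbT; last first.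
    by move=> /andP[h _]; apply: lt_le_trans h; exact: F0.
  move=> u0; have [n /andP[xn yn]] := exh _ (powR_gt0 (- a^-1) u0).
  have E : u = F (u `^ (- a^-1)).
    by rewrite /F -powRrM mulrNN mulVf ?gt_eqF// powRr1// ltW.
  exists n => //=; rewrite in_itv/= E Fdecrw ?powR_gt0//=.
  by rewrite Fdecrw.
- by move=> m n mn /=; exact: Fdecrw (y0 m) (ndy _ _ mn).
- by move=> m n mn /=; exact: Fdecrw (x0 n) (ndx _ _ mn).
by congr (limn _); apply/funext => n; exact/esym/sub.
Qed.

End substitution.

(** * The subordinating density *)

Section stable_weight.
Context {R : realType}.
Local Notation leb := (@lebesgue_measure R : {sigma_finite_measure set (measurableTypeR R) -> \bar R}).
Variables (alpha : R) (g : R -> R).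
Hypothesis halpha : 0 < alpha < 1.
Hypothesis cg : continuous g.
Hypothesis g0 : forall u, 0 <= g u.
Hypothesis gN : forall u, u <= 0 -> g u = 0.
Hypothesis laplace_g : forall sigma, 0 <= sigma ->
  \int[leb]_(s in `[0, +oo[) (expR (- sigma * s) * g s) = expR (- sigma `^ alpha).

Let a0 : 0 < alpha. Proof. by case/andP: halpha. Qed.

Let mg : measurable_fun setT g.
Proof. exact: continuous_measurable_fun. Qed.

Let eint_laplace sigma : 0 <= sigma ->
  (\int[leb]_s (expR (- sigma * s) * g s)%:E = (expR (- sigma `^ alpha))%:E)%E.
Proof.
move=> s0; have := laplace_g s0; rewrite Rint_indic.
have -> : (fun x : R => \1_(`[0, +oo[%classic : set R) x * (expR (- sigma * x) * g x)) =
    (fun s => expR (- sigma * s) * g s).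
  apply/funext => s; rewrite indicE mem_setE in_itv/= andbT.
  by case: leP => [_|/ltW/gN ->]; rewrite ?mul1r ?mulr0.
(* The Laplace hypothesis concerns a real-valued integral, which would be 0 if it diverged; its
   value is positive, so it converges. *)
rewrite /Rintegral; have : (0 <= \int[leb]_s (expR (- sigma * s) * g s)%:E)%E.
  by apply: integral_ge0 => s _; rewrite lee_fin mulr_ge0 ?expR_ge0.
case: (\int[leb]_s (expR (- sigma * s) * g s)%:E)%E => [r _ /= ->//|_ /= h|//].
by have := expR_gt0 (- sigma `^ alpha); rewrite -h ltxx.
Qed.

Let eint_g : (\int[leb]_s (g s)%:E = 1)%E.
Proof.
have := eint_laplace (lexx 0); rewrite powR0 ?gt_eqF// oppr0 expR0 => <-.
by apply: eq_integral => s _; rewrite mul0r expR0 mul1r.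
Qed.

Let ig_g : leb.-integrable setT (EFin \o g).
Proof. by apply: ge0_igP => //; rewrite eint_g ltry. Qed.

Let gap sigma u : 0 <= sigma -> 0 <= (1 - expR (- sigma * u)) * g u.
Proof.
move=> s0; have [u0|/gN ->] := ltP 0 u; last by rewrite mulr0.
rewrite mulr_ge0// subr_ge0 -expR0 ler_expR mulNr oppr_le0 mulr_ge0//.
exact: ltW.
Qed.

Let eint_gap sigma : 0 <= sigma ->
  (\int[leb]_u ((1 - expR (- sigma * u)) * g u)%:E <= (sigma `^ alpha)%:E)%E.
Proof.
move=> s0; have mE : measurable_fun setT (fun u => expR (- sigma * u) * g u) by mfun.
have igE : leb.-integrable setT (EFin \o (fun u => expR (- sigma * u) * g u)).
  apply: ge0_igP => //; first by move=> u; rewrite mulr_ge0 ?expR_ge0.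
  by rewrite eint_laplace// ltry.
under eq_integral do rewrite mulrBl mul1r.
rewrite (Rint_EFin (igB ig_g igE)) lee_fin RintB//.
have -> : \int[leb]_u g u = 1 by rewrite /Rintegral eint_g.
have -> : \int[leb]_u (expR (- sigma * u) * g u) = expR (- sigma `^ alpha).
  by rewrite /Rintegral eint_laplace.
by have := expR_ge1Dx (- sigma `^ alpha); lra.
Qed.

Let c1 : 0 < 1 - expR (-1) :> R.
Proof. by rewrite subr_gt0 -[X in _ < X]expR0 ltr_expR oppr_lt0. Qed.

Let kern (theta sigma : R) : R := \1_(`]0, 1]%classic : set R) sigma * sigma `^ (- 1 - theta).

Let kern_ge0 theta sigma : 0 <= kern theta sigma.
Proof. by rewrite mulr_ge0 ?indic_ge0 ?powR_ge0. Qed.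

Let mkern theta : measurable_fun setT (kern theta).
Proof. by apply: mfun_mul; [exact: measurable_indic|exact: measurable_powR]. Qed.

(* Bounding [u ^ theta] by Laplace functionals: the integral over [sigma >= 1 / u]
   already gives [u ^ theta - 1], up to a constant. *)
Let powR_le_kern theta u : 0 < theta -> 0 < u ->
  ((u `^ theta)%:E <= 1 + (theta / (1 - expR (-1)))%:E *
     \int[leb]_sigma (kern theta sigma * (1 - expR (- sigma * u)))%:E)%E.
Proof.
move=> t0 u0.
have k0 : 0 <= theta / (1 - expR (-1)) by rewrite divr_ge0 ?(ltW t0) ?(ltW c1).
have gap0 sigma : 0 <= kern theta sigma * (1 - expR (- sigma * u)).
  rewrite /kern indicE mem_setE in_itv/=; case: ltP => s0 /=; last by rewrite !mul0r.
  apply: mulr_ge0; first by rewrite mulr_ge0 ?powR_ge0.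
  by rewrite subr_ge0 -expR0 ler_expR mulNr oppr_le0 mulr_ge0 ?(ltW s0) ?(ltW u0).
have I0 : (0 <= \int[leb]_sigma (kern theta sigma * (1 - expR (- sigma * u)))%:E)%E.
  by apply: integral_ge0 => s _; rewrite lee_fin.
have [u1|u1] := leP u 1.
  rewrite (@le_trans _ _ 1%E)//; last by rewrite leeDl// mule_ge0.
  rewrite lee_fin (_ : 1 = 1 `^ theta); last by rewrite powR1.
  by apply: ge0_ler_powR; rewrite ?nnegrE ?(ltW t0) ?(ltW u0).
have v0 : 0 < u^-1 by rewrite invr_gt0.
have v1 : u^-1 < 1 by rewrite invf_lt1.
have FTC : (\int[leb]_(s in `[u^-1%R, 1%R]) (s `^ (- 1 - theta))%:E = ((u `^ theta - 1) / theta)%:E)%E.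
  have t1 : - 1 - theta + 1 = - theta by ring.
  have t1n : - 1 - theta + 1 != 0 by rewrite t1 oppr_eq0 gt_eqF.
  pose F (s : R) := (- 1 - theta + 1)^-1 * s `^ (- 1 - theta + 1).
  have cf s : u^-1 <= s <= 1 -> {for s, continuous (fun s : R => s `^ (- 1 - theta))}.
    move=> /andP[vs _]; exact: (@continuous_powR_pos _ (- 1 - theta) _ (lt_le_trans v0 vs)).
  have dF s : u^-1 <= s <= 1 -> is_derive s 1 F (s `^ (- 1 - theta)).
    by move=> /andP[vs _]; exact: is_derive_powR_div (lt_le_trans v0 vs) t1n.
  rewrite (integral_itv_FTC v1 cf dF) /F t1 powR1 -[u^-1]powR_inv1 ?(ltW u0)//.
  rewrite -powRrM mulrNN mul1r; congr EFin; field.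
  by rewrite gt_eqF.
have mI : measurable_fun setT (fun s : R => \1_(`[u^-1, 1]%classic : set R) s * s `^ (- 1 - theta)).
  by apply: mfun_mul; [exact: measurable_indic|exact: measurable_powR].
(* For [sigma >= 1 / u] the gap [1 - exp (- sigma u)] is at least [1 - exp (- 1)], a constant that
   factors out. *)
have h : ((1 - expR (-1))%:E * ((u `^ theta - 1) / theta)%:E <=
    \int[leb]_sigma (kern theta sigma * (1 - expR (- sigma * u)))%:E)%E.
  have mI0 (s : R) : 0 <= \1_(`[u^-1, 1]%classic : set R) s * s `^ (- 1 - theta).
    by rewrite mulr_ge0 ?indic_ge0 ?powR_ge0.
  rewrite -FTC eint_indic; apply: (@le_trans _ _ (\int[leb]_s ((1 - expR (-1)) *
     (\1_(`[u^-1, 1]%classic : set R) s * s `^ (- 1 - theta)))%:E)%E).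
    rewrite le_eqVlt; apply/orP; left; apply/eqP.
    exact: esym (eintZ leb (ltW c1) mI mI0).
  apply: eint_le.
  - by apply: mfun_mul => //; exact: mfun_cst.
  - by move=> s; rewrite mulr_ge0 ?(ltW c1)// mulr_ge0 ?indic_ge0 ?powR_ge0.
  - by apply: mfun_mul; [exact: mkern|mfun].
  - move=> s; have -> : \1_(`[u^-1, 1]%classic : set R) s = ((u^-1 <= s) && (s <= 1))%:R :> R.
      by rewrite indicE mem_setE in_itv.
    case: (leP u^-1 s) => us /=; last by rewrite mul0r mulr0 gap0.
    case: (leP s 1) => s1 /=; last by rewrite mul0r mulr0 gap0.
    have s0 : 0 < s by apply: lt_le_trans us.
    rewrite /kern indicE mem_setE in_itv/= s0 s1 !mul1r mulrC ler_wpM2l ?powR_ge0//.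
    by rewrite lerB// ler_expR mulNr lerN2 -ler_pdivrMr// div1r.
apply: (@le_trans _ _ (1 + (theta / (1 - expR (-1)))%:E *
    ((1 - expR (-1))%:E * ((u `^ theta - 1) / theta)%:E))%E).
  rewrite -!EFinM -EFinD lee_fin le_eqVlt; apply/orP; left; apply/eqP.
  by field; rewrite !gt_eqF.
by apply: leeD2l; apply: lee_wpmul2l => //; rewrite lee_fin.
Qed.

(** Tonelli and [powR_le_kern] reduce the moment to the integral of
    [sigma ^ (- 1 - theta) sigma ^ alpha] over []0, 1]], because [eint_gap] bounds the deficit of
    the Laplace transform by [sigma ^ alpha]; it is finite because [theta < alpha]. *)
Let moment_lty theta : 0 <= theta < alpha ->
  (\int[leb]_u (u `^ theta * g u)%:E < +oo)%E.
Proof.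
move=> /andP[]; rewrite le_eqVlt => /predU1P[<- _|t0 ta].
  by under eq_integral do rewrite powRr0 mul1r; rewrite eint_g ltry.
pose k := theta / (1 - expR (-1)).
have k0 : 0 <= k by rewrite divr_ge0 ?(ltW t0) ?(ltW c1).
pose f (u sigma : R) := kern theta sigma * ((1 - expR (- sigma * u)) * g u).
have f0 u sigma : 0 <= f u sigma.
  rewrite /f; have [s0|s0] := ltP 0 sigma; first by rewrite mulr_ge0// gap// ltW.
  by rewrite /kern indicE mem_setE in_itv/= ltNge s0 /= !mul0r.
have mf : measurable_fun setT (fun z : R * R => f z.1 z.2).
  apply: mfun_mul; first exact: measurableT_comp (mkern theta) measurable_snd.
  apply: mfun_mul; last exact: measurableT_comp mg measurable_fst.
  by mfun.
have mf1 u : measurable_fun setT (f u) by exact: mfun_curry1 mf u.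
have mI : measurable_fun setT (fun u => \int[leb]_sigma (f u sigma)%:E)%E.
  exact: (measurable_fun_fubini_tonelli_F (m2 := leb) _ (mfun_EFin mf)
    (fun z => f0 z.1 z.2)).
have I0 u : (0 <= \int[leb]_sigma (f u sigma)%:E)%E.
  by apply: integral_ge0 => s _; rewrite lee_fin.
have mpg : measurable_fun setT (fun u => u `^ theta * g u).
  by apply: mfun_mul => //; exact: measurable_powR.
apply: (@le_lt_trans _ _ (\int[leb]_u ((g u)%:E + k%:E * \int[leb]_sigma (f u sigma)%:E))%E).
  apply: ge0_le_integral.
  - exact: measurableT.
  - by move=> u _; rewrite lee_fin mulr_ge0 ?powR_ge0.
  - exact: mfun_EFin.
  - apply: emeasurable_funD; first exact: mfun_EFin.
    exact: measurable_funeM.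
  - move=> u _; have [u0|/gN ->] := ltP 0 u; last first.
      by rewrite mulr0 add0e mule_ge0.
    have gE : (0 <= (g u)%:E)%E by rewrite lee_fin.
    have := lee_wpmul2l gE (powR_le_kern t0 u0).
    rewrite -EFinM mulrC => h; apply: (le_trans h).
    have mK : measurable_fun setT (fun s => kern theta s * (1 - expR (- s * u))).
      by apply: mfun_mul; [exact: mkern|mfun].
    have K0 s : 0 <= kern theta s * (1 - expR (- s * u)).
      rewrite /kern indicE mem_setE in_itv/=; case: ltP => s0 /=; last by rewrite !mul0r.
      apply: mulr_ge0; first by rewrite mulr_ge0 ?powR_ge0.
      by rewrite subr_ge0 -expR0 ler_expR mulNr oppr_le0 mulr_ge0 ?(ltW s0) ?(ltW u0).
    have J0 : (0 <= \int[leb]_s (kern theta s * (1 - expR (- s * u)))%:E)%E.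
      by apply: integral_ge0 => s _; rewrite lee_fin.
    have E : (\int[leb]_s (f u s)%:E =
        (g u)%:E * \int[leb]_s (kern theta s * (1 - expR (- s * u)))%:E)%E.
      apply: etrans (eintZ leb (g0 u) mK K0).
      by apply: eq_integral => s _; rewrite /f; congr EFin; ring.
    by rewrite ge0_muleDr ?mule_ge0// mule1 muleCA E.
have -> : (\int[leb]_u ((g u)%:E + k%:E * \int[leb]_sigma (f u sigma)%:E) =
    \int[leb]_u (g u)%:E + k%:E * \int[leb]_u \int[leb]_sigma (f u sigma)%:E)%E.
  rewrite ge0_integralD//; last 4 first.
  - by move=> u _; rewrite lee_fin.
  - exact: mfun_EFin.
  - by move=> u _; rewrite mule_ge0.
  - exact: measurable_funeM.
  by rewrite ge0_integralZl.
rewrite eint_g lte_add_pinfty ?ltry// lte_mul_pinfty ?lee_fin//.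
have -> : (\int[leb]_u \int[leb]_sigma (f u sigma)%:E = \int[leb]_sigma \int[leb]_u (f u sigma)%:E)%E.
  exact: (fubini_tonelli (m1 := leb) (m2 := leb) _ (mfun_EFin mf) (fun z => f0 z.1 z.2)).
apply: (@le_lt_trans _ _ (\int[leb]_(s in `]0%R, 1%R]) (s `^ (alpha - 1 - theta))%:E)%E); last first.
  apply: (le_lt_trans (integral_powR_le1 _)); last exact: ltry.
  by lra.
rewrite eint_indic; apply: ge0_le_integral.
- exact: measurableT.
- by move=> s _; apply: integral_ge0 => u _; rewrite lee_fin.
- exact: (measurable_fun_fubini_tonelli_G (m1 := leb) _ (mfun_EFin mf)
    (fun z => f0 z.1 z.2)).
- by apply: mfun_EFin; apply: mfun_mul; [exact: measurable_indic|exact: measurable_powR].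
move=> s _; rewrite indicE mem_setE in_itv/=; case: (ltP 0 s) => s0 /=; last first.
  rewrite mul0r integral0_eq// => u _.
  by rewrite /f /kern indicE mem_setE in_itv/= ltNge s0 /= !mul0r.
case: (leP s 1) => s1 /=; last first.
  rewrite mul0r integral0_eq// => u _.
  by rewrite /f /kern indicE mem_setE in_itv/= [s <= 1]leNgt s1 andbF /= !mul0r.
have mG : measurable_fun setT (fun u => (1 - expR (- s * u)) * g u) by mfun.
have G0 u : 0 <= (1 - expR (- s * u)) * g u by exact: gap _ (ltW s0).
apply: (@le_trans _ _ ((kern theta s)%:E * (s `^ alpha)%:E)%E).
  apply: (@le_trans _ _ ((kern theta s)%:E * \int[leb]_u ((1 - expR (- s * u)) * g u)%:E)%E).
    rewrite le_eqVlt; apply/orP; left; apply/eqP.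
    have E := eintZ leb (kern_ge0 theta s) mG G0.
    transitivity (\int[leb]_u (kern theta s * ((1 - expR (- s * u)) * g u))%:E)%E; first by apply: eq_integral => u _; rewrite /f.
    exact: E.
  by apply: lee_wpmul2l; [rewrite lee_fin|exact: eint_gap _ (ltW s0)].
rewrite -EFinM lee_fin /kern indicE mem_setE in_itv/= s0 s1 !mul1r -powRD ?(gt_eqF s0) ?implybT//.
by rewrite le_eqVlt; apply/orP; left; apply/eqP; congr (_ `^ _); ring.
Qed.

(** The density of [U ^ (- alpha)] when [U] has density [g]; for the one-sided stable law this is
    the Mittag-Leffler law. The indicator lets it be integrated over the whole line. *)
Definition stable_weight (s : R) : R :=
  \1_(`]0, +oo[%classic : set R) s * (alpha^-1 * s `^ (- 1 - alpha^-1) * g (s `^ (- alpha^-1))).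

Lemma stable_weight_ge0 s : 0 <= stable_weight s.
Proof.
by rewrite mulr_ge0 ?indic_ge0// mulr_ge0// mulr_ge0 ?powR_ge0// invr_ge0 ltW.
Qed.

Lemma measurable_stable_weight : measurable_fun setT stable_weight.
Proof.
apply: mfun_mul; first exact: measurable_indic.
apply: mfun_mul; first by apply: mfun_mul; [exact: mfun_cst|exact: measurable_powR].
exact: measurableT_comp mg (measurable_powR _).
Qed.

(** Under [u = s ^ (- 1 / alpha)], the moment of order [- gamma] of the weight becomes the moment of
    order [gamma alpha] of [g], so that [gamma < 1] turns into [gamma alpha < alpha]. *)
Let eint_weight gamma : 0 <= gamma ->
  (\int[leb]_s (s `^ (- gamma) * stable_weight s)%:E =
   \int[leb]_u (u `^ (gamma * alpha) * g u)%:E)%E.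
Proof.
move=> ga0; have ai0 : 0 < alpha^-1 by rewrite invr_gt0.
pose G u := u `^ (gamma * alpha) * g u.
have mG : measurable_fun setT G by apply: mfun_mul => //; exact: measurable_powR.
have cG u : 0 < u -> {for u, continuous G}.
  by move=> u0; apply: cvgM; [exact: (@continuous_powR_pos _ (gamma * alpha) _ u0)|exact: cg].
have G0 u : 0 < u -> 0 <= G u by move=> _; rewrite mulr_ge0 ?powR_ge0.
have := ge0_integral_powRN ai0 cG G0 mG.
rewrite eint_indic [X in _ = X -> _]eint_indic => h.
transitivity (\int[leb]_s (\1_(`]0, +oo[%classic : set R) s *
    (alpha^-1 * s `^ (- 1 - alpha^-1) * G (s `^ (- alpha^-1))))%:E)%E.
  apply: eq_integral => s _; congr EFin; rewrite /stable_weight indicE mem_setE in_itv/= andbT.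
  case: ltP => [s0|_]; last by rewrite !mul0r mulr0.
  have -> : s `^ (- gamma) = (s `^ (- alpha^-1)) `^ (gamma * alpha).
    by rewrite -powRrM mulNr mulrC mulfK// gt_eqF.
  by rewrite /G; ring.
rewrite h; apply: eq_integral => u _; congr EFin; rewrite indicE mem_setE in_itv/= andbT.
by case: ltP => [_|/gN]; rewrite ?mul1r// /G => ->; rewrite !mulr0.
Qed.

Lemma eint_stable_weight : (\int[leb]_s (stable_weight s)%:E = 1)%E.
Proof.
rewrite -eint_g; have := eint_weight (lexx 0); rewrite oppr0 mul0r.
under eq_integral do rewrite powRr0 mul1r.
by under [in RHS]eq_integral do rewrite powRr0 mul1r.
Qed.

Lemma stable_weight_moment gamma : 0 <= gamma < 1 ->
  (\int[leb]_s (s `^ (- gamma) * stable_weight s)%:E < +oo)%E.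
Proof.
move=> /andP[ga0 ga1]; rewrite eint_weight//; apply: moment_lty.
by rewrite mulr_ge0 ?(ltW a0)//= gtr_pMl.
Qed.

End stable_weight.

(** * Mixtures of kernels in L^p *)

Section complex_norms.
Context {R : realType} {n : nat}.
Local Notation lam := (lebesgue_rV n : {sigma_finite_measure set 'rV[R]_n -> \bar R}).
Implicit Types f : 'rV[R]_n -> R[i].

Lemma normc_real (r : R) : Normc.normc (r%:C)%C = `|r|.
Proof. by rewrite /Normc.normc /= expr0n addr0 sqrtr_sqr. Qed.

Lemma normc_ge0 (z : R[i]) : 0 <= Normc.normc z.
Proof. by case: z => a b; rewrite /Normc.normc sqrtr_ge0. Qed.

Lemma Lp_norm_le f (p K : R) : 0 < p -> 0 <= K ->
  (\int[lam]_x (Normc.normc (f x) `^ p)%:E <= (K `^ p)%:E)%E ->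
  (Lp_norm p%:E f <= K%:E)%E.
Proof.
move=> p0 K0 h; rewrite /Lp_norm unlock.
apply: (@le_trans _ _ (((K `^ p)%:E) `^ p^-1)%E); last first.
  by rewrite poweR_EFin -powRrM mulfV ?gt_eqF// powRr1.
apply: gt0_ler_poweR => //.
- by rewrite invr_ge0 ltW.
- by rewrite in_itv/= leey andbT; apply: integral_ge0 => x _; rewrite lee_fin powR_ge0.
- by rewrite in_itv/= leey andbT lee_fin powR_ge0.
apply: le_trans h; rewrite le_eqVlt; apply/orP; left; apply/eqP.
by apply: eq_integral => x _; rewrite abse_EFin ger0_norm ?normc_ge0// poweR_EFin.
Qed.

Lemma Loo_norm_le f (K : R) : 0 <= K -> (forall x, Normc.normc (f x) <= K) ->
  (Lp_norm +oo%E f <= K%:E)%E.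
Proof.
(* By definition the norm at [+oo] is 0 when the whole space is null. *)
move=> K0 h; rewrite /Lp_norm unlock; case: ifP => _; last by rewrite lee_fin.
apply/ess_sup_inf.ess_supP; apply: nearW => x /=.
by rewrite lee_fin ger0_norm ?normc_ge0.
Qed.

End complex_norms.

Section mixture.
Context {R : realType} {n : nat}.
Local Notation lam := (lebesgue_rV n : {sigma_finite_measure set 'rV[R]_n -> \bar R}).
Local Notation leb := (@lebesgue_measure R : {sigma_finite_measure set (measurableTypeR R) -> \bar R}).
Variable w : R -> R.
Hypothesis mw : measurable_fun setT w.
Hypothesis w0 : forall s, 0 <= w s.
Hypothesis wN : forall s, s <= 0 -> w s = 0.

(** Jensen is applied with the weight [s ^ (- gamma) w s], the factor [s ^ gamma] being moved onto
    [h]. Then [h ^ p] is bounded by [h] times the sup bound to the power [p - 1], and the [L^1]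
    bound applies; [gamma] makes the powers of [s] cancel: [- kappa (p - 1) + gamma p = 0]. *)
Lemma mixture_powR_le (p kappa A M : R) (h : R -> 'rV[R]_n -> R) (b : 'rV[R]_n -> R) :
  let gamma := kappa * (1 - p^-1) in
  1 <= p -> 0 <= A -> 0 < M ->
  (\int[leb]_s (s `^ (- gamma) * w s)%:E <= M%:E)%E ->
  measurable_fun setT (fun z : R * 'rV[R]_n => h z.1 z.2) ->
  (forall s x, 0 <= h s x) ->
  (forall s x, 0 < s -> h s x <= A * s `^ (- kappa)) ->
  (forall s, 0 < s -> (\int[lam]_x (h s x)%:E <= A%:E)%E) ->
  measurable_fun setT b -> (forall x, 0 <= b x) ->
  (forall x, ((b x)%:E <= \int[leb]_s (h s x * w s)%:E)%E) ->
  (\int[lam]_x (b x `^ p)%:E <= ((M * A) `^ p)%:E)%E.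
Proof.
move=> gamma p1 A0 M0 hM mh h0 hsup hint mb b0 hb.
have p0 : 0 < p by apply: lt_le_trans p1.
pose m (s : R) := s `^ (- gamma) * w s.
have mm : measurable_fun setT m by apply: mfun_mul => //; exact: measurable_powR.
have m0 s : 0 <= m s by rewrite mulr_ge0 ?powR_ge0.
pose a (s : R) x := h s x * s `^ gamma.
have a0 s x : 0 <= a s x by rewrite mulr_ge0 ?powR_ge0.
have ma : measurable_fun setT (fun z : R * 'rV[R]_n => a z.1 z.2).
  by apply: mfun_mul => //; exact: measurableT_comp (measurable_powR _) measurable_fst.
have amE s x : a s x * m s = h s x * w s.
  have [s0|/wN ws] := ltP 0 s; last by rewrite /m ws !mulr0.
  have e : s `^ gamma * s `^ (- gamma) = 1.
    by rewrite -powRD ?(gt_eqF s0) ?implybT// subrr powRr0.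
  by rewrite -[RHS]mulr1 -e /a /m; ring.
pose F (s : R) x := M `^ (p - 1) * (a s x `^ p * m s).
have F0 s x : 0 <= F s x by rewrite mulr_ge0 ?powR_ge0// mulr_ge0 ?powR_ge0.
have mF : measurable_fun setT (fun z : R * 'rV[R]_n => F z.1 z.2).
  apply: mfun_mul; first exact: mfun_cst.
  by apply: mfun_mul; [exact: mfun_powR|exact: measurableT_comp mm measurable_fst].
have step1 x : ((b x `^ p)%:E <= \int[leb]_s (F s x)%:E)%E.
  have max : measurable_fun setT (a ^~ x) by exact: mfun_curry2 ma x.
  have mapx : measurable_fun setT (fun s => a s x `^ p * m s).
    by apply: mfun_mul => //; exact: mfun_powR.
  have apx0 s : 0 <= a s x `^ p * m s by rewrite mulr_ge0 ?powR_ge0.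
  have hbx : ((b x)%:E <= \int[leb]_s (a s x * m s)%:E)%E.
    by apply: (le_trans (hb x)); under [leRHS]eq_integral do rewrite amE.
  have J := @jensen_powR R _ _ leb p M (b x) (a ^~ x) m p1 M0 (b0 x) max mm
    (a0 ^~ x) m0 hM hbx.
  apply: (@le_trans _ _ _ _ _ J).
  rewrite le_eqVlt; apply/orP; left; apply/eqP; apply: esym.
  exact: (@eintZ R _ _ leb (M `^ (p - 1)) (fun s => a s x `^ p * m s) (powR_ge0 _ _) mapx apx0).
apply: (@le_trans _ _ (\int[lam]_x \int[leb]_s (F s x)%:E)%E).
  apply: ge0_le_integral.
  - exact: measurableT.
  - by move=> x _; rewrite lee_fin powR_ge0.
  - by apply: mfun_EFin; exact: mfun_powR.
  - exact: (measurable_fun_fubini_tonelli_G (m1 := leb) _ (mfun_EFin mF)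
      (fun z => F0 z.1 z.2)).
  - by move=> x _; exact: step1.
rewrite -(fubini_tonelli (m1 := leb) (m2 := lam) _ (mfun_EFin mF) (fun z => F0 z.1 z.2)) /=.
pose K := M `^ (p - 1) * A `^ p.
have K0 : 0 <= K by rewrite mulr_ge0 ?powR_ge0.
apply: (@le_trans _ _ (\int[leb]_s (K * m s)%:E)%E).
  apply: ge0_le_integral.
  - exact: measurableT.
  - by move=> s _; apply: integral_ge0 => x _; rewrite lee_fin.
  - exact: (measurable_fun_fubini_tonelli_F (m2 := lam) _ (mfun_EFin mF)
      (fun z => F0 z.1 z.2)).
  - by apply: mfun_EFin; apply: mfun_mul => //; exact: mfun_cst.
  move=> s _; have [s0|/wN ws] := ltP 0 s; last first.
    rewrite integral0_eq => [|x _]; last by rewrite /F /m ws !mulr0.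
    by rewrite lee_fin mulr_ge0.
  have mhs : measurable_fun setT (h s) by exact: mfun_curry1 mh s.
  pose B := M `^ (p - 1) * (A * s `^ (- kappa)) `^ (p - 1) * (s `^ gamma) `^ p * m s.
  have B0 : 0 <= B by rewrite mulr_ge0// !mulr_ge0 ?powR_ge0.
  apply: (@le_trans _ _ (\int[lam]_x (B * h s x)%:E)%E).
    apply: eint_le.
    - exact: mfun_curry1 mF s.
    - by move=> x; exact: F0.
    - by apply: mfun_mul => //; exact: mfun_cst.
    - move=> x; rewrite /F /B /a powRM ?powR_ge0//.
      have -> : h s x `^ p = h s x * h s x `^ (p - 1) by rewrite mulr_powRB1.
      have hp : h s x `^ (p - 1) <= (A * s `^ (- kappa)) `^ (p - 1).
        apply: ge0_ler_powR; rewrite ?nnegrE ?subr_ge0//; last exact: hsup.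
        by rewrite mulr_ge0 ?powR_ge0.
      set v := (A * _) `^ _ in hp *; set c1 := M `^ _; set c2 := _ `^ p; set u := h s x `^ _ in hp *.
      have -> : c1 * (h s x * u * c2 * m s) = (c1 * c2 * m s * h s x) * u by ring.
      have -> : c1 * v * c2 * m s * h s x = (c1 * c2 * m s * h s x) * v by ring.
      by rewrite ler_wpM2l// !mulr_ge0 ?powR_ge0.
  rewrite (eintZ lam B0 mhs (h0 s)).
  apply: (@le_trans _ _ (B%:E * A%:E)%E).
    by apply: lee_wpmul2l; [rewrite lee_fin|exact: hint].
  rewrite -EFinM lee_fin /B /K powRM ?powR_ge0// -!powRrM.
  have -> : A `^ p = A * A `^ (p - 1) by rewrite mulr_powRB1.
  have e : s `^ (- kappa * (p - 1)) * s `^ (gamma * p) = 1.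
    rewrite -powRD ?(gt_eqF s0) ?implybT//.
    have -> : - kappa * (p - 1) + gamma * p = 0 by rewrite /gamma; field; rewrite gt_eqF.
    by rewrite powRr0.
  rewrite le_eqVlt; apply/orP; left; apply/eqP.
  move: e; set u := s `^ (- kappa * _); set v := s `^ (gamma * _); set c1 := M `^ _.
  set c2 := A `^ _ => e.
  have -> : c1 * (c2 * u) * v * m s * A = c1 * (A * c2) * m s * (u * v) by ring.
  by rewrite e mulr1.
rewrite (eintZ leb K0 mm m0).
apply: (@le_trans _ _ (K%:E * M%:E)%E).
  by apply: lee_wpmul2l; rewrite ?lee_fin.
rewrite -EFinM lee_fin /K powRM ?(ltW M0)// mulrAC [M `^ _ * M]mulrC mulr_powRB1 ?(ltW M0)//.
Qed.

Lemma mixture_sup_le (kappa A M b : R) (h : R -> R) :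
  0 <= A -> (\int[leb]_s (s `^ (- kappa) * w s)%:E <= M%:E)%E ->
  measurable_fun setT h -> (forall s, 0 <= h s) ->
  (forall s, 0 < s -> h s <= A * s `^ (- kappa)) ->
  (b%:E <= \int[leb]_s (h s * w s)%:E)%E -> b <= M * A.
Proof.
move=> A0 hM mh h0 hsup hb; rewrite -lee_fin; apply: (le_trans hb).
have mm : measurable_fun setT (fun s : R => s `^ (- kappa) * w s).
  by apply: mfun_mul => //; exact: measurable_powR.
have m0 s : 0 <= s `^ (- kappa) * w s by rewrite mulr_ge0 ?powR_ge0.
apply: (@le_trans _ _ (\int[leb]_s (A * (s `^ (- kappa) * w s))%:E)%E).
  apply: eint_le.
  - exact: mfun_mul.
  - by move=> s; rewrite mulr_ge0.
  - by apply: mfun_mul => //; exact: mfun_cst.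
  - move=> s; have [s0|/wN ->] := ltP 0 s; last by rewrite !mulr0.
    by rewrite mulrA ler_wpM2r// hsup.
rewrite (eintZ leb A0 mm m0) mulrC EFinM; apply: lee_wpmul2l => //.
Qed.

End mixture.

Section green.
Context {R : realType} {n : nat}.
Local Notation lam := (lebesgue_rV n : {sigma_finite_measure set 'rV[R]_n -> \bar R}).
Variable mu : {measure set 'rV[R]_n -> \bar R}.
Variables (beta c : R).
Hypothesis H : is_symbol (psi mu beta) beta c.

(** The symbol is even, so the sine part of the inverse transform is odd in [xi] and integrates to
    0. *)
Lemma green_gk t x : 0 < t -> green mu beta t x = (gk (psi mu beta) t x)%:C%C.
Proof.
move=> t0; rewrite /green /cintegral /expi gkE.
have -> : \int[lam]_xi complex.Im ((cos (dotp x xi) +i* sin (dotp x xi)) *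
    (expR (- t * psi mu beta xi))%:C)%C = 0.
  have igs : lam.-integrable setT
      (EFin \o (fun xi => expR (- t * psi mu beta xi) * sin (dotp x xi))).
    apply: (igMb (ig_expRq H t0) (M := 1)); first by mfun; exact: measurable_dotp.
    by move=> xi; rewrite ler_norml sin_geN1 sin_le1.
  have N1 : -1 != 0 :> R by rewrite oppr_eq0 oner_eq0.
  have := Rint_affine 0 N1 igs; rewrite normrN normr1 expr1n invr1 mul1r.
  set I := (X in _ = X) => e.
  have {}e : - 1 * I = I.
    rewrite -[RHS]e -RintZ//; apply: eq_Rintegral => xi _.
    by rewrite add0r scaleN1r (symbol_even H) dotpNr sinN; ring.
  have /eqP : I *+ 2 = 0 by rewrite mulr2n -{1}e mulN1r addNr.
  rewrite mulrn_eq0 => /eqP I0; rewrite -[RHS]I0; apply: eq_Rintegral => xi _ /=.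
  by rewrite mulr0 add0r mulrC.
have -> : \int[lam]_xi complex.Re ((cos (dotp x xi) +i* sin (dotp x xi)) *
    (expR (- t * psi mu beta xi))%:C)%C =
    \int[lam]_xi (cos (dotp x xi) * expR (- t * psi mu beta xi)).
  by apply: eq_Rintegral => xi _ /=; rewrite mulr0 subr0.
by rewrite /real_complex_def; simpc.
Qed.

End green.

(** * Subordination of the stable kernel by a probability density *)

Section subordination.
Context {R : realType} {n : nat}.
Local Notation lam := (lebesgue_rV n : {sigma_finite_measure set 'rV[R]_n -> \bar R}).
Local Notation leb := (@lebesgue_measure R : {sigma_finite_measure set (measurableTypeR R) -> \bar R}).
Variables (q : 'rV[R]_n -> R) (beta c : R).
Hypothesis H : is_symbol q beta c.
Variable w : R -> R.
Hypothesis mw : measurable_fun setT w.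
Hypothesis w0 : forall s, 0 <= w s.
Hypothesis wN : forall s, s <= 0 -> w s = 0.
Hypothesis w1 : (\int[leb]_s (w s)%:E = 1)%E.

(** [tau] stands for [t ^ alpha]; the weight [w] stays abstract, a probability density on the
    positive half-line. *)
Definition subordinate (tau : R) (x : 'rV[R]_n) : R := \int[leb]_s (gk q (tau * s) x * w s).

Lemma gkw_ge0 (tau s : R) x : 0 < tau -> 0 <= gk q (tau * s) x * w s.
Proof.
move=> t0; have [s0|/wN ->] := ltP 0 s; last by rewrite mulr0.
by rewrite mulr_ge0// (gk_ge0 H)// mulr_gt0.
Qed.

Lemma measurable_gkw (tau : R) :
  measurable_fun setT (fun z : R * 'rV[R]_n => gk q (tau * z.1) z.2 * w z.1).
Proof.
apply: mfun_mul; last exact: measurableT_comp mw measurable_fst.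
by apply: (measurable_gk2 H); [mfun|exact: measurable_snd].
Qed.

Lemma measurable_gkw1 (tau : R) x : measurable_fun setT (fun s : R => gk q (tau * s) x * w s).
Proof. exact: (@mfun_curry2 R _ _ _ _ (fun s x => gk q (tau * s) x * w s) (measurable_gkw tau) x). Qed.

Lemma subordinate_ge0 tau x : 0 < tau -> 0 <= subordinate tau x.
Proof. by move=> t0; apply: Rintegral_ge0 => s _; exact: gkw_ge0. Qed.

Lemma measurable_subordinate tau : measurable_fun setT (subordinate tau).
Proof.
apply: (@mfun_Rint R _ _ _ _ leb (fun x s => gk q (tau * s) x * w s)).
apply: mfun_mul; last exact: measurableT_comp mw measurable_snd.
by apply: (measurable_gk2 H); [mfun|exact: measurable_fst].
Qed.

Lemma eint_gk t : 0 < t -> (\int[lam]_x (gk q t x)%:E = 1)%E.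
Proof. by move=> t0; rewrite (Rint_EFin (ig_gk H t0)) (Rint_gk H t0). Qed.

Lemma eint_gkw tau : 0 < tau ->
  (\int[lam]_x \int[leb]_s (gk q (tau * s) x * w s)%:E = 1)%E.
Proof.
move=> t0.
have F0 (z : R * 'rV[R]_n) : 0 <= gk q (tau * z.1) z.2 * w z.1 by exact: gkw_ge0.
rewrite -(fubini_tonelli (m1 := leb) (m2 := lam) _ (mfun_EFin (measurable_gkw tau)) F0) /=.
rewrite -w1; apply: (@eq_integral _ _ _ leb setT (fun s => (w s)%:E)) => s _.
have [s0|/wN ws] := ltP 0 s; last by rewrite ws integral0_eq// => x _; rewrite mulr0.
have ts : 0 < tau * s by rewrite mulr_gt0.
transitivity (\int[lam]_x (w s * gk q (tau * s) x)%:E)%E.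
  by apply: eq_integral => x _; rewrite mulrC.
rewrite (eintZ lam (w0 s) (measurable_gk H (tau * s)) (fun x => gk_ge0 H x ts)).
by rewrite eint_gk// mule1.
Qed.

(** Tonelli computes the mass of the extended-real mixture. Having integral 1 it is finite almost
    everywhere, and there it agrees with [subordinate], which is 0 at points of divergence. *)
Lemma eint_subordinate tau : 0 < tau -> (\int[lam]_x (subordinate tau x)%:E = 1)%E.
Proof.
move=> t0; rewrite -(eint_gkw t0).
pose F x := (\int[leb]_s (gk q (tau * s) x * w s)%:E)%E.
have F0 x : (0 <= F x)%E by apply: integral_ge0 => s _; rewrite lee_fin gkw_ge0.
have mF : measurable_fun setT F.
  have G0 (z : R * 'rV[R]_n) : 0 <= gk q (tau * z.1) z.2 * w z.1 by exact: gkw_ge0.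
  exact: (measurable_fun_fubini_tonelli_G (m1 := leb) _ (mfun_EFin (measurable_gkw tau)) G0).
have igF : lam.-integrable setT F.
  apply/integrableP; split => //.
  rewrite (_ : (fun x => `|F x|%E) = F); last by apply/funext => x; rewrite gee0_abs.
  by rewrite /F eint_gkw// ltry.
apply: ge0_ae_eq_integral => //.
- by apply: mfun_EFin; exact: measurable_subordinate.
- by move=> x _; rewrite lee_fin subordinate_ge0.
- by move=> x _; exact: F0.
- apply: filterS (integrable_ae measurableT igF) => x /(_ Logic.I) h _.
  by rewrite /subordinate /Rintegral fineK.
Qed.

Definition finite_moment (gamma : R) : Prop :=
  (\int[leb]_s (s `^ (- gamma) * w s)%:E < +oo)%E.

Lemma finite_moment_bound gamma : finite_moment gamma ->
  exists2 M, 0 < M & (\int[leb]_s (s `^ (- gamma) * w s)%:E <= M%:E)%E.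
Proof.
move=> h; set I := (\int[leb]_s _)%E.
have I0 : (0 <= I)%E by apply: integral_ge0 => s _; rewrite lee_fin mulr_ge0 ?powR_ge0.
exists (fine I + 1); first by rewrite ltr_pwDr// fine_ge0.
by rewrite -[leLHS]fineK ?ge0_fin_numE// lee_fin lerDl.
Qed.

Let gksup0 := gk_sup_ge0 H.
Let kappa := n%:R / beta.

Lemma subordinate_powR_lty tau p : 0 < tau -> 1 <= p ->
  finite_moment (kappa * (1 - p^-1)) ->
  exists2 K, 0 <= K & (\int[lam]_x (subordinate tau x `^ p)%:E <= (K `^ p)%:E)%E.
Proof.
move=> t0 p1 /finite_moment_bound[M M0 hM].
pose A := Num.max 1 (tau `^ (- kappa) * gk_sup q).
have A1 : 1 <= A by rewrite le_max lexx.
have A0 : 0 <= A by apply: le_trans A1.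
exists (M * A); first by rewrite mulr_ge0 ?(ltW M0).
pose h s x := `|gk q (tau * s) x|.
apply: (@mixture_powR_le R n w mw w0 wN p kappa A M h (subordinate tau)) => //.
- apply: mfun_norm; apply: (measurable_gk2 H); [by mfun|exact: measurable_snd].
- by move=> s x; exact: normr_ge0.
- move=> s x s0; have ts : 0 < tau * s by rewrite mulr_gt0.
  rewrite /h ger0_norm ?(gk_ge0 H)// (le_trans (gk_bound H x ts))//.
  rewrite powRM ?(ltW t0) ?(ltW s0)// mulrAC ler_wpM2r ?powR_ge0//.
  by rewrite le_max lexx orbT.
- move=> s s0; have ts : 0 < tau * s by rewrite mulr_gt0.
  under eq_integral do rewrite /h ger0_norm ?(gk_ge0 H)//.
  by rewrite eint_gk// lee_fin.
- exact: measurable_subordinate.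
- by move=> x; exact: subordinate_ge0.
- move=> x; apply: le_trans (Rint_EFin_le leb (fun s => gkw_ge0 s x t0)) _.
  apply: eint_le.
  + exact: measurable_gkw1.
  + by move=> s; exact: gkw_ge0.
  + by apply: mfun_mul => //; apply: mfun_norm; apply: (measurable_gk2 H); [mfun|exact: measurable_cst].
  + by move=> s; rewrite ler_wpM2r// ler_norm.
Qed.

Lemma subordinate_dist_le s t x : 0 < s -> 0 < t ->
  ((`|subordinate t x - subordinate s x|)%:E <=
   \int[leb]_r (`|gk q (t * r) x - gk q (s * r) x| * w r)%:E)%E.
Proof.
move=> s0 t0; apply: le_trans (abs_RintB_le leb (measurable_gkw1 t x) (measurable_gkw1 s x)
  (fun r => gkw_ge0 r x t0) (fun r => gkw_ge0 r x s0)) _.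
rewrite le_eqVlt; apply/orP; left; apply/eqP; apply: eq_integral => r _.
by rewrite -mulrBl normrM [X in _ * X]ger0_norm.
Qed.

Let mdist s t : measurable_fun setT (fun z : R * 'rV[R]_n => `|gk q (t * z.1) z.2 - gk q (s * z.1) z.2|).
Proof.
by apply: mfun_norm; apply: mfun_sub; apply: (measurable_gk2 H); (try exact: measurable_snd); mfun.
Qed.

(** Multiplying both times by [r] leaves [(t - s) / s] unchanged; only the sup bound acquires a
    power of [r], through the height of [gk (s r / 2)] at 0. These are the two endpoint bounds that
    [mixture_powR_le] interpolates. *)
Lemma gk_dist_bounds eps : 0 < eps -> exists2 C, 0 < C & forall s t, eps <= s -> s <= t ->
  (forall r x, 0 < r -> `|gk q (t * r) x - gk q (s * r) x| <= C * ((t - s) / s) * r `^ (- kappa)) /\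
  (forall r, 0 < r -> (\int[lam]_x (`|gk q (t * r) x - gk q (s * r) x|)%:E <= (C * ((t - s) / s))%:E)%E).
Proof.
move=> e0; have [C C0 hC] := gkdist_lipschitz H.
(* The factor 2 is that of [gk_lipschitz_sup], and [s >= eps] bounds [(s / 2) ^ (- kappa)] by
   [(eps / 2) ^ (- kappa)]. *)
pose D := 2 * (eps / 2) `^ (- kappa) * gk_sup q.
have D0 : 0 <= D by rewrite !mulr_ge0 ?powR_ge0.
exists (Num.max C D); first by rewrite lt_max C0.
move=> s t es st; have s0 : 0 < s by apply: lt_le_trans es.
have d0 : 0 <= (t - s) / s by rewrite divr_ge0 ?subr_ge0 ?(ltW s0).
have t0 := lt_le_trans s0 st.
have b0 := symbol_beta_gt0 H.
split=> [r x r0|r r0].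
  have sr : 0 < s * r by rewrite mulr_gt0.
  have str : s * r <= t * r by rewrite ler_wpM2r ?(ltW r0).
  apply: (le_trans (gk_lipschitz_sup H x sr str)).
  have sr2 : 0 < s * r / 2 by rewrite divr_gt0.
  rewrite (gk0E H sr2) -/kappa.
  have -> : (t * r - s * r) * (2 / (s * r)) = 2 * ((t - s) / s).
    by field; rewrite !gt_eqF.
  have hp : (s * r / 2) `^ (- kappa) <= (eps / 2) `^ (- kappa) * r `^ (- kappa).
    have -> : s * r / 2 = s / 2 * r by ring.
    rewrite powRM ?(ltW r0) ?divr_ge0 ?(ltW s0)// ler_wpM2r ?powR_ge0//.
    rewrite !powRN lef_pV2 ?posrE ?powR_gt0 ?divr_gt0//.
    have k0 : 0 <= kappa by rewrite divr_ge0 ?(ltW b0).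
    apply: ge0_ler_powR => //.
    - by rewrite nnegrE divr_ge0 ?(ltW e0).
    - by rewrite nnegrE divr_ge0 ?(ltW s0).
    - by rewrite ler_pM2r// invr_gt0.
  apply: (@le_trans _ _ (2 * ((t - s) / s) * ((eps / 2) `^ (- kappa) * r `^ (- kappa) * gk_sup q))).
    by rewrite ler_wpM2l ?(mulr_ge0 _ d0)// ler_wpM2r.
  have -> : 2 * ((t - s) / s) * ((eps / 2) `^ (- kappa) * r `^ (- kappa) * gk_sup q) =
    D * ((t - s) / s) * r `^ (- kappa) by rewrite /D; ring.
  by rewrite ler_wpM2r ?powR_ge0// ler_wpM2r// le_max lexx orbT.
have sr : 0 < s * r by rewrite mulr_gt0.
have tr : 0 < t * r by rewrite mulr_gt0.
have ign := integrable_norm (igB (ig_gk H tr) (ig_gk H sr)).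
rewrite (Rint_EFin ign) lee_fin.
have str : s * r <= t * r by rewrite ler_wpM2r ?(ltW r0).
apply: (le_trans (hC _ _ sr str)).
have -> : C * (t * r - s * r) / (s * r) = C * ((t - s) / s) by field; rewrite !gt_eqF.
by rewrite ler_wpM2r// le_max lexx.
Qed.

Lemma subordinate_lipschitz eps p : 0 < eps -> 1 <= p ->
  finite_moment (kappa * (1 - p^-1)) ->
  exists2 C, 0 < C & forall s t, eps <= s -> s <= t ->
    (\int[lam]_x (`|subordinate t x - subordinate s x| `^ p)%:E <=
     ((C * ((t - s) / s)) `^ p)%:E)%E.
Proof.
move=> e0 p1 /finite_moment_bound[M M0 hM]; have [C C0 hC] := gk_dist_bounds e0.
exists (M * C); first exact: mulr_gt0.
move=> s t es st; have s0 : 0 < s by apply: lt_le_trans es.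
have t0 := lt_le_trans s0 st; have [h1 h2] := hC _ _ es st.
have d0 : 0 <= (t - s) / s by rewrite divr_ge0 ?subr_ge0 ?(ltW s0).
rewrite -mulrA; apply: (@mixture_powR_le R n w mw w0 wN p kappa _ M
  (fun r x => `|gk q (t * r) x - gk q (s * r) x|)
  (fun x => `|subordinate t x - subordinate s x|)) => //.
- by rewrite mulr_ge0 ?(ltW C0).
- by apply: mfun_norm; apply: mfun_sub; exact: measurable_subordinate.
- by move=> x; exact: subordinate_dist_le.
Qed.

Lemma subordinate_lipschitz_sup eps : 0 < eps -> finite_moment kappa ->
  exists2 C, 0 < C & forall s t x, eps <= s -> s <= t ->
    `|subordinate t x - subordinate s x| <= C * ((t - s) / s).
Proof.
move=> e0 /finite_moment_bound[M M0 hM]; have [C C0 hC] := gk_dist_bounds e0.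
exists (M * C); first exact: mulr_gt0.
move=> s t x es st; have s0 : 0 < s by apply: lt_le_trans es.
have t0 := lt_le_trans s0 st; have [h1 _] := hC _ _ es st.
have d0 : 0 <= (t - s) / s by rewrite divr_ge0 ?subr_ge0 ?(ltW s0).
rewrite -mulrA; apply: (@mixture_sup_le R w mw w0 wN kappa _ M _
  (fun r => `|gk q (t * r) x - gk q (s * r) x|)) => //.
- by rewrite mulr_ge0 ?(ltW C0).
- exact: (@mfun_curry2 R _ _ _ _ (fun r x => `|gk q (t * r) x - gk q (s * r) x|) (mdist s t) x).
- by move=> r r0; exact: h1.
- exact: subordinate_dist_le.
Qed.

End subordination.

(** * Continuity of translations in L^p *)

Section translation.
Context {R : realType} {n : nat}.
Local Notation lam := (lebesgue_rV n : {sigma_finite_measure set 'rV[R]_n -> \bar R}).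
Variable p : R.
Hypothesis p1 : 1 <= p.
Let p0 : 0 < p. Proof. exact: lt_le_trans p1. Qed.
Implicit Types (u v w : 'rV[R]_n -> R) (y : nat -> 'rV[R]_n).

(** Formulated along sequences of translations, the form in which dominated convergence applies. *)
Definition translation_continuous u : Prop := measurable_fun setT u /\
  forall y, y @ \oo --> (0 : 'rV[R]_n) -> forall e : R, 0 < e ->
    \forall j \near \oo,
      (\int[lam]_x (`|u (x - y j) - u x| `^ p)%:E <= e%:E)%E.

(** From [d <= 3 * max a b c]; the crude constant is enough for all limits below. *)
Lemma powR_sum3_le (a b c d : R) : 0 <= d -> 0 <= a -> 0 <= b -> 0 <= c ->
  d <= a + b + c -> d `^ p <= 3 `^ p * (a `^ p + b `^ p + c `^ p).
Proof.
move=> d0 a0 b0 c0 dabc; pose m := Num.max a (Num.max b c).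
have m0 : 0 <= m by rewrite le_max a0.
have dm : d <= 3 * m.
  have am : a <= m by rewrite le_max lexx.
  have bm : b <= m by rewrite !le_max lexx orbT.
  have cm : c <= m by rewrite !le_max lexx !orbT.
  by apply: (le_trans dabc); lra.
have mp : m `^ p <= a `^ p + b `^ p + c `^ p.
  have ap := powR_ge0 a p; have bp := powR_ge0 b p; have cp := powR_ge0 c p.
  by rewrite /m; case: (leP b c) => _; [case: (leP a c) => _|case: (leP a b) => _]; lra.
apply: (@le_trans _ _ ((3 * m) `^ p)).
  by apply: ge0_ler_powR; rewrite ?nnegrE ?(ltW p0)// mulr_ge0.
by rewrite powRM// ler_wpM2l ?powR_ge0.
Qed.

Lemma measurable_translate (y : 'rV[R]_n) u : measurable_fun setT u ->
  measurable_fun setT (fun x : 'rV[R]_n => u (x - y)).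
Proof.
move=> mu; apply: (measurableT_comp mu).
by apply: measurable_sub2_rV; [exact: measurable_id|exact: measurable_cst].
Qed.

Lemma eint_translate (y : 'rV[R]_n) u : measurable_fun setT u -> (forall x, 0 <= u x) ->
  (\int[lam]_x (u (x - y)%R)%:E = \int[lam]_x (u x)%:E)%E.
Proof.
move=> mu u0; have := ge0_integral_affine_rV (- y) (oner_neq0 R) (mfun_EFin mu) (fun x => u0 x).
rewrite normr1 expr1n invr1 mul1e => <-.
by apply: eq_integral => x _; rewrite scale1r addrC.
Qed.

Let mdiff u (y : 'rV[R]_n) : measurable_fun setT u -> measurable_fun setT (fun x : 'rV[R]_n => `|u (x - y) - u x| `^ p).
Proof.
move=> mu; apply: mfun_powR; apply: mfun_norm; apply: mfun_sub => //.
exact: measurable_translate.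
Qed.

(** One closure property that serves for sums, scalar multiples, unions and relative complements:
    only the increments of [w] have to be controlled. *)
Lemma translation_continuous_dom (K : R) u v w : 0 <= K ->
  translation_continuous u -> translation_continuous v -> measurable_fun setT w ->
  (forall x x', `|w x' - w x| <= K * `|u x' - u x| + K * `|v x' - v x|) ->
  translation_continuous w.
Proof.
move=> K0 [mu tu] [mv tv] mw h; split; first exact: mw.
move=> y yy e e0.
pose L := 3 `^ p * K `^ p.
have L0 : 0 <= L by rewrite mulr_ge0 ?powR_ge0.
have L1 : 0 < L + 1 by rewrite ltr_pwDr.
pose d := e / (L + 1) / 2.
have d0 : 0 < d by rewrite !divr_gt0.
apply: filterS2 (tu y yy d d0) (tv y yy d d0) => j hu hv.
apply: (@le_trans _ _ (L%:E * (\int[lam]_x (`|u (x - y j) - u x| `^ p)%:E +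
    \int[lam]_x (`|v (x - y j) - v x| `^ p)%:E))%E); last first.
  apply: (@le_trans _ _ (L%:E * (d%:E + d%:E))%E).
    by apply: lee_wpmul2l; [rewrite lee_fin|exact: (leeD hu hv)].
  rewrite -EFinD -EFinM lee_fin /d -splitr mulrA ler_pdivrMr// mulrDr mulr1 mulrC.
  by rewrite lerDl ltW.
pose S (x : 'rV[R]_n) := `|u (x - y j) - u x| `^ p + `|v (x - y j) - v x| `^ p.
have S0 x : 0 <= S x by rewrite addr_ge0 ?powR_ge0.
have mS : measurable_fun setT S by apply: mfun_add; exact: mdiff.
rewrite -(eintD lam (mdiff (y j) mu) (fun x => powR_ge0 _ _) (mdiff (y j) mv)
  (fun x => powR_ge0 _ _)) -(@eintZ _ _ _ lam L S L0 mS S0).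
apply: eint_le.
- exact: mdiff.
- by move=> x; exact: powR_ge0.
- by apply: mfun_mul => //; exact: mfun_cst.
- move=> x; rewrite /S; pose a := `|u (x - y j) - u x|; pose b := `|v (x - y j) - v x|.
  have ab : `|w (x - y j) - w x| <= K * a + K * b + 0 by rewrite addr0; exact: h.
  have Ka : 0 <= K * a by exact: mulr_ge0 K0 (normr_ge0 _).
  have Kb : 0 <= K * b by exact: mulr_ge0 K0 (normr_ge0 _).
  apply: (le_trans (powR_sum3_le (normr_ge0 _) Ka Kb (lexx 0) ab)).
  by rewrite powR0 ?(gt_eqF p0)// addr0 (powRM _ K0 (normr_ge0 _)) (powRM _ K0 (normr_ge0 _)) -mulrDr mulrA.
Qed.

(** A three-term argument: two terms are distances between [u_ m] and [u], one of them translated,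
    which does not change its integral; the third is the translation increment of [u_ m]. *)
Lemma translation_continuous_lim (u_ : nat -> 'rV[R]_n -> R) g u :
  (forall m, translation_continuous (u_ m)) -> measurable_fun setT u ->
  (forall x, u_ m x @[m --> \oo] --> u x) -> (forall m x, `|u_ m x - u x| <= g x) ->
  lam.-integrable setT (EFin \o (fun x => g x `^ p)) ->
  translation_continuous u.
Proof.
move=> tu mu uu ug igg; split; first exact: mu.
move=> y yy e e0.
have mu_ m : measurable_fun setT (u_ m) by case: (tu m).
have mD m : measurable_fun setT (fun x => `|u_ m x - u x| `^ p).
  by apply: mfun_powR; apply: mfun_norm; exact: mfun_sub.
have D0 m x : 0 <= `|u_ m x - u x| `^ p by exact: powR_ge0.
have Dg m x : `| `|u_ m x - u x| `^ p | <= g x `^ p.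
  rewrite ger0_norm//; apply: ge0_ler_powR; rewrite ?nnegrE ?(ltW p0)//.
  exact: le_trans (ug m x).
pose L : R := 3 `^ p; have L0 : 0 < L by rewrite powR_gt0.
pose d := e / L / 3; have d0 : 0 < d by rewrite !divr_gt0.
have [m hm] : exists m, (\int[lam]_x (`|u_ m x - u x| `^ p)%:E <= d%:E)%E.
  have : \int[lam]_x (`|u_ m x - u x| `^ p) @[m --> \oo] --> \int[lam]_x (0 : R).
    apply: (Rint_cvg igg mD _ Dg) => x.
    have h : u_ m x - u x @[m --> \oo] --> u x - u x by apply: cvgB; [exact: uu|exact: cvg_cst].
    have := cvg_norm_powR p0 h; rewrite subrr normr0 powR0 ?gt_eqF//.
  rewrite Rintegral_cst// mul0r => /cvgrPdist_le/(_ _ d0)[m _ /(_ m (leqnn m))].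
  rewrite /= sub0r normrN => h; exists m.
  have igD : lam.-integrable setT (EFin \o (fun x => `|u_ m x - u x| `^ p)).
    exact: ig_le igg (mD m) (Dg m).
  by rewrite (Rint_EFin igD) lee_fin (le_trans (ler_norm _)).
have [_ /(_ y yy d d0)] := tu m; apply: filterS => j hj.
have mT : measurable_fun setT (fun x : 'rV[R]_n => `|u_ m (x - y j) - u (x - y j)| `^ p).
  exact: (measurable_translate (y j) (mD m)).
apply: (@le_trans _ _ (\int[lam]_x (L * (`|u_ m (x - y j) - u (x - y j)| `^ p +
   `|u_ m (x - y j) - u_ m x| `^ p + `|u_ m x - u x| `^ p))%:E)%E).
  apply: eint_le.
  - exact: mdiff.
  - by move=> x; exact: powR_ge0.
  - apply: mfun_mul; first exact: mfun_cst.
    by apply: mfun_add => //; apply: mfun_add => //; exact: mdiff.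
  - move=> x; apply: powR_sum3_le => //.
    have -> : u (x - y j) - u x = - (u_ m (x - y j) - u (x - y j)) +
      (u_ m (x - y j) - u_ m x) + (u_ m x - u x) by ring.
    by rewrite !(le_trans (ler_normD _ _))// lerD2r (le_trans (ler_normD _ _))// normrN.
have T0 (x : 'rV[R]_n) : 0 <= `|u_ m (x - y j) - u (x - y j)| `^ p + `|u_ m (x - y j) - u_ m x| `^ p.
  by rewrite addr_ge0 ?powR_ge0.
have mT2 : measurable_fun setT (fun x : 'rV[R]_n => `|u_ m (x - y j) - u (x - y j)| `^ p +
    `|u_ m (x - y j) - u_ m x| `^ p).
  by apply: mfun_add => //; exact: mdiff.
pose S (x : 'rV[R]_n) := `|u_ m (x - y j) - u (x - y j)| `^ p + `|u_ m (x - y j) - u_ m x| `^ p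
  + `|u_ m x - u x| `^ p.
have S0 x : 0 <= S x by rewrite addr_ge0.
have mS : measurable_fun setT S by exact: mfun_add.
rewrite (@eintZ _ _ _ lam L S (ltW L0) mS S0) (eintD lam mT2 T0 (mD m) (D0 m)).
rewrite (eintD lam mT (fun x => powR_ge0 _ _) (mdiff (y j) (mu_ m)) (fun x => powR_ge0 _ _)).
rewrite (eint_translate (y j) (mD m) (D0 m)).
apply: (@le_trans _ _ (L%:E * (d%:E + d%:E + d%:E))%E).
  by apply: lee_wpmul2l; [rewrite lee_fin ltW|exact: (leeD (leeD hm hj) hm)].
rewrite -!EFinD -EFinM lee_fin le_eqVlt; apply/orP; left; apply/eqP.
by rewrite /d; field; rewrite gt_eqF.
Qed.

Lemma translation_continuous0 : translation_continuous (fun=> 0).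
Proof.
split=> [|y _ e e0]; first exact: measurable_cst.
apply: nearW => j; rewrite integral0_eq ?lee_fin ?(ltW e0)// => x _.
by rewrite subrr normr0 powR0 ?gt_eqF.
Qed.

(** For an indicator the increment to the power [p] equals [1_U (x) + 1_U (x - y) - 2 * 1_U (x) *
    1_U (x - y)] whatever [p] is, so convergence of the product suffices. It holds pointwise: by
    openness at points of [U], and trivially elsewhere, boundary included. *)
Lemma translation_continuous_open (U : set 'rV[R]_n) : open U ->
  lam.-integrable setT (EFin \o (\1_U : _ -> R)) -> translation_continuous \1_U.
Proof.
move=> oU igU; have mU := ig_measurable igU; split; first exact: mU.
move=> y yy e e0.
have mUy j := measurable_translate (y j) mU.
have igUy j : lam.-integrable setT (EFin \o (fun x : 'rV[R]_n => \1_U (x - y j) : R)).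
  apply: ge0_igP; [exact: mUy|by move=> x; exact: indic_ge0|].
  rewrite (eint_translate (y j) mU (fun x => indic_ge0 U x)).
  by rewrite (Rint_EFin igU) ltry.
have E j : \int[lam]_x (\1_U (x - y j) : R) = \int[lam]_x (\1_U x : R).
  by rewrite /Rintegral (eint_translate (y j) mU (fun x => indic_ge0 U x)).
have igP j : lam.-integrable setT (EFin \o (fun x : 'rV[R]_n => \1_U x * \1_U (x - y j) : R)).
  by apply: (igMb igU (M := 1)) => // x; rewrite ger0_norm ?indic_ge0 ?indic_le1.
have hcv : \int[lam]_x (\1_U x * \1_U (x - y j) : R) @[j --> \oo] --> \int[lam]_x (\1_U x : R).
  apply: (@Rint_cvg _ _ _ lam _ _ (\1_U : _ -> R)) => //.
  - by move=> j; exact: mfun_mul.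
  - move=> x; have [Ux|nUx] := boolP (x \in U); last first.
      have -> : \1_U x = 0 :> R by rewrite indicE (negbTE nUx).
      by under eq_fun do rewrite mul0r; exact: cvg_cst.
    have -> : \1_U x = 1 :> R by rewrite indicE Ux.
    apply: cvg_near_cst.
    have h : x - y j @[j --> \oo] --> x - 0 by apply: cvgB => //; exact: cvg_cst.
    rewrite subr0 in h.
    have nU : nbhs x U by apply: open_nbhs_nbhs; split=> //; exact/set_mem.
    have hU : \forall j \near \oo, U (x - y j) by exact: h.
    by apply: filterS hU => j Uj; rewrite mul1r indicE mem_set.
  - move=> j x; rewrite ger0_norm ?mulr_ge0 ?indic_ge0//.
    by rewrite ler_piMr ?indic_ge0 ?indic_le1.
have e20 : 0 < e / 2 by rewrite divr_gt0.
move/cvgrPdist_le : hcv => /(_ _ e20); apply: filterS => j h.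
have -> : (\int[lam]_x (`|\1_U (x - y j) - \1_U x| `^ p)%:E =
    (\int[lam]_x (\1_U x + \1_U (x - y j) - 2 * (\1_U x * \1_U (x - y j))))%:E)%E.
  rewrite -(Rint_EFin (igB (igD igU (igUy j)) (igZ 2 (igP j)))).
  apply: eq_integral => x _; congr EFin; rewrite !indicE.
  have pn0 : p != 0 by rewrite gt_eqF.
  case: (x - y j \in U); case: (x \in U);
    rewrite /= ?(subrr, subr0, sub0r) ?normrN ?normr0 ?normr1 ?powR1 ?(powR0 pn0); by ring.
rewrite lee_fin RintB; [|exact: igD|exact: igZ].
rewrite RintD// RintZ// E; move: h; set I := \int[lam]_x _; set J := \int[lam]_x _.
by move=> /(le_trans (ler_norm _)); lra.
Qed.

(** The sets whose trace on [B] has a translation continuous indicator form a sigma-algebra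
    containing the open sets. The finite measure of [B] provides the majorant for countable
    unions. *)
Lemma translation_continuous_indic (B A : set 'rV[R]_n) : open B ->
  lam.-integrable setT (EFin \o (\1_B : _ -> R)) -> measurable A ->
  translation_continuous (\1_(A `&` B)).
Proof.
move=> oB igB mA.
have mB : measurable B by exact: open_measurable_rV.
pose E := [set C : set 'rV[R]_n | measurable C /\ translation_continuous (\1_(C `&` B))].
suff : <<s open >> `<=` E by move=> /(_ A mA)[].
have mI C : measurable C -> measurable_fun setT (\1_(C `&` B) : 'rV[R]_n -> R).
  by move=> mC; apply: measurable_indic; exact: measurableI.
have tB := translation_continuous_open oB igB.
have indI C x : \1_(C `&` B) x = (x \in C)%:R * (x \in B)%:R :> R.
  by rewrite indicE in_setI; case: (_ \in C); case: (_ \in B); rewrite /= ?mulr0 ?mulr1.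
have EU C D : E C -> E D -> E (C `|` D).
  move=> [mC tC] [mD tD]; split; first exact: measurableU.
  apply: (translation_continuous_dom ler01 tC tD); first by apply: mI; exact: measurableU.
  move=> x x'; rewrite !indI !in_setU !mul1r.
  case: (x \in C); case: (x' \in C); case: (x \in D); case: (x' \in D);
  case: (x \in B); case: (x' \in B); rewrite /= ?(mulr0, mul0r, mulr1);
  rewrite ?(subrr, subr0, sub0r, normrN, normr0, normr1, addr0, add0r) ?lexx ?ler01 ?lerDl ?ler01//.
apply: smallest_sub; last first.
  move=> C oC; split; first exact: open_measurable_rV.
  apply: translation_continuous_open; first exact: openI.
  apply: (ig_le igB); first exact: mI (open_measurable_rV oC).
  move=> x; rewrite ger0_norm ?indic_ge0// indI indicE.
  by case: (x \in C); rewrite ?mul1r// mul0r.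
have E0 : E set0.
  by split; [exact: measurable0|rewrite set0I indic0; exact: translation_continuous0].
split; [exact: E0|move=> C [mC tC]|move=> F EF].
  rewrite setTD; split; first exact: measurableC.
  apply: (translation_continuous_dom ler01 tC tB); first by apply: mI; exact: measurableC.
  move=> x x'; rewrite !indI !indicE !in_setC !mul1r.
  case: (x \in C); case: (x' \in C); case: (x \in B); case: (x' \in B);
  rewrite /= ?(mulr0, mul0r, mulr1);
  rewrite ?(subrr, subr0, sub0r, normrN, normr0, normr1, addr0, add0r) ?lexx ?ler01 ?lerDl ?ler01//.
have mF i : measurable (F i) by case: (EF i).
have mUF : measurable (\bigcup_i F i) by apply: bigcup_measurable => i _; exact: mF.
split; first exact: mUF.
pose G m := \big[setU/set0]_(i < m) F i.
have EG m : E (G m).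
  rewrite /G; elim: m => [|m IH]; first by rewrite big_ord0; exact: E0.
  rewrite big_ord_recr /=; exact: (EU _ _ IH (EF m)).
apply: (@translation_continuous_lim (fun m => \1_(G m `&` B)) (\1_B)).
- by move=> m; case: (EG m).
- exact: mI mUF.
- move=> x; apply: cvg_near_cst.
  have [[i _ Fi]|nF] := pselect ((\bigcup_i F i) x); last first.
    apply: nearW => m; rewrite !indI; congr (_%:R * _).
    congr nat_of_bool.
    rewrite (memNset nF) memNset// /G -bigcup_mkord => -[i _ Fi].
    by apply: nF; exists i.
  exists i.+1 => // m /= im; rewrite !indI; congr (_%:R * _).
  rewrite !mem_set//; first by exists i.
  by rewrite /G -bigcup_mkord; exists i.
- move=> m x; rewrite !indI indicE -mulrBl normrM [`|_%:R|]ger0_norm//.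
  rewrite ler_piMl//; case: (x \in G m); case: (x \in _);
    by rewrite /= ?subrr ?subr0 ?sub0r ?normrN ?normr0 ?normr1.
- rewrite (_ : (fun x => _) = (\1_B : _ -> R))//; apply/funext => x.
  by rewrite indicE; case: (_ \in B); rewrite /= ?powR1// powR0// gt_eqF.
Qed.

Definition eball (m : nat) : set 'rV[R]_n := [set x | enorm x < m%:R].

Lemma open_eball m : open (eball m).
Proof.
rewrite (_ : eball m = enorm @^-1` [set r | r < m%:R]); last by [].
apply: open_comp => [x _|]; first exact: continuous_enorm.
exact: open_lt.
Qed.

Lemma ig_eball m : lam.-integrable setT (EFin \o (\1_(eball m) : _ -> R)).
Proof.
(* On the ball every [|x_i|] is at most [m], so [exp (m) ^ n * base 1 x >= 1]: an integrable
   majorant without computing a volume. *)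
have := igZ (expR m%:R ^+ n) (ig_base n (ltr01 : 0 < 1 :> R)); move/ig_le; apply.
  by apply: measurable_indic; apply: open_measurable_rV; exact: open_eball.
move=> x; rewrite ger0_norm ?indic_ge0// indicE.
have [/set_mem xm|_] := boolP (x \in eball m); last by rewrite mulr_ge0 ?base_ge0// exprn_ge0 ?expR_ge0.
have -> : expR m%:R ^+ n = \prod_(i < n) expR (m%:R : R) by rewrite prodr_const card_ord.
rewrite /base -big_split/= [leLHS](_ : _ = \prod_(i < n) 1); last by rewrite big1.
apply: ler_prod => i _; rewrite ler01 /= -expRD -[leLHS]expR0 ler_expR mulN1r subr_ge0.
exact: le_trans (coord_le_enorm x i) (ltW xm).
Qed.

Lemma translation_continuous_sum (I : Type) (r : seq I) (f : I -> 'rV[R]_n -> R) :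
  (forall i, translation_continuous (f i)) -> translation_continuous (fun x => \sum_(i <- r) f i x).
Proof.
move=> tf; elim: r => [|i r IH].
  by under eq_fun do rewrite big_nil; exact: translation_continuous0.
under eq_fun do rewrite big_cons.
apply: (translation_continuous_dom ler01 (tf i) IH).
  by apply: mfun_add; [case: (tf i)|case: IH].
move=> x x'; rewrite !mul1r.
by rewrite (_ : _ + _ - _ = (f i x' - f i x) + (\sum_(i <- r) f i x' - \sum_(i <- r) f i x)) ?ler_normD//; ring.
Qed.

Lemma translation_continuousZ (a : R) u : translation_continuous u ->
  translation_continuous (fun x => a * u x).
Proof.
move=> tu; apply: (translation_continuous_dom (normr_ge0 a) tu translation_continuous0).
  by apply: mfun_mul; [exact: mfun_cst|case: tu].
by move=> x x'; rewrite subrr normr0 mulr0 addr0 -mulrBr normrM.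
Qed.

Import HBNNSimple.

(** The simple functions increasing to [u] are cut off to balls, so that their level sets become
    sets of finite measure; [u] itself dominates the error. *)
Lemma ge0_translation_continuous_Lp u : measurable_fun setT u -> (forall x, 0 <= u x) ->
  (\int[lam]_x (u x `^ p)%:E < +oo)%E -> translation_continuous u.
Proof.
move=> mu u0 uoo.
have mEu : measurable_fun setT (EFin \o u) by exact: mfun_EFin.
have Eu0 x : setT x -> (0%:E <= (EFin \o u) x)%E by rewrite lee_fin.
have [f [ndf cf]] := approximation measurableT mEu Eu0.
have cfx x : f m x @[m --> \oo] --> u x by have := cf x Logic.I; move/fine_cvg.
have fu m x : f m x <= u x.
  have nd : nondecreasing_seq (fun m => f m x).
    by move=> a b ab; have /lefP := ndf _ _ ab; apply.
  have := nondecreasing_cvgn_le nd (cvgP _ (cfx x)) m.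
  by rewrite (cvg_lim _ (cfx x)).
have f0 m x : 0 <= f m x by [].
apply: (@translation_continuous_lim (fun m x => f m x * \1_(eball m) x) u) => //.
- move=> m.
  have -> : (fun x => f m x * \1_(eball m) x) = (fun x =>
     \sum_(r <- finmap.enum_fset (fset_set (range (f m)))) r * \1_(f m @^-1` [set r] `&` eball m) x).
    apply/funext => x; rewrite [X in X * _]fimfunE fsbig_finite//= mulr_suml.
    by apply: eq_bigr => r _; rewrite -mulrA indicI.
  apply: translation_continuous_sum => r; apply: translation_continuousZ.
  apply: translation_continuous_indic; [exact: open_eball|exact: ig_eball|].
  exact: measurable_sfunP.
- move=> x; apply: cvg_trans (cfx x); apply: near_eq_cvg.
  exists (Num.truncn (enorm x)).+1 => // m /= xm; rewrite indicE mem_set ?mulr1//.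
  by rewrite /eball /= (lt_le_trans (truncnS_gt _))// ler_nat.
- move=> m x; have h : f m x * \1_(eball m) x <= u x.
    by rewrite (le_trans _ (fu m x))// ler_piMr ?indic_le1.
  have h0 : 0 <= f m x * \1_(eball m) x by rewrite mulr_ge0 ?indic_ge0.
  by rewrite ler0_norm ?subr_le0// opprB lerBlDr lerDl.
- by apply: ge0_igP => //; [exact: mfun_powR|move=> x; exact: powR_ge0].
Qed.

Lemma translation_continuous_Lp u : measurable_fun setT u ->
  (\int[lam]_x (`|u x| `^ p)%:E < +oo)%E -> translation_continuous u.
Proof.
move=> mu uoo.
have mpow (v : 'rV[R]_n -> R) : measurable_fun setT v -> (forall x, 0 <= v x <= `|u x|) ->
    translation_continuous v.
  move=> mv vu; apply: (ge0_translation_continuous_Lp mv); first by move=> x; case/andP: (vu x).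
  apply: le_lt_trans uoo; apply: eint_le.
  - exact: mfun_powR.
  - by move=> x; exact: powR_ge0.
  - by apply: mfun_powR; exact: mfun_norm.
  - by move=> x; have /andP[v0 vx] := vu x; apply: ge0_ler_powR; rewrite ?nnegrE ?(ltW p0).
pose up x := (`|u x| + u x) / 2; pose um x := (`|u x| - u x) / 2.
have mup : measurable_fun setT up.
  by apply: mfun_mul; [apply: mfun_add => //; exact: mfun_norm|exact: mfun_cst].
have mum : measurable_fun setT um.
  by apply: mfun_mul; [apply: mfun_sub => //; exact: mfun_norm|exact: mfun_cst].
have ub x : - `|u x| <= u x <= `|u x| by rewrite -ler_norml.
have tp : translation_continuous up.
  by apply: mpow => // x; have /andP[] := ub x; rewrite /up => ? ?; apply/andP; split; lra.
have tm : translation_continuous um.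
  by apply: mpow => // x; have /andP[] := ub x; rewrite /um => ? ?; apply/andP; split; lra.
apply: (translation_continuous_dom ler01 tp tm mu) => x x'; rewrite !mul1r.
by rewrite (_ : u x' - u x = (up x' - up x) - (um x' - um x)) ?ler_normB// /up /um; lra.
Qed.

End translation.

(** * Approximate identities *)

Section approximate_identity.
Context {R : realType} {n : nat}.
Local Notation lam := (lebesgue_rV n : {sigma_finite_measure set 'rV[R]_n -> \bar R}).
Local Notation leb := (@lebesgue_measure R : {sigma_finite_measure set (measurableTypeR R) -> \bar R}).
Variables (q : 'rV[R]_n -> R) (beta c : R).
Hypothesis H : is_symbol q beta c.
Variable w : R -> R.
Hypothesis mw : measurable_fun setT w.
Hypothesis w0 : forall s, 0 <= w s.
Hypothesis wN : forall s, s <= 0 -> w s = 0.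
Hypothesis w1 : (\int[leb]_s (w s)%:E = 1)%E.
Let beta0 := symbol_beta_gt0 H.

Local Notation S := (subordinate q w).
Local Notation P := (sfprod leb lam : {sigma_finite_measure set (measurableTypeR R * 'rV[R]_n)%type -> \bar R}).
Local Notation RV := (measurableTypeR R * 'rV[R]_n)%type.

(** [S tau] has mass 1, so [u x] can be subtracted under the integral sign. If the right-hand side
    is infinite there is nothing to prove; otherwise it provides the integrability that the
    subtraction requires. *)
Lemma convolution_dist_le tau (u : 'rV[R]_n -> R) x : 0 < tau -> measurable_fun setT u ->
  ((`|\int[lam]_y (S tau (x - y) * u y) - u x|)%:E <=
   \int[lam]_y (S tau y * `|u (x - y)%R - u x|)%:E)%E.
Proof.
move=> t0 mu.
have S0 y : 0 <= S tau y by exact: (subordinate_ge0 H w0 wN).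
have mS : measurable_fun setT (S tau) by exact: (measurable_subordinate H mw).
have mSx : measurable_fun setT (fun y : 'rV[R]_n => S tau (x - y)).
  exact: measurableT_comp mS (measurable_sub_rV x).
have mux : measurable_fun setT (fun y : 'rV[R]_n => u (x - y)).
  exact: measurableT_comp mu (measurable_sub_rV x).
have mF : measurable_fun setT (fun y : 'rV[R]_n => S tau y * `|u (x - y) - u x|).
  by apply: mfun_mul => //; apply: mfun_norm; apply: mfun_sub => //; exact: mfun_cst.
have F0 y : 0 <= S tau y * `|u (x - y) - u x| by rewrite mulr_ge0.
have N1 : -1 != 0 :> R by rewrite oppr_eq0 oner_eq0.
have refl (f : 'rV[R]_n -> R) : measurable_fun setT f -> (forall y, 0 <= f y) ->
    (\int[lam]_y (f (x - y)%R)%:E = \int[lam]_y (f y)%:E)%E.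
  move=> mf f0; have := ge0_integral_affine_rV x N1 (mfun_EFin mf) (fun y => f0 y).
  rewrite normrN normr1 expr1n invr1 mul1e => <-.
  by apply: eq_integral => y _; rewrite scaleN1r.
have := refl _ mF F0 => <-.
have subK y : x - (x - y) = y by rewrite subKr.
have -> : (\int[lam]_y (S tau (x - y) * `|u (x - (x - y)) - u x|)%:E =
    \int[lam]_y (`|S tau (x - y) * (u y - u x)|)%:E)%E.
  by apply: eq_integral => y _; rewrite subK normrM [in RHS]ger0_norm.
have mg : measurable_fun setT (fun y : 'rV[R]_n => S tau (x - y) * (u y - u x)).
  by apply: mfun_mul => //; apply: mfun_sub => //; exact: mfun_cst.
have [Foo|] := ltP (\int[lam]_y (`|S tau (x - y) * (u y - u x)|)%:E)%E +oo%E; last first.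
  by rewrite leye_eq => /eqP ->; rewrite leey.
have igg : lam.-integrable setT (EFin \o (fun y : 'rV[R]_n => S tau (x - y) * (u y - u x))).
  by apply/integrableP; split; [exact: mfun_EFin|exact: Foo].
have S1 : (\int[lam]_y (S tau (x - y)%R)%:E = 1)%E.
  by rewrite (refl _ mS S0); exact: (eint_subordinate H mw w0 wN w1).
have igS : lam.-integrable setT (EFin \o (fun y : 'rV[R]_n => S tau (x - y))).
  by apply: (ge0_igP mSx) => [y|]; [exact: S0|rewrite S1 ltry].
have -> : \int[lam]_y (S tau (x - y) * u y) =
    \int[lam]_y (S tau (x - y) * (u y - u x)) + u x.
  transitivity (\int[lam]_y (S tau (x - y) * (u y - u x) + u x * S tau (x - y))).
    by apply: eq_Rintegral => y _; ring.
  by rewrite (RintD igg (igZ (u x) igS)) (RintZ (u x) igS) {2}/Rintegral S1 mulr1.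
by rewrite addrK; exact: abs_Rint_le.
Qed.

(** The length scale at time [tau * s]: [gk (tau * s)] is [gk 1] dilated by this factor. *)
Definition dilation (tau s : R) : R := (tau * s) `^ beta^-1.

(** A probability density on pairs [(s, z)] that is free of [tau]: as [tau] tends to 0 only the
    translations [dilation tau s *: z] move, and dominated convergence applies. *)
Definition mixing_weight (z : RV) : R := w z.1 * gk q 1 z.2.

Lemma mixing_weight_ge0 z : 0 <= mixing_weight z.
Proof. by rewrite mulr_ge0// (gk_ge0 H). Qed.

Lemma measurable_mixing_weight : measurable_fun setT mixing_weight.
Proof.
apply: mfun_mul; first exact: measurableT_comp mw measurable_fst.
exact: measurableT_comp (measurable_gk H 1) measurable_snd.
Qed.

Lemma eint_mixing_weight : (\int[P]_z (mixing_weight z)%:E = 1)%E.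
Proof.
rewrite (fubini_tonelli1 (m2 := lam) _ (mfun_EFin measurable_mixing_weight) mixing_weight_ge0).
rewrite -[RHS]w1; apply: eq_integral => s _; rewrite /fubini_F /mixing_weight /=.
rewrite (eintZ lam (w0 s) (measurable_gk H 1) (fun x => gk_ge0 H x ltr01)).
by rewrite (eint_gk H)// mule1.
Qed.

Lemma measurable_dilation tau : measurable_fun setT (fun z : RV => dilation tau z.1 *: z.2).
Proof.
apply/measurable_fun_rVP => i; under eq_fun do rewrite mxE.
apply: mfun_mul; last exact: measurableT_comp (measurable_coord_rV i) measurable_snd.
apply: mfun_powR; apply: mfun_mul; first exact: mfun_cst.
exact: measurable_fst.
Qed.

Lemma eint_gk_dilation tau s (D : 'rV[R]_n -> R) : 0 < tau -> 0 < s ->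
  measurable_fun setT D -> (forall y, 0 <= D y) ->
  (\int[lam]_y (gk q (tau * s) y * D y)%:E =
   \int[lam]_z (gk q 1 z * D (dilation tau s *: z)%R)%:E)%E.
Proof.
move=> t0 s0 mD D0; have ts : 0 < tau * s by rewrite mulr_gt0.
set r := dilation tau s; have r0 : 0 < r by rewrite powR_gt0.
have rb : r `^ beta = tau * s by rewrite -powRrM mulVf ?gt_eqF// powRr1 ?(ltW ts).
pose f y := gk q (tau * s) y * D y.
have mf : measurable_fun setT f by apply: mfun_mul => //; exact: measurable_gk H _.
have f0 y : 0 <= f y by rewrite mulr_ge0// (gk_ge0 H).
have rn0 : r != 0 by rewrite gt_eqF.
have e := ge0_integral_affine_rV 0 rn0 (mfun_EFin mf) (fun y => f0 y).
have rn : 0 < r ^+ n by rewrite exprn_gt0.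
transitivity ((r ^+ n)%:E * \int[lam]_x (f (0 + r *: x)%R)%:E)%E.
  by rewrite e gtr0_norm// muleA -EFinM mulfV ?gt_eqF// mul1e.
have mfr : measurable_fun setT (fun x : 'rV[R]_n => f (0 + r *: x)).
  exact: measurableT_comp mf (measurable_affine_rV 0 r).
rewrite -(@eintZ _ _ _ lam _ (fun x => f (0 + r *: x)) (ltW rn) mfr (fun x => f0 _)).
apply: eq_integral => z _; congr EFin; rewrite add0r /f mulrA; congr (_ * _).
rewrite -rb -[r `^ beta]mulr1 (gk_scale H)// scalerA mulVf// scale1r.
by rewrite mulrA mulfV ?gt_eqF// mul1r.
Qed.

(** Substituting [y = dilation tau s *: z] in each kernel turns the convolution bound into an
    average of translation increments. It is an inequality because a divergent inner integral counts
    as 0 on the left. *)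
Lemma convolution_dist_mixing tau (u : 'rV[R]_n -> R) x : 0 < tau -> measurable_fun setT u ->
  (\int[lam]_y (S tau y * `|u (x - y)%R - u x|)%:E <=
   \int[P]_z (`|u (x - dilation tau z.1 *: z.2)%R - u x| * mixing_weight z)%:E)%E.
Proof.
move=> t0 mu; pose D (y : 'rV[R]_n) := `|u (x - y) - u x|.
have mD : measurable_fun setT D.
  apply: mfun_norm; apply: mfun_sub; last exact: mfun_cst.
  exact: measurableT_comp mu (measurable_sub_rV x).
have D0 y : 0 <= D y by exact: normr_ge0.
pose G (s : R) y := gk q (tau * s) y * w s * D y.
have G0 s y : 0 <= G s y by rewrite mulr_ge0// (gkw_ge0 H w0 wN).
have mG : measurable_fun setT (fun z : R * 'rV[R]_n => G z.1 z.2).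
  apply: mfun_mul; first exact: (measurable_gkw H mw).
  exact: measurableT_comp mD measurable_snd.
apply: (@le_trans _ _ (\int[lam]_y \int[leb]_s (G s y)%:E)%E).
  apply: ge0_le_integral.
  - exact: measurableT.
  - by move=> y _; rewrite lee_fin mulr_ge0// (subordinate_ge0 H w0 wN).
  - by apply: mfun_EFin; apply: mfun_mul => //; exact: (measurable_subordinate H mw).
  - exact: (measurable_fun_fubini_tonelli_G (m1 := leb) _ (mfun_EFin mG)
      (fun z => G0 z.1 z.2)).
  move=> y _; have gy s : 0 <= gk q (tau * s) y * w s by exact: (gkw_ge0 H w0 wN).
  apply: (@le_trans _ _ ((D y)%:E * \int[leb]_s (gk q (tau * s) y * w s)%:E)%E).
    rewrite mulrC EFinM; apply: lee_wpmul2l; first by rewrite lee_fin.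
    exact: (@Rint_EFin_le R _ _ leb (fun s => gk q (tau * s) y * w s) gy).
  rewrite -(@eintZ _ _ _ leb _ (fun s => gk q (tau * s) y * w s) (D0 y)
    (measurable_gkw1 H mw tau y) gy).
  rewrite le_eqVlt; apply/orP; left; apply/eqP; apply: eq_integral => s _.
  by rewrite /G mulrC.
rewrite -(fubini_tonelli (m1 := leb) (m2 := lam) _ (mfun_EFin mG) (fun z => G0 z.1 z.2)) /=.
pose F (z : RV) := D (dilation tau z.1 *: z.2) * mixing_weight z.
have F0 z : 0 <= F z by rewrite mulr_ge0 ?mixing_weight_ge0.
have mF : measurable_fun setT F.
  apply: mfun_mul; last exact: measurable_mixing_weight.
  exact: measurableT_comp mD (measurable_dilation tau).
rewrite (_ : (\int[P]_z _)%E = \int[P]_z (F z)%:E)%E; last by [].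
rewrite (fubini_tonelli1 (m2 := lam) _ (mfun_EFin mF) F0).
rewrite le_eqVlt; apply/orP; left; apply/eqP; apply: eq_integral => s _.
rewrite /fubini_F /F /mixing_weight /=.
have [s0|/wN ws] := ltP 0 s; last first.
  by rewrite !integral0_eq// => y _; rewrite /G ws ?mul0r ?mulr0 ?mul0r.
have mgD : measurable_fun setT (fun y => gk q (tau * s) y * D y).
  by apply: mfun_mul => //; exact: measurable_gk H _.
have gD0 y : 0 <= gk q (tau * s) y * D y by rewrite mulr_ge0// (gk_ge0 H)// mulr_gt0.
transitivity ((w s)%:E * \int[lam]_y (gk q (tau * s) y * D y)%:E)%E.
  rewrite -(@eintZ _ _ _ lam _ (fun y => gk q (tau * s) y * D y) (w0 s) mgD gD0).
  by apply: eq_integral => y _; rewrite /G; congr EFin; ring.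
rewrite (eint_gk_dilation t0 s0 mD D0).
have mD' : measurable_fun setT (fun z => gk q 1 z * D (dilation tau s *: z)).
  apply: mfun_mul; first exact: measurable_gk H _.
  have := measurable_affine_rV 0 (dilation tau s) (n := n).
  by under eq_fun do rewrite add0r; exact: measurableT_comp mD.
have gD0' z : 0 <= gk q 1 z * D (dilation tau s *: z) by rewrite mulr_ge0// (gk_ge0 H).
rewrite -(@eintZ _ _ _ lam _ (fun z => gk q 1 z * D (dilation tau s *: z)) (w0 s) mD' gD0').
by apply: eq_integral => z _; congr EFin; ring.
Qed.

Section Lp.
Variables (p : R) (u : 'rV[R]_n -> R).
Hypothesis p1 : 1 <= p.
Hypothesis mu : measurable_fun setT u.
Hypothesis uLp : (\int[lam]_x (`|u x| `^ p)%:E < +oo)%E.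
Let p0 : 0 < p. Proof. exact: lt_le_trans p1. Qed.

Definition translation_modulus (y : 'rV[R]_n) : R := \int[lam]_x (`|u (x - y) - u x| `^ p).

Let mup : measurable_fun setT (fun x : 'rV[R]_n => `|u x| `^ p).
Proof. by apply: mfun_powR; exact: mfun_norm. Qed.

Let igup : lam.-integrable setT (EFin \o (fun x => `|u x| `^ p)).
Proof. by apply: (ge0_igP mup) => // x; exact: powR_ge0. Qed.

Let mut y : measurable_fun setT (fun x : 'rV[R]_n => `|u (x - y) - u x| `^ p).
Proof.
by apply: mfun_powR; apply: mfun_norm; apply: mfun_sub => //; exact: measurable_translate.
Qed.

Let bound : R := 3 `^ p * (2 * \int[lam]_x (`|u x| `^ p)).

Let eint_modulus_le y : (\int[lam]_x (`|u (x - y)%R - u x| `^ p)%:E <= bound%:E)%E.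
Proof.
have Sp : 0 <= 3 `^ p :> R by exact: powR_ge0.
have mT := measurable_translate y mup.
have A0 x : 0 <= `|u x| `^ p by exact: powR_ge0.
pose F (x : 'rV[R]_n) := `|u (x - y)| `^ p + `|u x| `^ p.
have mF : measurable_fun setT F by exact: mfun_add.
have F0 x : 0 <= F x by rewrite addr_ge0.
apply: (@le_trans _ _ (\int[lam]_x (3 `^ p * F x)%:E)%E).
  apply: eint_le.
  - exact: mut.
  - by move=> x; exact: powR_ge0.
  - by apply: mfun_mul => //; exact: mfun_cst.
  - move=> x; have h : `|u (x - y) - u x| <= `|u (x - y)| + `|u x| + 0.
      by rewrite addr0 ler_normB.
    have := powR_sum3_le p1 (normr_ge0 _) (normr_ge0 _) (normr_ge0 _) (lexx 0) h.
    by rewrite powR0 ?gt_eqF// addr0.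
rewrite (@eintZ _ _ _ lam _ F Sp mF F0) /F (eintD lam mT (fun x => A0 _) mup A0).
rewrite (eint_translate y mup A0) (Rint_EFin igup) -EFinD -EFinM lee_fin /bound.
by rewrite mulr_natl mulr2n.
Qed.

Let ig_modulus y : lam.-integrable setT (EFin \o (fun x => `|u (x - y) - u x| `^ p)).
Proof.
apply: (ge0_igP (mut y)) => [x|]; first exact: powR_ge0.
exact: le_lt_trans (eint_modulus_le y) (ltry _).
Qed.

Let modulus_ge0 y : 0 <= translation_modulus y.
Proof. by apply: Rintegral_ge0 => x _; exact: powR_ge0. Qed.

Let modulus_le y : translation_modulus y <= bound.
Proof. by rewrite -lee_fin -(Rint_EFin (ig_modulus y)) eint_modulus_le. Qed.

Let mjoint tau : measurable_fun setT (fun zx : RV * 'rV[R]_n =>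
  `|u (zx.2 - dilation tau zx.1.1 *: zx.1.2) - u zx.2| `^ p).
Proof.
apply: mfun_powR; apply: mfun_norm; apply: mfun_sub; last exact: measurableT_comp mu measurable_snd.
apply: (measurableT_comp mu); apply: measurable_sub2_rV; first exact: measurable_snd.
exact: measurableT_comp (measurable_dilation tau) measurable_fst.
Qed.

Definition mean_modulus (tau : R) : R :=
  \int[P]_z (mixing_weight z * translation_modulus (dilation tau z.1 *: z.2)).

Let mmodulus tau : measurable_fun setT (fun z : RV => translation_modulus (dilation tau z.1 *: z.2)).
Proof.
exact: (@mfun_Rint R _ _ _ _ lam (fun (z : RV) x =>
  `|u (x - dilation tau z.1 *: z.2) - u x| `^ p) (mjoint tau)).
Qed.

Let ig_mixing : P.-integrable setT (EFin \o mixing_weight).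
Proof.
apply: (ge0_igP measurable_mixing_weight) => [z|]; first exact: mixing_weight_ge0.
by rewrite eint_mixing_weight ltry.
Qed.

Let modulus_norm_le tau (z : RV) : `|translation_modulus (dilation tau z.1 *: z.2)| <= bound.
Proof. by rewrite ger0_norm. Qed.

(** Jensen with total mass 1, then Tonelli, in place of Minkowski's integral inequality. *)
Lemma convolution_Lp_le tau : 0 < tau ->
  (\int[lam]_x (`|\int[lam]_y (S tau (x - y)%R * u y) - u x| `^ p)%:E <=
   (mean_modulus tau)%:E)%E.
Proof.
move=> t0.
pose F (z : RV) x := `|u (x - dilation tau z.1 *: z.2) - u x| `^ p * mixing_weight z.
have F0 z x : 0 <= F z x by rewrite mulr_ge0 ?powR_ge0 ?mixing_weight_ge0.
have mF : measurable_fun setT (fun zx : RV * 'rV[R]_n => F zx.1 zx.2).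
  apply: mfun_mul; first exact: mjoint.
  exact: measurableT_comp measurable_mixing_weight measurable_fst.
have step x : ((`|\int[lam]_y (S tau (x - y)%R * u y) - u x| `^ p)%:E <=
    \int[P]_z (F z x)%:E)%E.
  pose a (z : RV) := `|u (x - dilation tau z.1 *: z.2) - u x|.
  have ma : measurable_fun setT a.
    apply: mfun_norm; apply: mfun_sub; last exact: mfun_cst.
    apply: (measurableT_comp mu); apply: measurable_sub2_rV; first exact: measurable_cst.
    exact: measurable_dilation.
  have M1 : (\int[P]_z (mixing_weight z)%:E <= 1%:E)%E by rewrite eint_mixing_weight.
  have h := le_trans (convolution_dist_le x t0 mu) (convolution_dist_mixing x t0 mu).
  have := @jensen_powR R _ _ P p 1 _ a mixing_weight p1 ltr01 (normr_ge0 _) ma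
    measurable_mixing_weight (fun z => normr_ge0 _) mixing_weight_ge0 M1 h.
  by rewrite powR1 mul1e.
apply: (@le_trans _ _ (\int[lam]_x \int[P]_z (F z x)%:E)%E).
  apply: ge0_le_integral.
  - exact: measurableT.
  - by move=> x _; rewrite lee_fin powR_ge0.
  - apply: mfun_EFin; apply: mfun_powR; apply: mfun_norm; apply: mfun_sub => //.
    apply: (@mfun_Rint R _ _ _ _ lam (fun (x y : 'rV[R]_n) => S tau (x - y) * u y)).
    apply: mfun_mul; last exact: measurableT_comp mu measurable_snd.
    apply: (measurableT_comp (measurable_subordinate H mw tau)).
    by apply: measurable_sub2_rV; [exact: measurable_fst|exact: measurable_snd].
  - exact: (measurable_fun_fubini_tonelli_G (m1 := P) _ (mfun_EFin mF)
      (fun z => F0 z.1 z.2)).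
  - by move=> x _; exact: step.
rewrite -(fubini_tonelli (m1 := P) (m2 := lam) _ (mfun_EFin mF) (fun z => F0 z.1 z.2)) /=.
rewrite /mean_modulus -(Rint_EFin (igMb ig_mixing (mmodulus tau) (modulus_norm_le tau))).
rewrite le_eqVlt; apply/orP; left; apply/eqP; apply: eq_integral => z _.
rewrite EFinM -(Rint_EFin (ig_modulus _)).
rewrite -(@eintZ _ _ _ lam _ (fun x => `|u (x - dilation tau z.1 *: z.2) - u x| `^ p)
  (mixing_weight_ge0 z) (mut _) (fun x => powR_ge0 _ _)).
by apply: eq_integral => x _; rewrite /F mulrC.
Qed.

(** For fixed [s > 0] and [z] the translation tends to 0, hence so does the modulus, which is
    bounded uniformly by [bound]. *)
Lemma mean_modulus_cvg alpha : 0 < alpha -> mean_modulus (t `^ alpha) @[t --> 0^'+] --> 0.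
Proof.
move=> a0; apply/cvg_at_rightP => t [t0 tc].
have -> : 0 = \int[P]_z (0 : R) by rewrite /Rintegral integral0_eq.
apply: (@Rint_cvg R _ _ P (fun j z => mixing_weight z * translation_modulus (dilation (t j `^ alpha) z.1 *: z.2))
  (fun=> 0) (fun z => bound * mixing_weight z)).
- exact: (@igZ R _ _ P bound mixing_weight ig_mixing).
- by move=> j; apply: mfun_mul; [exact: measurable_mixing_weight|exact: mmodulus].
- move=> [s' z] /=; pose s : R := s'; rewrite -/s; have [s0|/wN ws] := ltP 0 s; last first.
    by rewrite /mixing_weight /= ws; under eq_fun do rewrite !mul0r; exact: cvg_cst.
  have rc : dilation (t j `^ alpha) s *: z @[j --> \oo] --> (0 : 'rV[R]_n).
    have b0 : 0 < beta^-1 by rewrite invr_gt0.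
    have h1 := cvg_norm_powR a0 tc.
    have h2 : `|t j| `^ alpha * s @[j --> \oo] --> `|0 : R| `^ alpha * s.
      by apply: cvgM; [exact: h1|exact: cvg_cst].
    have := cvg_norm_powR b0 h2.
    rewrite normr0 powR0 ?gt_eqF// mul0r normr0 powR0 ?gt_eqF// => h3.
    have h4 : `| `|t j| `^ alpha * s| `^ beta^-1 *: z @[j --> \oo] --> (0 : R) *: z.
      by apply: cvgZ; [exact: h3|exact: cvg_cst].
    rewrite scale0r in h4; apply: cvg_trans h4; apply: near_eq_cvg; apply: nearW => j.
    by rewrite /dilation [`|t j|]gtr0_norm// ger0_norm// mulr_ge0 ?powR_ge0 ?(ltW s0).
  have [_ tu] := translation_continuous_Lp p1 mu uLp.
  have mod0 : translation_modulus (dilation (t j `^ alpha) s *: z) @[j --> \oo] --> 0.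
    apply/cvgrPdist_le => e e0; apply: filterS (tu _ rc e e0) => j.
    by rewrite (Rint_EFin (ig_modulus _)) lee_fin sub0r normrN ger0_norm.
  have h : mixing_weight (s, z) * translation_modulus (dilation (t j `^ alpha) s *: z) @[j --> \oo]
      --> mixing_weight (s, z) * 0.
      by apply: cvgM; [exact: cvg_cst|exact: mod0].
  by rewrite mulr0 in h.
- move=> j z; rewrite normrM [X in X * _]ger0_norm ?mixing_weight_ge0// mulrC.
  by rewrite ler_wpM2r ?mixing_weight_ge0.
Qed.

End Lp.

End approximate_identity.

(** * The fundamental solution *)

Lemma ge0_cvge0 (R : realType) (T : Type) (F : set_system T) (FF : Filter F) (f : T -> \bar R) :
  (forall x, (0 <= f x)%E) -> (forall e : R, 0 < e -> \forall x \near F, (f x <= e%:E)%E) ->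
  f @ F --> 0%E.
Proof.
move=> f0 fe; apply/fine_cvgP; split.
  apply: filterS (fe 1 ltr01) => x h; rewrite ge0_fin_numE//.
  exact: le_lt_trans h (ltry _).
apply/cvgrPdist_le => e e0; apply: filterS (fe e e0) => x h /=.
rewrite sub0r normrN ger0_norm ?fine_ge0// -lee_fin fineK//.
by rewrite ge0_fin_numE// (le_lt_trans h)// ltry.
Qed.

(** With [r = t / s >= 1] the claim is [r ^ a <= r]: the change of time does not increase relative
    increments. *)
Lemma powR_increment_le (R : realType) (a s t : R) : 0 < a <= 1 -> 0 < s -> s <= t ->
  (t `^ a - s `^ a) / s `^ a <= (t - s) / s.
Proof.
move=> /andP[a0 a1] s0 st; have t0 := lt_le_trans s0 st.
have sa : 0 < s `^ a by rewrite powR_gt0.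
rewrite !mulrBl !mulfV ?gt_eqF// lerD2r.
have -> : t `^ a / s `^ a = (t / s) `^ a.
  by rewrite powRM ?invr_ge0 ?(ltW t0) ?(ltW s0)// -[s^-1]powR_inv1 ?(ltW s0)// -powRrM mulN1r powRN.
have ts : 1 <= t / s by rewrite ler_pdivlMr// mul1r.
by rewrite -[leRHS]powRr1 ?(le_trans _ ts)//; exact: ler_powR.
Qed.

(** The condition [p < d / (d - beta)] rearranges to [(d / beta) (1 - 1 / p) < 1]; for [d <= beta]
    the latter holds for every finite [p]. *)
Lemma kappa1_exponent (R : realType) (d : nat) (beta p : R) : 0 < beta -> 1 <= p ->
  (p%:E < kappa1 d beta)%E -> 0 <= d%:R / beta * (1 - p^-1) < 1.
Proof.
move=> b0 p1; have p0 : 0 < p by apply: lt_le_trans p1.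
have q0 : 0 <= 1 - p^-1 by rewrite subr_ge0 invf_le1.
have pi0 : 0 < p^-1 by rewrite invr_gt0.
have k0 : 0 <= d%:R / beta by rewrite divr_ge0 ?(ltW b0).
rewrite mulr_ge0//= /kappa1; case: (ltP beta d%:R) => [bd|db _].
  rewrite lte_fin ltr_pdivlMr ?subr_gt0// => h.
  have -> : d%:R / beta * (1 - p^-1) = d%:R * (p - 1) / (beta * p).
    by field; rewrite !gt_eqF.
  by rewrite ltr_pdivrMr ?mulr_gt0//; move: h; set x := d%:R; lra.
have : d%:R / beta <= 1 by rewrite ler_pdivrMr// mul1r.
move=> h; apply: (@le_lt_trans _ _ (1 * (1 - p^-1))); first by rewrite ler_wpM2r.
by rewrite mul1r gtrBl.
Qed.

Section fundamental_solution.
Context {R : realType} {d : nat}.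
Local Notation lam := (lebesgue_rV d : {sigma_finite_measure set 'rV[R]_d -> \bar R}).
Local Notation leb := (@lebesgue_measure R : {sigma_finite_measure set (measurableTypeR R) -> \bar R}).
Variables (alpha beta c : R) (mu : {finite_measure set 'rV[R]_d -> \bar R}) (Galpha : R -> R -> R).
Hypothesis halpha : 0 < alpha < 1.
Hypothesis H : is_symbol (psi mu beta) beta c.
Hypothesis hG : is_frac_green alpha Galpha.

Let w := stable_weight alpha (Galpha 1).
Let cG : continuous (Galpha 1). Proof. exact: frac_green_continuous hG _ ltr01. Qed.
Let G0 u : 0 <= Galpha 1 u. Proof. exact: frac_green_ge0 hG _ _ ltr01. Qed.
Let GN u : u <= 0 -> Galpha 1 u = 0. Proof. exact: frac_green_one_sided hG _ _ ltr01. Qed.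
Let laplaceG sigma : 0 <= sigma ->
  \int[leb]_(s in `[0, +oo[) (expR (- sigma * s) * Galpha 1 s) = expR (- sigma `^ alpha).
Proof.
by move=> s0; have := frac_green_laplace hG ltr01 s0; rewrite mulN1r => <-.
Qed.

Let a0 : 0 < alpha. Proof. by case/andP: halpha. Qed.
Let b0 := symbol_beta_gt0 H.
Let mw : measurable_fun setT w. Proof. exact: measurable_stable_weight. Qed.
Let w0 s : 0 <= w s. Proof. exact: stable_weight_ge0. Qed.
Let wN s : s <= 0 -> w s = 0.
Proof. by move=> s0; rewrite /w /stable_weight indicE mem_setE in_itv/= ltNge s0 mul0r. Qed.
Let w1 : (\int[leb]_s (w s)%:E = 1)%E.
Proof. exact: (eint_stable_weight halpha cG G0 GN laplaceG). Qed.
Let moment gamma : 0 <= gamma < 1 -> finite_moment w gamma.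
Proof. exact: (stable_weight_moment halpha cG G0 GN laplaceG). Qed.

Local Notation S := (subordinate (psi mu beta) w).
Local Notation Z := (Zfun alpha beta mu Galpha).

(** An identity at every point, even where the integral over [s] diverges: both sides are then 0 by
    default, and the factor [alpha^-1] passes through by [ge0_RintZ]. *)
Lemma Zfun_subordinate t x : 0 < t -> Z t x = (S (t `^ alpha) x)%:C%C.
Proof.
move=> t0; have ta : 0 < t `^ alpha by rewrite powR_gt0.
pose W s := s `^ (- 1 - alpha^-1) * Galpha 1 (s `^ (- alpha^-1)).
pose V s := \1_(`]0, +oo[%classic : set R) s * (gk (psi mu beta) (t `^ alpha * s) x * W s).
have VE s : gk (psi mu beta) (t `^ alpha * s) x * w s = alpha^-1 * V s.
  by rewrite /w /stable_weight /V /W; ring.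
have mV : measurable_fun setT V.
  apply: mfun_mul; first exact: measurable_indic.
  apply: mfun_mul.
    apply: (measurable_gk2 H); [by mfun|exact: measurable_cst].
  apply: mfun_mul; first exact: measurable_powR.
  exact: measurableT_comp (continuous_measurable_fun cG) (measurable_powR _).
have V0 s : 0 <= V s.
  rewrite /V indicE mem_setE in_itv/= andbT; case: ltP => s0; last by rewrite mul0r.
  rewrite mul1r mulr_ge0// ?(gk_ge0 H) ?mulr_gt0//.
  by rewrite mulr_ge0 ?powR_ge0.
rewrite /Zfun /cintegral.
have -> : \int[leb]_(s in `]0, +oo[) complex.Re (green mu beta (t `^ alpha * s) x * (W s)%:C)%C =
    \int[leb]_s V s.
  rewrite /V -Rint_indic; apply: eq_Rintegral => s sI.
  have s0 : 0 < s by move: sI; rewrite inE /= in_itv/= andbT.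
  by rewrite (green_gk H) ?mulr_gt0//=; ring.
have -> : \int[leb]_(s in `]0, +oo[) complex.Im (green mu beta (t `^ alpha * s) x * (W s)%:C)%C = 0.
  rewrite /Rintegral integral0_eq// => s sI.
  have s0 : 0 < s by move: sI; rewrite /= in_itv/= andbT.
  by rewrite (green_gk H) ?mulr_gt0//=; congr EFin; ring.
have -> : S (t `^ alpha) x = alpha^-1 * \int[leb]_s V s.
  rewrite -(@ge0_RintZ _ _ _ leb _ V _ mV V0) ?invr_ge0 ?(ltW a0)//.
  by apply: eq_Rintegral => s _; exact: VE.
by rewrite /real_complex_def; simpc.
Qed.

Lemma normc_Zfun_sub t s x : 0 < t -> 0 < s ->
  Normc.normc (Z t x - Z s x) = `|S (t `^ alpha) x - S (s `^ alpha) x|.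
Proof.
by move=> t0 s0; rewrite !Zfun_subordinate// -normc_real -rmorphB.
Qed.

Let increment_le eps s t : 0 < eps -> eps <= s -> s <= t ->
  (t `^ alpha - s `^ alpha) / s `^ alpha <= eps^-1 * (t - s).
Proof.
move=> e0 es st; have s0 := lt_le_trans e0 es.
apply: (le_trans (powR_increment_le _ s0 st)); first by rewrite a0/= ltW//; case/andP: halpha.
by rewrite mulrC ler_wpM2r ?subr_ge0// lef_pV2.
Qed.

Let powR_mono s t : 0 < s -> s <= t -> s `^ alpha <= t `^ alpha.
Proof.
move=> s0 st; have t0 := lt_le_trans s0 st.
by apply: ge0_ler_powR; rewrite ?nnegrE ?(ltW a0) ?(ltW s0) ?(ltW t0).
Qed.

Lemma Zfun_lipschitz_Lp p eps : 1 <= p -> (p%:E < kappa1 d beta)%E -> 0 < eps ->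
  exists2 C : R, 0 < C & forall t s : R, eps <= t -> eps <= s ->
    (Lp_norm p%:E (fun x => (Z t x - Z s x)%R) <= (C * `|t - s|)%:E)%E.
Proof.
move=> p1 pk e0; have p0 : 0 < p by apply: lt_le_trans p1.
have ea : 0 < eps `^ alpha by rewrite powR_gt0.
have [C C0 hC] := subordinate_lipschitz H mw w0 wN ea p1 (moment (kappa1_exponent b0 p1 pk)).
have C0' : 0 < C * eps^-1 by rewrite mulr_gt0 ?invr_gt0.
exists (C * eps^-1) => //.
have key s t : eps <= s -> s <= t ->
    (\int[lam]_x (`|S (t `^ alpha) x - S (s `^ alpha) x| `^ p)%:E <=
     ((C * eps^-1 * (t - s)) `^ p)%:E)%E.
  move=> es st; have s0 := lt_le_trans e0 es.
  apply: (le_trans (hC _ _ (powR_mono e0 es) (powR_mono s0 st))).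
  have sa : 0 < s `^ alpha by rewrite powR_gt0.
  rewrite lee_fin; apply: ge0_ler_powR; rewrite ?nnegrE ?(ltW p0)//.
  - by rewrite mulr_ge0 ?(ltW C0)// divr_ge0 ?(ltW sa)// subr_ge0 powR_mono.
  - by rewrite mulr_ge0 ?(ltW C0')// subr_ge0.
  - by rewrite -mulrA ler_wpM2l ?(ltW C0)// increment_le.
move=> t s et es; have t0 := lt_le_trans e0 et; have s0 := lt_le_trans e0 es.
apply: (Lp_norm_le p0); first by rewrite mulr_ge0 ?(ltW C0').
under eq_integral do rewrite normc_Zfun_sub//.
have [st|/ltW ts] := leP s t; first by rewrite ger0_norm ?subr_ge0//; exact: key.
by under eq_integral do rewrite distrC; rewrite distrC ger0_norm ?subr_ge0//; exact: key.
Qed.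

Lemma Zfun_lipschitz_Loo eps : d%:R < beta -> 0 < eps ->
  exists2 C : R, 0 < C & forall t s : R, eps <= t -> eps <= s ->
    (Lp_norm +oo%E (fun x => (Z t x - Z s x)%R) <= (C * `|t - s|)%:E)%E.
Proof.
move=> db e0; have ea : 0 < eps `^ alpha by rewrite powR_gt0.
have k1 : 0 <= d%:R / beta < 1.
  by rewrite divr_ge0 ?(ltW b0)//= ltr_pdivrMr// mul1r.
have [C C0 hC] := subordinate_lipschitz_sup H mw w0 wN ea (moment k1).
have C0' : 0 < C * eps^-1 by rewrite mulr_gt0 ?invr_gt0.
exists (C * eps^-1) => //.
have key s t x : eps <= s -> s <= t ->
    `|S (t `^ alpha) x - S (s `^ alpha) x| <= C * eps^-1 * (t - s).
  move=> es st; have s0 := lt_le_trans e0 es.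
  apply: (le_trans (hC _ _ x (powR_mono e0 es) (powR_mono s0 st))).
  by rewrite -mulrA ler_wpM2l ?(ltW C0)// increment_le.
move=> t s et es; have t0 := lt_le_trans e0 et; have s0 := lt_le_trans e0 es.
apply: Loo_norm_le; first by rewrite mulr_ge0 ?(ltW C0').
move=> x; rewrite normc_Zfun_sub//.
have [st|/ltW ts] := leP s t; first by rewrite [X in _ * X]ger0_norm ?subr_ge0//; exact: key.
by rewrite distrC [X in _ * X]distrC [X in _ * X]ger0_norm ?subr_ge0//; exact: key.
Qed.

Lemma Zfun_in_Lp p t : 1 <= p -> (p%:E < kappa1 d beta)%E -> 0 < t -> in_Lp p%:E (Z t).
Proof.
move=> p1 pk t0; have p0 : 0 < p by apply: lt_le_trans p1.
have ta : 0 < t `^ alpha by rewrite powR_gt0.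
have ZE : Z t = fun x => (S (t `^ alpha) x)%:C%C.
  by apply/funext => x; exact: Zfun_subordinate.
have mS := measurable_subordinate H mw (t `^ alpha).
have [K K0 hK] := subordinate_powR_lty H mw w0 wN ta p1 (moment (kappa1_exponent b0 p1 pk)).
rewrite ZE; split; [exact: mS|exact: measurable_cst|].
apply: (@le_lt_trans _ _ K%:E); last exact: ltry.
apply: (Lp_norm_le p0 K0).
under eq_integral do rewrite normc_real ger0_norm ?(subordinate_ge0 H w0 wN)//.
exact: hK.
Qed.

Lemma Zfun_continuous_Lp p t : 1 <= p -> (p%:E < kappa1 d beta)%E -> 0 < t ->
  Lp_norm p%:E (fun x => Z s x - Z t x) @[s --> t] --> 0%E.
Proof.
(* The Lipschitz bound on [[t / 2, +oo[] covers a neighbourhood of [t]. *)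
move=> p1 pk t0; have t20 : 0 < t / 2 by rewrite divr_gt0.
have [C C0 hC] := Zfun_lipschitz_Lp p1 pk t20.
have t2t : t / 2 < t by rewrite ltr_pdivrMr// ltr_pMr// ltr1n.
apply: ge0_cvge0 => [s|e e0]; first exact: Lnorm_ge0.
have eC : 0 < e / C by rewrite divr_gt0.
have hn : \forall s \near t, `|t - s| <= e / C 
  by move/cvgrPdist_le : (@cvg_id _ (nbhs t)) => /(_ _ eC).
apply: filterS2 (lt_nbhsr t2t) hn => s /ltW st ts.
apply: (le_trans (hC s t st (ltW t2t))).
by rewrite lee_fin mulrC -ler_pdivlMr// distrC.
Qed.

Lemma normc_ge_Re_Im (z : R[i]) :
  `|complex.Re z| <= Normc.normc z /\ `|complex.Im z| <= Normc.normc z.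
Proof.
case: z => a b /=; rewrite /Normc.normc -[`|a|]sqrtr_sqr -[`|b|]sqrtr_sqr.
by rewrite !ler_sqrt ?addr_ge0 ?sqr_ge0// lerDl lerDr !sqr_ge0.
Qed.

Lemma normc_le_Re_Im (z : R[i]) :
  Normc.normc z <= `|complex.Re z| + `|complex.Im z|.
Proof.
case: z => a b; rewrite /Normc.normc /=.
have ab : 0 <= `|a| + `|b| by rewrite addr_ge0.
rewrite -[leRHS](ger0_norm ab) -sqrtr_sqr ler_sqrt ?sqr_ge0// sqrrD !real_normK ?num_real// addrAC lerDl.
by rewrite mulrn_wge0// mulr_ge0.
Qed.

Lemma in_Lp_powR_lty p (v : 'rV[R]_d -> R[i]) : 0 < p -> in_Lp p%:E v ->
  (\int[lam]_x (`|complex.Re (v x)| `^ p)%:E < +oo)%E /\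
  (\int[lam]_x (`|complex.Im (v x)| `^ p)%:E < +oo)%E.
Proof.
move=> p0 [mre mim voo].
have mn : measurable_fun setT (fun x => Normc.normc (v x)).
  rewrite (_ : (fun x => _) = fun x => Num.sqrt (complex.Re (v x) ^+ 2 + complex.Im (v x) ^+ 2)); last first.
    by apply/funext => x; case: (v x).
  apply: measurableT_comp; first by apply: continuous_measurable_fun; exact: sqrt_continuous.
  by apply: measurable_funD; exact: measurable_funX.
have noo : (\int[lam]_x (Normc.normc (v x) `^ p)%:E < +oo)%E.
  have pn0 : p != 0 by rewrite gt_eqF.
  have := poweR_Lnorm lam (fun x => (Normc.normc (v x))%:E) pn0.
  rewrite -/(Lp_norm p%:E v).
  have -> : (\int[lam]_x `|(Normc.normc (v x))%:E| `^ p = \int[lam]_x (Normc.normc (v x) `^ p)%:E)%E.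
    by apply: eq_integral => x _; rewrite abse_EFin ger0_norm ?normc_ge0.
  by move=> <-; exact: poweR_lty.
have np0 x : 0 <= Normc.normc (v x) `^ p by exact: powR_ge0.
split; apply: le_lt_trans noo; apply: eint_le.
- by apply: mfun_powR; exact: mfun_norm.
- by move=> x; exact: powR_ge0.
- exact: mfun_powR.
- move=> x; have [h _] := normc_ge_Re_Im (v x).
  by apply: ge0_ler_powR; rewrite ?nnegrE ?(ltW p0)// normc_ge0.
- by apply: mfun_powR; exact: mfun_norm.
- by move=> x; exact: powR_ge0.
- exact: mfun_powR.
- move=> x; have [_ h] := normc_ge_Re_Im (v x).
  by apply: ge0_ler_powR; rewrite ?nnegrE ?(ltW p0)// normc_ge0.
Qed.

Lemma convolution_Zfun t (v : 'rV[R]_d -> R[i]) x : 0 < t ->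
  convolution (Z t) v x =
  ((\int[lam]_y (S (t `^ alpha) (x - y) * complex.Re (v y))) +i*
   (\int[lam]_y (S (t `^ alpha) (x - y) * complex.Im (v y))))%C.
Proof.
move=> t0; rewrite /convolution /cintegral; congr (_ +i* _)%C; apply: eq_Rintegral => y _;
  by rewrite Zfun_subordinate//; case: (v y) => a b /=; ring.
Qed.

(** [Z t] is real, so convolution with it acts separately on the real and imaginary parts of [v],
    and the real-valued estimate applies to each. *)
Lemma Zfun_approximate_identity p (v : 'rV[R]_d -> R[i]) : 1 <= p -> in_Lp p%:E v ->
  Lp_norm p%:E (fun x => convolution (Z t) v x - v x) @[t --> 0^'+] --> 0%E.
Proof.
move=> p1 vLp; have p0 : 0 < p by apply: lt_le_trans p1.
have [mre mim _] := vLp; have [reoo imoo] := in_Lp_powR_lty p0 vLp.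
have Jre := mean_modulus_cvg H mw w0 wN w1 p1 mre reoo a0.
have Jim := mean_modulus_cvg H mw w0 wN w1 p1 mim imoo a0.
apply: ge0_cvge0 => [t|e e0]; first exact: Lnorm_ge0.
pose L : R := 3 `^ p; have L0 : 0 < L by rewrite powR_gt0.
(* Each part contributes [e1], under the factor [3 ^ p] of [powR_sum3_le]; hence the choice
   [3 ^ p * (e1 + e1) = e ^ p]. *)
pose e1 := e `^ p / L / 2; have e10 : 0 < e1 by rewrite !divr_gt0 ?powR_gt0.
have e1E : L * (e1 + e1) = e `^ p by rewrite /e1; field; rewrite gt_eqF.
move/cvgrPdist_le : Jre => /(_ _ e10) Jre; move/cvgrPdist_le : Jim => /(_ _ e10) Jim.
have pos : \forall t \near 0^'+, (0 : R) < t by exact: nbhs_right_gt.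
apply: (filterS _ (filterI pos (filterI Jre Jim))) => t [t0 [hre him]].
rewrite sub0r normrN in hre; rewrite sub0r normrN in him.
have ta : 0 < t `^ alpha by rewrite powR_gt0.
apply: (Lp_norm_le p0 (ltW e0)).
pose D (f : 'rV[R]_d -> R) x := \int[lam]_y (S (t `^ alpha) (x - y) * f y) - f x.
have mD (f : 'rV[R]_d -> R) : measurable_fun setT f -> measurable_fun setT (D f).
  move=> mf; apply: mfun_sub => //.
  apply: (@mfun_Rint R _ _ _ _ lam (fun (x y : 'rV[R]_d) => S (t `^ alpha) (x - y) * f y)).
  apply: mfun_mul; last exact: measurableT_comp mf measurable_snd.
  apply: (measurableT_comp (measurable_subordinate H mw (t `^ alpha))).
  by apply: measurable_sub2_rV; [exact: measurable_fst|exact: measurable_snd].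
pose dre := D (fun y => complex.Re (v y)); pose dim := D (fun y => complex.Im (v y)).
have mdre : measurable_fun setT dre by exact: mD.
have mdim : measurable_fun setT dim by exact: mD.
pose A x := `|dre x| `^ p; pose B x := `|dim x| `^ p.
have mA : measurable_fun setT A by apply: mfun_powR; exact: mfun_norm.
have mB : measurable_fun setT B by apply: mfun_powR; exact: mfun_norm.
have A0 x : 0 <= A x by exact: powR_ge0.
have B0 x : 0 <= B x by exact: powR_ge0.
have mAB : measurable_fun setT (fun x => A x + B x) by exact: mfun_add.
have AB0 x : 0 <= A x + B x by exact: addr_ge0.
have hA : (\int[lam]_x (A x)%:E <= e1%:E)%E.
  apply: le_trans (convolution_Lp_le H mw w0 wN w1 p1 mre reoo ta) _.
  by rewrite lee_fin; exact: le_trans (ler_norm _) hre.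
have hB : (\int[lam]_x (B x)%:E <= e1%:E)%E.
  apply: le_trans (convolution_Lp_le H mw w0 wN w1 p1 mim imoo ta) _.
  by rewrite lee_fin; exact: le_trans (ler_norm _) him.
have dE x : convolution (Z t) v x - v x = (dre x +i* dim x)%C.
  by rewrite convolution_Zfun// /dre /dim /D; case: (v x).
apply: (@le_trans _ _ (\int[lam]_x (L * (A x + B x))%:E)%E).
  under eq_integral do rewrite dE.
  apply: eint_le.
  - apply: mfun_powR; rewrite /Normc.normc.
    apply: measurableT_comp; first by apply: continuous_measurable_fun; exact: sqrt_continuous.
    by apply: mfun_add; exact: measurable_funX.
  - by move=> x; exact: powR_ge0.
  - by apply: mfun_mul => //; exact: mfun_cst.
  - move=> x; have h := normc_le_Re_Im (dre x +i* dim x)%C.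
    rewrite -[leRHS]addr0 in h.
    have := powR_sum3_le p1 (normc_ge0 _) (normr_ge0 _) (normr_ge0 _) (lexx 0) h.
    by rewrite powR0 ?gt_eqF// addr0.
rewrite (@eintZ _ _ _ lam L (fun x => A x + B x) (ltW L0) mAB AB0) (eintD lam mA A0 mB B0).
apply: (@le_trans _ _ (L%:E * (e1%:E + e1%:E))%E).
  by apply: lee_wpmul2l; [rewrite lee_fin ltW|exact: (leeD hA hB)].
by rewrite -EFinD -EFinM e1E.
Qed.

End fundamental_solution.

Theorem theorem2p5 (R : realType) (d : nat) (alpha beta : R)
    (mu : {finite_measure set 'rV[R]_d -> \bar R}) (Galpha : R -> R -> R)
    (hd : (0 < d)%N) (halpha : 0 < alpha < 1) (hbeta : 0 < beta < 2)
    (mu_sphere : mu (~` sphere) = 0%E)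
    (mu_sym : centrally_symmetric mu)
    (mu_density : has_positive_density mu)
    (omega_gt0 : forall theta, sphere theta -> 0 < omega mu beta theta)
    (omega_smooth :
      Ck_on_sphere (d + 1 + `|Num.floor beta|)%N (omega mu beta))
    (hGalpha : is_frac_green alpha Galpha) :
  let Z := Zfun alpha beta mu Galpha in
  let lipschitz_away_from_0 (p : \bar R) :=
    forall eps : R, 0 < eps ->
      exists2 C : R, 0 < C &
        forall t s : R, eps <= t -> eps <= s ->
          (Lp_norm p (fun x => (Z t x - Z s x)%R) <= (C * `|t - s|)%:E)%E in
  [/\ forall p : R, 1 <= p -> (p%:E < kappa1 d beta)%E ->
        [/\ forall t : R, 0 < t -> in_Lp p%:E (Z t),
            forall t : R, 0 < t ->
              Lp_norm p%:E (fun x => Z s x - Z t x) @[s --> t] --> 0%E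
          & lipschitz_away_from_0 p%:E],
      d%:R < beta -> lipschitz_away_from_0 +oo%E
    & forall (p : R) (v : 'rV[R]_d -> R[i]), 1 <= p -> in_Lp p%:E v ->
        Lp_norm p%:E (fun x => convolution (Z t) v x - v x) @[t --> 0^'+]
          --> 0%E].
Proof.
move=> Z lipschitz_away_from_0.
(* From here on the spectral measure enters through the properties collected in [is_symbol]. *)
have [c H] := psi_is_symbol hbeta hd omega_gt0 omega_smooth.
split=> [p p1 pk|db eps e0|p v p1 vLp].
- split=> [t t0|t t0|eps e0].
  + exact: (Zfun_in_Lp halpha H hGalpha).
  + exact: (Zfun_continuous_Lp halpha H hGalpha).
  + exact: (Zfun_lipschitz_Lp halpha H hGalpha).
- exact: (Zfun_lipschitz_Loo halpha H hGalpha).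
- exact: (Zfun_approximate_identity halpha H hGalpha).
Qed.
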